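(* Let $s>1$, $k\in\mathbb{N}$, and let $h>0$ be a small parameter. Let $W\subset\mathbb{R}^d$ be open. Suppose that $u,f\in\mathcal{G}^s(W)$ (complex-valued) and that, for some $x_0\in W$, $f(x_0)=0$, $f'(x_0)=0$ and $\mathrm{Im}\,f''(x_0)$ is positive definite. Then there exists a small open neighborhood $U\Subset W$ of $x_0$ such that $$\Bigl|\int_Ue^{\frac{i}{h}f(x)}u(x)\,dx-\Bigl(\det\Bigl(\frac{f''(x_0)}{2\pi ih}\Bigr)\Bigr)^{-\frac12}\sum_{j<k}h^jL_ju\Bigr|\le C^{k+1}\,k!^{2s-1}\,h^{k+\frac d2}.$$ Here the constant $C$ depends only on the dimension $d$ and the Gevrey constants of $u,f\in\mathcal{G}^s_{\rm b}(U)$. Writing $g_{x_0}(x)=f(x)-\frac12f''(x_0)(x-x_0)\cdot(x-x_0)$, which vanishes to third order at $x_0$, one has $$L_ju=\sum_{\nu-\mu=j}\ \sum_{2\nu\ge3\mu}\frac{i^{\mu+\nu}}{2^\nu\mu!\,\nu!}\bigl(f''(x_0)^{-1}\partial\cdot\partial\bigr)^\nu\bigl(g_{x_0}^\mu u\bigr)(x_0).$$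
   Context: $\mathbb{N}=\{0,1,2,\dots\}$. $\mathcal{G}^s(W)$ is the set of $u\in C^\infty(W)$ such that for each compact $K\subset W$ there are $A_K,C_K>0$ with $|\partial^\alpha u(x)|\le A_KC_K^{|\alpha|}\alpha!^s$ for all $\alpha\in\mathbb{N}^d$, $x\in K$. $\mathcal{G}^s_{\rm b}(U)$ is the set of $u\in C^\infty(U)$ for which there are $A,C>0$ (the Gevrey constants) with $|\partial^\alpha u(x)|\le AC^{|\alpha|}\alpha!^s$ for all $\alpha$ and all $x\in U$. In the sum for $L_j$, $\mu,\nu\in\mathbb{N}$. For a matrix $B$, $B\partial\cdot\partial=\sum_{p,q}B_{pq}\partial_{x_p}\partial_{x_q}$. The square root of the determinant is the usual branch for matrices $f''(x_0)/i$ in the convex set of symmetric complex matrices with positive definite real part, i.e. the continuous branch which is positive on real positive definite matrices, so that $\int_{\mathbb{R}^d}e^{\frac{i}{2}Bx\cdot x}dx=(\det(B/2\pi i))^{-1/2}$ for symmetric $B$ with $\mathrm{Im}\,B>0$.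
   Formalization: The constant C may also depend on s and on a lower bound λ>0 for Im f''(x_0), since dependence on d and the Gevrey constants alone fails (f=iεx²/2, u=1, k=0, ε→0); ''small h'' means 0<h<h_0, with h_0 independent of k but allowed to depend on u, f, U and their constants. *)

(* Defs.v *)
From HB Require Import structures.
From mathcomp Require Import all_boot all_order all_algebra.
From mathcomp Require Import all_classical all_reals all_analysis.
From mathcomp Require Import complex.

Set Implicit Arguments.
Unset Strict Implicit.
Unset Printing Implicit Defensive.

Import Order.TTheory GRing.Theory Num.Theory.
Import numFieldNormedType.Exports.

Local Open Scope classical_set_scope.
Local Open Scope ring_scope.

(* A complex-valued function on an open set W of R^d is encoded as a total
   function 'rV[R]_d -> R[i] that is only constrained on W. *)

Section LebesgueMeasure.
Variable R : realType.

Definition tuple_consp n (p : R * n.-tuple R) : n.+1.-tuple R :=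
  [the n.+1.-tuple R of p.1 :: p.2].

Lemma measurable_tuple_consp n :
  measurable_fun [set: measurableTypeR R * n.-tuple (measurableTypeR R)]
    (@tuple_consp n : _ -> n.+1.-tuple (measurableTypeR R)).
Proof. exact: (measurable_cons measurable_fst measurable_snd). Qed.

Section step.
Variable n : nat.
Variable m : {sigma_finite_measure set (n.-tuple (measurableTypeR R)) -> \bar R}.

Definition lebesgue_prod :
    {measure set (measurableTypeR R * n.-tuple (measurableTypeR R)) -> \bar R} :=
  (@lebesgue_measure R \x m)%E.

Definition lebesgue_cons : set (n.+1.-tuple (measurableTypeR R)) -> \bar R :=
  pushforward lebesgue_prod (@tuple_consp n).

Let mcons A : measurable A -> measurable (@tuple_consp n @^-1` A :
  set (measurableTypeR R * n.-tuple (measurableTypeR R))).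
Proof.
by move=> mA; rewrite -[X in measurable X]setTI; apply: measurable_tuple_consp.
Qed.

Let lebesgue_cons0 : lebesgue_cons set0 = 0%E.
Proof. by rewrite /lebesgue_cons /pushforward preimage_set0 measure0. Qed.

Let lebesgue_cons_ge0 A : (0 <= lebesgue_cons A)%E.
Proof. exact: (measure_ge0 lebesgue_prod). Qed.

Let lebesgue_cons_sigma_additive : semi_sigma_additive lebesgue_cons.
Proof.
move=> F mF tF mUF; rewrite /lebesgue_cons /pushforward preimage_bigcup.
apply: (measure_semi_sigma_additive (s := lebesgue_prod)).
- by move=> k; apply: mcons; apply: mF.
- apply/trivIsetP => /= i j _ _ ij; rewrite -preimage_setI.
  by move/trivIsetP : tF => /(_ _ _ _ _ ij) ->//; rewrite preimage_set0.
- by rewrite -preimage_bigcup; apply: mcons.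
Qed.

HB.instance Definition _ := isMeasure.Build _ _ _ lebesgue_cons
  lebesgue_cons0 lebesgue_cons_ge0 lebesgue_cons_sigma_additive.

Let lebesgue_cons_sigma_finite : sigma_finite setT lebesgue_cons.
Proof.
have /sigma_finiteP[F [TF ndF Foo]] := sigma_finiteT (@lebesgue_measure R).
have /sigma_finiteP[G [TG ndG Goo]] := sigma_finiteT m.
exists (fun k => [set t | F k (thead t) /\ G k [tuple of behead t]]).
  rewrite predeqE => t; split=> // _.
  have : setT (thead t) by [].
  rewrite TF => -[i _ Fi].
  have : setT [tuple of behead t] by [].
  rewrite TG => -[j _ Gj].
  exists (maxn i j) => //=; split.
  - by move: Fi; exact/subsetPset/ndF/leq_maxl.
  - by move: Gj; exact/subsetPset/ndG/leq_maxr.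
move=> k; have [mF Fk] := Foo k; have [mG Gk] := Goo k; split.
  rewrite (_ : [set _ | _] =
    (@tnth _ (measurableTypeR R) ^~ ord0) @^-1` F k `&`
    (fun t : n.+1.-tuple (measurableTypeR R) => [tuple of behead t]) @^-1` G k).
    apply: measurableI.
    - by rewrite -[X in measurable X]setTI; exact: (measurable_tnth ord0).
    - by rewrite -[X in measurable X]setTI; exact: measurable_behead.
  by apply/seteqP; split.
rewrite /lebesgue_cons /pushforward.
rewrite (_ : _ @^-1` _ = F k `*` G k); last first.
  rewrite predeqE => -[x t] /=; rewrite /tuple_consp /= theadE.
  have -> : [tuple of behead (x :: t)] = t by apply/val_inj.
  by [].
rewrite [ltLHS](product_measure1E (@lebesgue_measure R) m mF mG).
by rewrite lte_mul_pinfty// ge0_fin_numE.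
Qed.

HB.instance Definition _ := Measure_isSigmaFinite.Build _ _ _ lebesgue_cons
  lebesgue_cons_sigma_finite.

End step.

(* The d-fold product of the Lebesgue measure of R, carried from nested pairs
   over to tuples. *)
Fixpoint lebesgue_tuple (d : nat) :
    {sigma_finite_measure set (d.-tuple (measurableTypeR R)) -> \bar R} :=
  match d with
  | 0 => [the {sigma_finite_measure set _ -> \bar R} of \d_ [tuple]]
  | d'.+1 => [the {sigma_finite_measure set _ -> \bar R} of
               lebesgue_cons (lebesgue_tuple d')]
  end.

End LebesgueMeasure.

Section Defs.
Variable R : realType.
Variable d : nat.
Local Open Scope complex_scope.

Local Notation C := R[i].
Local Notation re := (@complex.Re R).
Local Notation im := (@complex.Im R).
Local Notation point := 'rV[R]_d.

Definition cexp (z : C) : C :=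
  (expR (re z) * cos (im z)) +i* (expR (re z) * sin (im z)).

Definition row_of_tuple (t : d.-tuple R) : point := \row_i tnth t i.

Definition cintegral (U : set point) (F : point -> C) : C :=
  (\int[lebesgue_tuple R d]_(t in row_of_tuple @^-1` U) re (F (row_of_tuple t)))
  +i*
  (\int[lebesgue_tuple R d]_(t in row_of_tuple @^-1` U) im (F (row_of_tuple t))).

Definition rel_compact_in (U W : set point) : Prop :=
  compact (closure U) /\ closure U `<=` W.

Definition pderiv (i : 'I_d) (u : point -> C) : point -> C := fun x =>
  ('D_(delta_mx 0 i) (re \o u) x) +i* ('D_(delta_mx 0 i) (im \o u) x).

Definition smooth_on (W : set point) (u : point -> C) : Prop :=
  forall (l : seq 'I_d) (x : point), W x ->
    let v := foldr pderiv u l in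
    [/\ {for x, continuous (re \o v)}, {for x, continuous (im \o v)} &
        forall i : 'I_d, derivable (re \o v) x (delta_mx 0 i) /\
                         derivable (im \o v) x (delta_mx 0 i)].

Implicit Types (alpha : {ffun 'I_d -> nat}).

Definition mderiv alpha (u : point -> C) : point -> C :=
  foldr (fun i v => iter (alpha i) (pderiv i) v) u (enum 'I_d).

Definition msize alpha : nat := (\sum_i alpha i)%N.
Definition mfact alpha : nat := (\prod_i (alpha i)`!)%N.

Definition gevrey_bound (s : R) (K : set point) (u : point -> C) (A B : R) :
    Prop :=
  forall alpha x, K x ->
    `|mderiv alpha u x| <= (A * B ^+ msize alpha * (mfact alpha)%:R `^ s)%:C.

Definition gevrey (s : R) (W : set point) (u : point -> C) : Prop :=
  smooth_on W u /\
  forall K : set point, compact K -> K `<=` W ->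
    exists A B : R, [/\ 0 < A, 0 < B & gevrey_bound s K u A B].

Definition gevrey_b_with (s : R) (U : set point) (u : point -> C) (A B : R) :
    Prop :=
  [/\ smooth_on U u, 0 < A, 0 < B & gevrey_bound s U u A B].

Definition hessian (f : point -> C) (x : point) : 'M[C]_d :=
  \matrix_(p, q) pderiv p (pderiv q f) x.

Definition posdef (M : 'M[R]_d) : Prop :=
  forall v : point, v != 0 -> 0 < (v *m M *m v^T) 0 0.

Definition re_posdef_sym : set 'M[C]_d :=
  [set B | B^T = B /\ posdef (map_mx re B)].

(* [R[i]^o] only serves to give R[i] its usual topology.  In the order of R[i],
   0 < z means that z is a positive real number. *)
Definition is_sqrt_det (phi : 'M[C]_d -> C) : Prop :=
  [/\ {within (re_posdef_sym : set 'M[C^o]_d), continuous (phi : _ -> C^o)},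
      forall B, re_posdef_sym B -> phi B ^+ 2 = \det B &
      forall B, re_posdef_sym B -> (forall p q, im (B p q) = 0) -> 0 < phi B].

(* [re_posdef_sym] is convex and \det does not vanish on it, so a branch exists
   and any two agree on it; the default value 0 is never used. *)
Definition sqrt_det : 'M[C]_d -> C := xget (fun=> 0) [set phi | is_sqrt_det phi].

Definition quad_op (B : 'M[C]_d) (v : point -> C) : point -> C := fun x =>
  \sum_p \sum_q B p q * pderiv p (pderiv q v) x.

Definition cubic_part (f : point -> C) (x0 : point) : point -> C := fun x =>
  let y := map_mx (real_complex R) (x - x0) in
  f x - 2^-1 * (y *m hessian f x0 *m y^T) 0 0.

(* The two conditions on mu and nu force mu <= 2 j and nu <= 3 j, so the finite
   ranges omit no term. *)
Definition Lop (f : point -> C) (x0 : point) (j : nat) (u : point -> C) : C :=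
  \sum_(nu < (3 * j).+1) \sum_(mu < (2 * j).+1 |
      (nu == mu + j :> nat)%N && (3 * mu <= 2 * nu)%N)
    ('i%C ^+ (mu + nu) / (2 ^+ nu * (mu`!)%:R * (nu`!)%:R)) *
    iter nu (quad_op (invmx (hessian f x0)))
      (fun x => cubic_part f x0 x ^+ mu * u x) x0.

Definition oscillatory_integral (h : R) (U : set point) (f u : point -> C) : C :=
  cintegral U (fun x => cexp ('i%C / h%:C * f x) * u x).

Definition stationary_expansion (h : R) (k : nat) (f u : point -> C)
    (x0 : point) : C :=
  (sqrt_det (((2 * pi * h)%:C * 'i%C)^-1 *: hessian f x0))^-1 *
  \sum_(j < k) h%:C ^+ j * Lop f x0 j u.

End Defs.

(* Main.v *)
(* Put [y = x - x0] and [B = f''(x0)].  The factor [exp (i B y . y / 2 h)] is a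
   complex Gaussian; integrating by parts against it (Wick's formula) evaluates
   the integral of every polynomial, and the integral [J] of the Gaussian itself
   satisfies [J^2 det = const], by differentiating along the segment from the
   identity; since [J] is continuous and positive on real matrices, it is the
   prescribed branch of the square root.  Hence the expansion is the integral
   over all of R^d of the Gaussian times a polynomial [P (y)], the expansion of
   [exp (i g / h) u] in jets at [x0] with the terms of order less than [2 k].

   It remains to bound [exp (i f / h) u] on [U] minus [P] times the Gaussian
   pointwise.  By the Gevrey bounds, the jets of order [l <= 2 k] are dominated by
   [theta^l] with [theta] of size [|y| k^(s-1)], and majorant series give an error
   [(M theta)^(2 k)] times half of the Gaussian decay, first where [M theta <= 1],
   then everywhere by the trivial bound.  Integrating [|y|^(2 k)] against the
   remaining Gaussian produces [h^(k + d/2) k!], and [k^(2 k (s-1))] becomes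
   [k!^(2 s - 2)].  Outside [U] with [M theta < 1] only finitely many [k] occur,
   and the Gaussian is smaller than [h^k] there for small [h]. *)

Require Import Defs.
From mathcomp Require Import all_boot all_order all_algebra.
From mathcomp Require Import all_classical all_reals all_analysis.
From mathcomp Require Import complex measurable_realfun.
From mathcomp Require Import ring lra zify.

Set Implicit Arguments.
Unset Strict Implicit.
Unset Printing Implicit Defensive.

Import Order.TTheory GRing.Theory Num.Theory.
Import numFieldNormedType.Exports.

Local Open Scope classical_set_scope.
Local Open Scope ring_scope.

Import Normc.

#[local] Arguments Normc.normc : simpl never.
#[local] Arguments cexp : simpl never.
#[local] Arguments pderiv : simpl never.

Local Notation re := (@complex.Re _).
Local Notation im := (@complex.Im _).

(** * Complex numbers and one-variable calculus *)

(** The constant may depend neither on [k] nor on the size of U, while for s > 1 the Taylor series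
    of u and f need not converge. The way out is a scale that depends on [k]: for l <= 2 k a factor
    l!^(s-1) is at most (2 (k+1))^((s-1) l), so up to that order the jets obey geometric bounds,
    like those of an analytic function whose radius of convergence shrinks like k^(1-s). The
    threshold [M theta = 1] involves only the dimension, s, the Gevrey constants and [lam]. U is
    shrunk only to get |g| <= Im f''(x0) y . y / 4, a bound with an absolute constant which leaves
    exp (i f / h) half of the Gaussian decay; the radius of U then enters only through the
    admissible range of [h]. Writing E for Im f''(x0) y . y / h, the Gaussian has modulus exp (- E /
    2), and this exponent is spent in portions: E / 16 on a majorized exponential, E / 4 on g. Of
    what remains at least lam |y|^2 / (8 h) is kept, one half for the moments of order 2 k and one
    half for integrability. *)

Section ComplexModulus.
Variable R : realType.
Implicit Types (z w : R[i]) (a b : R).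

Lemma normc_ge0 z : 0 <= normc z.
Proof. by case: z => a b; exact: sqrtr_ge0. Qed.

Lemma ReD z w : re (z + w) = re z + re w. Proof. by case: z; case: w. Qed.
Lemma ImD z w : im (z + w) = im z + im w. Proof. by case: z; case: w. Qed.
Lemma ReN z : re (- z) = - re z. Proof. by case: z. Qed.
Lemma ReB z w : re (z - w) = re z - re w. Proof. by case: z; case: w. Qed.
Lemma ImB z w : im (z - w) = im z - im w. Proof. by case: z; case: w. Qed.
Lemma ReM z w : re (z * w) = re z * re w - im z * im w.
Proof. by case: z; case: w. Qed.
Lemma ImM z w : im (z * w) = re z * im w + im z * re w.
Proof. by case: z; case: w. Qed.
Lemma ReZ a z : re (a%:C%C * z) = a * re z.
Proof. by rewrite ReM/= mul0r subr0. Qed.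
Lemma ImZ a z : im (a%:C%C * z) = a * im z.
Proof. by rewrite ImM/= mul0r addr0. Qed.

Lemma Re_sum (I : Type) (r : seq I) (P : pred I) (F : I -> R[i]) :
  re (\sum_(i <- r | P i) F i) = \sum_(i <- r | P i) re (F i).
Proof. exact: (big_morph _ ReD (erefl _)). Qed.

Lemma Im_sum (I : Type) (r : seq I) (P : pred I) (F : I -> R[i]) :
  im (\sum_(i <- r | P i) F i) = \sum_(i <- r | P i) im (F i).
Proof. exact: (big_morph _ ImD (erefl _)). Qed.

Lemma complex_eqP z w : re z = re w -> im z = im w -> z = w.
Proof. by case: z w => a b [c d] /= -> ->. Qed.

Lemma normcD z w : normc (z + w) <= normc z + normc w.
Proof. exact: le_normcD. Qed.

Lemma normcB z w : normc (z - w) <= normc z + normc w.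
Proof. by rewrite (le_trans (normcD _ _))// normcN. Qed.

Lemma normcX z n : normc (z ^+ n) = normc z ^+ n.
Proof.
elim: n => [|n ih]; first by rewrite !expr0 -[LHS]/(normc 1%C) normc1.
by rewrite !exprS normcM ih.
Qed.

Lemma normc_real a : normc (a%:C)%C = `|a|.
Proof. by rewrite /normc /= expr0n addr0 sqrtr_sqr. Qed.

Lemma normc_i : normc ('i%C : R[i]) = 1.
Proof. by rewrite /normc /= expr0n add0r expr1n sqrtr1. Qed.

Lemma normc_sum (I : Type) (r : seq I) (P : pred I) (F : I -> R[i]) :
  normc (\sum_(i <- r | P i) F i) <= \sum_(i <- r | P i) normc (F i).
Proof.
elim/big_rec2 : _ => [|i x y _ h]; first by rewrite -[X in X <= _]/(normc 0%C) normc0.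
by rewrite (le_trans (normcD _ _))// lerD2l.
Qed.

Lemma normr_Re z : `|re z| <= normc z.
Proof. by rewrite -lecR; exact: normc_ge_Re. Qed.

Lemma normr_Im z : `|im z| <= normc z.
Proof.
case: z => a b; rewrite /normc /= -sqrtr_sqr; apply: ler_wsqrtr.
by rewrite lerDr sqr_ge0.
Qed.

Lemma normc_le_ReIm z : normc z <= `|re z| + `|im z|.
Proof.
case: z => a b; rewrite /normc /= -(ler_pXn2r (n := 2)) ?nnegrE ?sqrtr_ge0 ?addr_ge0//.
rewrite sqr_sqrtr ?addr_ge0 ?sqr_ge0// sqrrD !real_normK ?num_real//.
by rewrite -addrA lerD2l lerDr mulrn_wge0// mulr_ge0.
Qed.

Lemma normc_le2 z (M : R) : `|re z| <= M -> `|im z| <= M -> normc z <= 2 * M.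
Proof.
by move=> h1 h2; rewrite (le_trans (normc_le_ReIm z))// mulr2n mulrDl mul1r lerD.
Qed.

Lemma normc_gt0 z : z != 0 -> 0 < normc z.
Proof.
move=> z0; rewrite lt_neqAle normc_ge0 andbT eq_sym.
by apply: contra_neq z0; exact: eq0_normc.
Qed.

Lemma normcVnat n : normc (n%:R^-1 : R[i]) = n%:R^-1.
Proof. by rewrite -(rmorph_nat (real_complex R)) -fmorphV normc_real ger0_norm. Qed.

Lemma realC_neq0 a : a != 0 -> a%:C%C != 0.
Proof. by apply: contra_neq => /(congr1 (@complex.Re R)). Qed.

Lemma mulCii : 'i%C * 'i%C = -1 :> R[i]. Proof. by rewrite -expr2 sqr_i. Qed.

Lemma Ci_neq0 : 'i%C != 0 :> R[i].
Proof. by apply: contra_eq_neq mulCii => ->; rewrite mul0r eq_sym oppr_eq0 oner_neq0. Qed.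

Lemma inv_realCi a : (a%:C%C * 'i%C)^-1 = - ('i%C / a%:C%C).
Proof.
rewrite invfM mulrC -mulNr; congr (_ * _).
by apply: (mulfI Ci_neq0); rewrite mulfV ?Ci_neq0// mulrN mulCii opprK.
Qed.

Lemma Re_idiv a z : re ('i%C / a%:C%C * z) = - (im z / a).
Proof. by rewrite -fmorphV mulrAC mulrC ReZ ReM /= mul0r mul1r sub0r mulrN mulrC. Qed.

Lemma le_of_eq a b : a = b -> a <= b. Proof. by move=> ->. Qed.

End ComplexModulus.

Section DerivativeOnTheLine.
Variable R : realType.

(** Division-free form of a directional derivative. It also holds at h = 0, so derivatives are
    restricted to lines, reflected and translated by rewriting increments. *)
Lemma is_derive_epsP (V : normedModType R) (f : V -> R) (x v : V) (df : R) :
  is_derive x v f df <->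
  forall e : R, 0 < e -> exists2 r : R, 0 < r &
    forall h : R, `|h| < r -> `|f (x + h *: v) - f x - h * df| <= e * `|h|.
Proof.
split=> [Df e e0|Df].
  have := @ex_derive _ _ _ _ _ _ _ Df; rewrite /derivable => /cvg_ex[l fl].
  have ldf : l = df.
    have := @derive_val _ _ _ _ _ _ _ Df; rewrite /derive => <-.
    by apply/esym/cvg_lim.
  rewrite ldf in fl.
  have /cvgrPdist_le/(_ _ e0)[r /= r0 hr] := fl.
  exists r => // h hr'.
  have [->|h0] := eqVneq h 0.
    by rewrite scale0r addr0 subrr mul0r subrr normr0 mulr0.
  have := hr h; rewrite /= sub0r normrN => /(_ hr' h0).
  rewrite distrC => H.
  rewrite (_ : _ - _ = h * (h^-1 *: ((f \o shift x) (h *: v) - f x) - df)).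
    by rewrite normrM mulrC ler_wpM2r.
  by rewrite mulrBr /= -[h^-1 *: _]/(h^-1 * _) mulrA divff// mul1r (addrC x).
have fl : h^-1 *: ((f \o shift x) (h *: v) - f x) @[h --> 0^'] --> df.
  apply/cvgrPdist_le => e e0; have [r r0 hr] := Df e e0.
  exists r => //= h; rewrite /ball_ /= sub0r normrN => hr' h0.
  have /= := hr _ hr'.
  rewrite (_ : _ - _ - _ = - (h * (df - h^-1 *: ((f \o shift x) (h *: v) - f x)))).
    rewrite normrN normrM mulrC ler_pM2r ?normr_gt0//.
  rewrite mulrBr /= -[h^-1 *: _]/(h^-1 * _) mulrA divff// mul1r opprB.
  by rewrite (addrC x).
apply: DeriveDef; first by apply/cvg_ex; exists df.
by rewrite /derive; apply/cvg_lim.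
Qed.

Lemma is_derive_line (V : normedModType R) (f : V -> R) (x v : V) (t df : R) :
  is_derive (x + t *: v) v f df <-> is_derive t 1 (fun s => f (x + s *: v)) df.
Proof.
rewrite !is_derive_epsP; split=> H e e0; have [r r0 hr] := H e e0; exists r => //.
  move=> h hh; rewrite -[h *: 1]/(h * 1) mulr1 scalerDl addrA; exact: hr.
move=> h hh; have := hr h hh.
by rewrite -[h *: 1]/(h * 1) mulr1 scalerDl addrA.
Qed.

Lemma is_derive_conv (V : normedModType R) (f g : V -> R) (x v : V) (df dg : R) :
  is_derive x v f df -> f =1 g -> df = dg -> is_derive x v g dg.
Proof. by move=> + /funext fg <-; rewrite fg. Qed.

(** The interval is symmetric about [a], so that callers need not know the sign of [b - a]; the case
    b < a is reduced to the other by x -> - x. *)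
Lemma mean_value (f df : R -> R) (a b : R) :
  (forall x, `|x - a| <= `|b - a| -> is_derive x 1 f (df x)) ->
  exists2 c, `|c - a| <= `|b - a| & f b - f a = df c * (b - a).
Proof.
move=> Df.
wlog ab : f df a b Df / a <= b => [H|].
  have [ab|/ltW ba] := leP a b; first exact: H.
  have := H (fun x => f (- x)) (fun x => - df (- x)) (- a) (- b).
  rewrite lerN2 => /(_ _ ba)[].
    move=> x xb; apply/is_derive_epsP => e e0.
    have /is_derive_epsP/(_ e e0)[r r0 hr] : is_derive (- x) 1 f (df (- x)).
      apply: Df; move: xb; rewrite -normrN opprD opprK => /le_trans->//.
      by rewrite -normrN opprD !opprK.
    exists r => // h hr'; have := hr (- h); rewrite normrN => /(_ hr').
    by rewrite -![_ *: 1]/(_ * 1) !mulr1 opprD mulrN mulNr.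
  rewrite !opprK => c hc E; exists (- c).
    rewrite -normrN opprD !opprK; apply: (le_trans hc).
    by rewrite -normrN opprD !opprK.
  by rewrite E mulNr -mulrN opprD !opprK.
have Df' (x : R) : x \in `[a, b] -> is_derive x 1 f (df x).
  rewrite in_itv/= => /andP[ax xb]; apply: Df.
  by rewrite !ger0_norm ?subr_ge0// lerD2r.
have Doo (x : R) : x \in `]a, b[ -> is_derive x 1 f (df x).
  by move=> /subset_itv_oo_cc; exact: Df'.
have cf : {within `[a, b], continuous f}.
  by apply: derivable_within_continuous => x xab; exact: (@ex_derive _ _ _ _ _ _ _ (Df' x xab)).
have [c cab E] := MVT_segment ab Doo cf.
exists c => //; move: cab; rewrite in_itv/= => /andP[ac cb].
by rewrite !ger0_norm ?subr_ge0// lerD2r.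
Qed.

(** The remainder of order N + 1 has as derivative the remainder of order N of the shifted family,
    which the induction bounds by M t^N / N!. *)
Lemma taylor_bound (f : nat -> R -> R) (N : nat) (M : R) :
  (forall n (t : R), (n < N)%N -> 0 <= t <= 1 -> is_derive t 1 (f n) (f n.+1 t)) ->
  (forall t : R, 0 <= t <= 1 -> `|f N t| <= M) ->
  forall t : R, 0 <= t <= 1 ->
  `|f 0%N t - \sum_(n < N) f n 0 * t ^+ n / n`!%:R| <= M * t ^+ N / N`!%:R.
Proof.
elim: N f => [|N ih] f Df fM t t01.
  by rewrite big_ord0 subr0 expr0 mulr1 fact0 divr1; exact: fM.
have {}ih := ih (fun n => f n.+1) (fun n t nN => Df n.+1 t nN) fM.
pose p s := \sum_(n < N.+1) f n 0 * s ^+ n / n`!%:R.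
pose p' s := \sum_(n < N) f n.+1 0 * s ^+ n / n`!%:R.
have Dmon (n : nat) (c s : R) :
    is_derive s 1 (fun s => c * s ^+ n.+1 / n.+1`!%:R) (c * s ^+ n / n`!%:R).
  have : is_derive s 1 ((c / n.+1`!%:R) \*: (fun s : R => s ^+ n.+1))
      ((c / n.+1`!%:R) *: (n.+1%:R * s ^+ n *: 1)).
    apply: is_deriveZ.
    apply: is_derive_conv (@is_deriveX R R id n.+1 s 1 1 (is_derive_id _ _)) _ _ => //.
    by move=> u; elim: (n.+1) => // m ih'; rewrite !exprS -ih'.
  rewrite (_ : (_ \*: _) = (fun s : R => c * s ^+ n.+1 / n.+1`!%:R)); last first.
    by apply/funext => u /=; rewrite -[_ *: _]/(_ * _) mulrAC.
  rewrite (_ : _ *: _ = c * s ^+ n / n`!%:R)//.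
  rewrite -[(_ *: 1)]/(_ * 1) mulr1 -[_ *: _]/(_ * _) factS natrM invfM.
  rewrite -!mulrA; congr (_ * _); rewrite (mulrC _ (n`!%:R^-1 * _)) mulrA.
  have nz : (n.+1%:R : R) != 0 by rewrite pnatr_eq0.
  by rewrite (mulrC _ n.+1%:R) -!mulrA mulrC -!mulrA mulVf// mulr1 mulrC.
have Dp (s : R) : is_derive s 1 p (p' s).
  rewrite (_ : p = cst (f 0 0) + \sum_(n < N) (fun s => f n.+1 0 * s ^+ n.+1 / n.+1`!%:R)); last first.
    apply/funext => u; rewrite /p big_ord_recl/= expr0 mulr1 fact0 divr1.
    by rewrite fctE fct_sumE.
  rewrite -[p' s]add0r; apply: is_deriveD; apply: is_derive_sum => i; exact: Dmon.
(* The two signs give the two halves of the absolute value. The signed remainder minus its claimed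
   bound vanishes at 0 and has nonpositive derivative. *)
have key (sg : bool) : 0 <= t -> (-1) ^+ sg * (f 0 t - p t) <= M * t ^+ N.+1 / N.+1`!%:R.
  move=> t0.
  pose g s := (-1) ^+ sg * (f 0 s - p s) - M * s ^+ N.+1 / N.+1`!%:R.
  pose g' s := (-1) ^+ sg * (f 1 s - p' s) - M * s ^+ N / N`!%:R.
  have H0 : g 0 = 0.
    rewrite /g /p big_ord_recl/= expr0 mulr1 fact0 divr1 big1 ?addr0 => [|i _].
      by rewrite subrr mulr0 exprS !mul0r mulr0 mul0r subr0.
    by rewrite exprS mul0r mulr0 mul0r.
  have itvP (s : R) : s \in `[0, t] -> is_derive s 1 g (g' s).
    rewrite in_itv/= => /andP[s0 st].
    have Ds : is_derive s 1 (f 0%N) (f 1%N s).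
      by apply: Df => //; rewrite s0 (le_trans st)// (andP t01).2.
    have D1 := is_deriveZ ((-1) ^+ sg) (is_deriveB Ds (Dp s)).
    exact: is_derive_conv (is_deriveB D1 (Dmon N M s)) (frefl _) (erefl _).
  have Doo (s : R) : s \in `]0, t[ -> is_derive s 1 g (g' s).
    by move=> /subset_itv_oo_cc; exact: itvP.
  have cg : {within `[0, t], continuous g}.
    by apply: derivable_within_continuous => x xab; exact: (@ex_derive _ _ _ _ _ _ _ (itvP x xab)).
  have [c] := MVT_segment t0 Doo cg.
  rewrite in_itv/= H0 subr0 => /andP[c0 ct] gt.
  rewrite -subr_le0 -/(g t) gt subr0; apply: mulr_le0_ge0 => //; rewrite /g' subr_le0.
  have := ih c; rewrite c0 (le_trans ct) ?(andP t01).2// => /(_ isT).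
  apply: le_trans; apply: le_trans (ler_norm _) _.
  by rewrite normrM normrX normrN1 expr1n mul1r.
have t0 : 0 <= t by case/andP: t01.
rewrite ler_norml lerNl; apply/andP; split.
  by have := key true t0; rewrite expr1 mulN1r.
by have := key false t0; rewrite expr0 mul1r.
Qed.

End DerivativeOnTheLine.

Section ComplexDerivatives.
Variables (R : realType) (V : normedModType R).
Implicit Types (u v F : V -> R[i]) (x y : V) (c : R[i]).

Definition is_cdir x y v c :=
  is_derive x y (re \o v) (re c) /\ is_derive x y (im \o v) (im c).

Lemma cdirD x y u v a b : is_cdir x y u a -> is_cdir x y v b ->
  is_cdir x y (fun z => u z + v z) (a + b).
Proof.
move=> [D1 D2] [E1 E2]; split.
- by apply: is_derive_conv (is_deriveD D1 E1) _ _ => [z|]; rewrite ?[in RHS]/= ReD.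
- by apply: is_derive_conv (is_deriveD D2 E2) _ _ => [z|]; rewrite ?[in RHS]/= ImD.
Qed.

Lemma cdirM x y u v a b : is_cdir x y u a -> is_cdir x y v b ->
  is_cdir x y (fun z => u z * v z) (a * v x + u x * b).
Proof.
move=> [D1 D2] [E1 E2]; split.
- apply: is_derive_conv (is_deriveB (is_deriveM D1 E1) (is_deriveM D2 E2)) _ _ => [z|].
    by rewrite [in RHS]/= ReM.
  by rewrite ReD !ReM -![_ *: _]/(_ * _) /=; ring.
- apply: is_derive_conv (is_deriveD (is_deriveM D1 E2) (is_deriveM D2 E1)) _ _ => [z|].
    by rewrite [in RHS]/= ImM.
  by rewrite ImD !ImM -![_ *: _]/(_ * _) /=; ring.
Qed.

Lemma cdir_cst x y c : is_cdir x y (fun=> c) 0.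
Proof. by split; exact: is_derive_cst. Qed.

Lemma cdir_sum (I : Type) (r : seq I) (F : I -> V -> R[i]) (c : I -> R[i]) x y :
  (forall i, is_cdir x y (F i) (c i)) ->
  is_cdir x y (fun z => \sum_(i <- r) F i z) (\sum_(i <- r) c i).
Proof.
move=> DF; elim: r => [|i r ih].
  rewrite big_nil; under eq_fun do rewrite big_nil.
  exact: cdir_cst.
rewrite big_cons; under eq_fun do rewrite big_cons.
exact: cdirD.
Qed.

Lemma cdirZ x y v c a : is_cdir x y v a -> is_cdir x y (fun z => c * v z) (c * a).
Proof.
by move=> Dv; have := cdirM (cdir_cst x y c) Dv; rewrite mul0r add0r.
Qed.

(** Restricting to the line through [x] in direction [y] makes the one-variable chain rule
    applicable. *)
Lemma cdir_cexp F x y c : is_cdir x y F c -> is_cdir x y (fun z => cexp (F z)) (c * cexp (F x)).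
Proof.
have line (g : V -> R) (dg : R) : is_derive x y g dg <-> is_derive (0 : R) 1 (fun s : R => g (x + s *: y)) dg.
  by rewrite -is_derive_line scale0r addr0.
move=> [/line D1 /line D2].
have De : is_derive (0 : R) 1 (fun s : R => expR (re (F (x + s *: y)))) (re c * expR (re (F x))).
  have := is_derive1_comp (is_derive_expR _) D1.
  by rewrite /= scale0r addr0 mulrC.
have Dc : is_derive (0 : R) 1 (fun s : R => cos (im (F (x + s *: y)))) (- im c * sin (im (F x))).
  have := is_derive1_comp (is_derive_cos _) D2.
  by rewrite /= scale0r addr0 mulrC mulrN mulNr.
have Ds : is_derive (0 : R) 1 (fun s : R => sin (im (F (x + s *: y)))) (im c * cos (im (F x))).
  have := is_derive1_comp (is_derive_sin _) D2.
  by rewrite /= scale0r addr0 mulrC.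
split; apply/line.
- apply: is_derive_conv (is_deriveM De Dc) _ _ => [s //|].
  by rewrite scale0r addr0 ReM -![_ *: _]/(_ * _) /cexp /=; ring.
- apply: is_derive_conv (is_deriveM De Ds) _ _ => [s //|].
  by rewrite scale0r addr0 ImM -![_ *: _]/(_ * _) /cexp /=; ring.
Qed.

End ComplexDerivatives.

Notation is_cderive t := (is_cdir t 1).

Section ComplexExponential.
Variable R : realType.
Implicit Types (z w : R[i]) (a b : R).

(** The factor 2 is the price of treating real and imaginary parts separately. *)
Lemma taylor_cbound (F : nat -> R -> R[i]) (N : nat) (M : R) :
  (forall n (t : R), (n < N)%N -> 0 <= t <= 1 -> is_cderive t (F n) (F n.+1 t)) ->
  (forall t : R, 0 <= t <= 1 -> normc (F N t) <= M) ->
  normc (F 0%N 1 - \sum_(n < N) F n 0 / n`!%:R) <= 2 * (M / N`!%:R).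
Proof.
move=> DF FM.
have E (z : R[i]) (n : nat) : z / n`!%:R = (n`!%:R^-1)%:C%C * z.
  by rewrite fmorphV rmorph_nat mulrC.
have h1 : 0 <= (1 : R) <= 1 by rewrite ler01 lexx.
apply: normc_le2.
- have := @taylor_bound R (fun n t => re (F n t)) N M _ _ 1 h1.
  rewrite expr1n mulr1 ReB Re_sum => H.
  rewrite (eq_bigr (fun n : 'I_N => re (F n 0) * 1 ^+ n / n`!%:R)); last first.
    by move=> n _; rewrite E ReZ expr1n mulr1 mulrC.
  apply: H => [n t nN t01|t t01]; first by have [] := DF n t nN t01.
  by rewrite (le_trans (normr_Re _))// FM.
- have := @taylor_bound R (fun n t => im (F n t)) N M _ _ 1 h1.
  rewrite expr1n mulr1 ImB Im_sum => H.
  rewrite (eq_bigr (fun n : 'I_N => im (F n 0) * 1 ^+ n / n`!%:R)); last first.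
    by move=> n _; rewrite E ImZ expr1n mulr1 mulrC.
  apply: H => [n t nN t01|t t01]; first by have [] := DF n t nN t01.
  by rewrite (le_trans (normr_Im _))// FM.
Qed.

Lemma cexpD z w : cexp (z + w) = cexp z * cexp w.
Proof.
by apply: complex_eqP; rewrite ?ReM ?ImM /cexp /= ReD ImD expRD ?cosD ?sinD; ring.
Qed.

Lemma cexp0 : cexp (0 : R[i]) = 1.
Proof. by rewrite /cexp/= expR0 cos0 sin0 mulr0 mulr1. Qed.

Lemma normc_cexp z : normc (cexp z) = expR (re z).
Proof.
rewrite /normc /cexp /= !exprMn -mulrDr cos2Dsin2 mulr1 sqrtr_sqr ger0_norm// expR_ge0.
Qed.

Lemma cexp_real a : cexp (a%:C%C) = (expR a)%:C%C.
Proof. by rewrite /cexp/= cos0 sin0 mulr0 mulr1. Qed.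

Lemma is_cderive_cexp z w (t : R) :
  is_cderive t (fun s : R => cexp (w + s%:C%C * z)) (z * cexp (w + t%:C%C * z)).
Proof.
apply: cdir_cexp.
have Dr : is_cderive t (fun s : R => s%:C%C) 1 by split; [exact: is_derive_id|exact: is_derive_cst].
have := cdirD (cdir_cst t 1 w) (cdirM Dr (cdir_cst t 1 z)).
by rewrite mul1r mulr0 addr0 add0r.
Qed.

Lemma cexp_taylor z (n : nat) :
  normc (cexp z - \sum_(j < n) z ^+ j / j`!%:R)
    <= 2 * (normc z ^+ n * expR (normc z) / n`!%:R).
Proof.
have := @taylor_cbound (fun j t => z ^+ j * cexp (0 + t%:C%C * z)) n
  (normc z ^+ n * expR (normc z)).
rewrite /= expr0 mul1r add0r.
rewrite [(1%:C)%C]rmorph1 mul1r => H.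
rewrite (eq_bigr (fun j : 'I_n => z ^+ j * cexp (0 + 0%:C%C * z) / j`!%:R)); last first.
  by move=> j _; rewrite [(0%:C)%C]rmorph0 mul0r addr0 cexp0 mulr1.
apply: H => [j t _ _|t /andP[t0 t1]].
  by rewrite exprSr -mulrA; exact: cdirZ (is_cderive_cexp z 0 t).
rewrite normcM normcX ler_wpM2l ?exprn_ge0 ?normc_ge0//.
rewrite normc_cexp ler_expR add0r ReZ.
rewrite (le_trans (ler_norm _))// normrM ger0_norm//.
by rewrite (le_trans (ler_piMl _ t1))// normr_Re.
Qed.

(** On the segment from [w] to [z] the real part stays below [m] by convexity. Only real parts enter
    the exponential, which matters because the imaginary parts of the phases are not controlled by
    the Gaussian decay. *)
Lemma cexp_lipschitz z w (m : R) : re z <= m -> re w <= m ->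
  normc (cexp z - cexp w) <= 2 * (normc (z - w) * expR m).
Proof.
move=> zm wm.
have := @taylor_cbound (fun j t => (z - w) ^+ j * cexp (w + t%:C%C * (z - w))) 1
  (normc (z - w) * expR m).
rewrite big_ord1 /= ?fact0 ?(factS 0) ?mulr1n !divr1 ?expr0 ?mul1r.
rewrite [(0%:C)%C]rmorph0 mul0r addr0 (addrC w) subrK => H.
apply: H => [j t|t /andP[t0 t1]].
  rewrite ltnS leqn0 => /eqP -> _.
  under eq_fun do rewrite expr0 mul1r.
  rewrite expr1; exact: is_cderive_cexp.
rewrite expr1 normcM normc_cexp ler_wpM2l ?normc_ge0// ler_expR ReD ReZ ReB.
rewrite (_ : _ + _ = t * re z + (1 - t) * re w); last by ring.
rewrite (_ : m = t * m + (1 - t) * m); last by ring.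
by rewrite lerD ?ler_wpM2l ?subr_ge0.
Qed.

End ComplexExponential.

(** * Smooth functions of several variables *)

Section LOneNorm.
Variables (R : realType) (d : nat).
Implicit Types (x y z : 'rV[R]_d) (i : 'I_d).

(** This norm is adapted to directional derivatives: expanding (y . \partial)^n costs exactly the
    n-th power of it times the largest partial derivative, with no factor depending on the
    dimension. *)
Definition norm1 y := \sum_i `|y 0 i|.

Local Notation basis i := (delta_mx 0 i : 'rV[R]_d).

Lemma norm1_ge0 y : 0 <= norm1 y.
Proof. exact: sumr_ge0. Qed.

Lemma norm1D x y : norm1 (x + y) <= norm1 x + norm1 y.
Proof. by rewrite -big_split; apply: ler_sum => i _; rewrite mxE ler_normD. Qed.

Lemma norm1_delta a i : norm1 (a *: basis i) = `|a|.
Proof.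
rewrite /norm1 (bigD1 i)//= big1 ?addr0 => [|j ji].
  by rewrite !mxE !eqxx mulr1.
by rewrite !mxE (negbTE ji) andbF mulr0 normr0.
Qed.

Lemma le_norm1 y i : `|y 0 i| <= norm1 y.
Proof. by rewrite /norm1 (bigD1 i)//= lerDl sumr_ge0. Qed.

Lemma rV_ballP x (e : R) y : ball x e y <-> 0 < e /\ forall i, `|x 0 i - y 0 i| < e.
Proof.
split=> [[e0 H]|[e0 H]]; split=> // i; first exact: H.
by move=> j; rewrite (ord1 i); exact: H.
Qed.

Lemma near_norm1 x (P : set 'rV[R]_d) : (\forall y \near x, P y) ->
  exists2 r : R, 0 < r & forall y, norm1 y < r -> P (x + y).
Proof.
move=> /nbhs_ballP[r /= r0 rP]; exists r => // y yr; apply: rP.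
apply/rV_ballP; split=> // i; rewrite mxE opprD addrA subrr add0r normrN.
exact: le_lt_trans (le_norm1 _ _) yr.
Qed.

End LOneNorm.

Section RealPartials.
Variables (R : realType) (d : nat) (W : set 'rV[R]_d).
Hypothesis oW : open W.
Local Notation basis i := (delta_mx 0 i : 'rV[R]_d).

Lemma is_derive_partials (w : 'rV[R]_d -> R) (dw : 'I_d -> 'rV[R]_d -> R) x y :
  (forall z i, W z -> is_derive z (basis i) w (dw i z)) -> W x ->
  (forall i, {for x, continuous (dw i)}) ->
  is_derive x y w (\sum_i y 0 i * dw i x).
Proof.
move=> Dw Wx cdw.
(* Coordinates are moved one at a time, with a mean value step for each. An arbitrary list of
   indices makes this an induction. *)
have key (e : R) : 0 < e -> exists2 r : R, 0 < r & forall (l : seq 'I_d) (a : 'I_d -> R),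
    \sum_(i <- l) `|a i| < r ->
    `|w (x + \sum_(i <- l) a i *: basis i) - w x - \sum_(i <- l) a i * dw i x|
       <= e * \sum_(i <- l) `|a i|.
  move=> e0.
  have : \forall z \near x, W z /\ forall i, `|dw i x - dw i z| <= e.
    apply: filterI; first exact: (open_nbhs_nbhs (conj oW Wx)).
    apply: (@filter_forall 'rV[R]_d 'I_d (fun i z => `|dw i x - dw i z| <= e) (nbhs x) _) => i.
    by have /cvgrPdist_le := cdw i; exact.
  move=> /near_norm1[r r0 rP]; exists r => //; elim=> [|i l ih] a.
    by rewrite !big_nil addr0 subrr subr0 normr0 mulr0.
  rewrite !big_cons => ar.
  have lr : \sum_(j <- l) `|a j| < r.
    by apply: le_lt_trans ar; rewrite lerDr.
  set y' := \sum_(j <- l) a j *: basis j.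
  have ny' : norm1 y' <= \sum_(j <- l) `|a j|.
    rewrite /y'; elim/big_ind2 : _ => [|u1 u2 v1 v2 h1 h2|j _].
    - by rewrite /norm1 big1// => j _; rewrite mxE normr0.
    - by rewrite (le_trans (norm1D _ _))// lerD.
    - by rewrite norm1_delta.
  have near_i (t : R) : `|t| <= `|a i| -> norm1 (y' + t *: basis i) < r.
    move=> ti; apply: le_lt_trans ar.
    by rewrite (le_trans (norm1D _ _))// norm1_delta addrC lerD.
  have [|t] := @mean_value R (fun t => w ((x + y') + t *: basis i))
      (fun t => dw i (x + y' + t *: basis i)) 0 (a i).
    move=> t; rewrite !subr0 => ti; apply: (is_derive_line w _ _ _ _).1; apply: Dw.
    by rewrite -addrA; apply: (rP _ _).1; exact: near_i.
  rewrite !subr0 scale0r addr0 => ti E.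
  have := (rP _ (near_i _ ti)).2 i; rewrite addrA => dwi.
  rewrite (_ : _ - _ = (w (x + y') - w x - \sum_(j <- l) a j * dw j x) -
       (dw i x - dw i (x + y' + t *: basis i)) * a i); last first.
    rewrite mulrBl -E (addrC _ y') addrA; ring.
  rewrite (le_trans (ler_normB _ _))// mulrDr addrC lerD//; last exact: ih.
  by rewrite normrM ler_wpM2r.
apply/is_derive_epsP => e e0.
(* Adding 1 avoids a case distinction on [y = 0]. *)
have n0 : 0 < norm1 y + 1 by rewrite ltr_wpDl// norm1_ge0.
have [r r0 rP] := key _ (divr_gt0 e0 n0).
exists (r / (norm1 y + 1)); first exact: divr_gt0.
move=> h hr.
have E1 : \sum_i `|h * y 0 i| = `|h| * norm1 y.
  by rewrite mulr_sumr; apply: eq_bigr => i _; rewrite normrM.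
have := rP (index_enum 'I_d) (fun i => h * y 0 i).
rewrite E1 => H.
have {}H := H _.
have yE : h *: y = \sum_i (h * y 0 i) *: basis i.
  rewrite [in LHS](row_sum_delta y) scaler_sumr.
  by apply: eq_bigr => i _; rewrite scalerA.
rewrite yE mulr_sumr; under [\sum_i h * _]eq_bigr do rewrite mulrA.
apply: le_trans (H _) _.
  move: hr; rewrite ltr_pdivlMr// => /(le_lt_trans _); apply.
  by rewrite ler_wpM2l// lerDl.
rewrite mulrAC -mulrA ler_wpM2l ?(ltW e0)//.
by rewrite ler_pdivrMr// ler_wpM2l// lerDl.
Qed.

(** The second difference over a square of side t is t^2 times a mixed derivative at an intermediate
    point, in either order of differentiation; continuity at [x] compares the two values. *)
Lemma schwarz (w a b aq bp : 'rV[R]_d -> R) (p q : 'I_d) x :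
  (forall z, W z -> is_derive z (basis p) w (a z)) ->
  (forall z, W z -> is_derive z (basis q) w (b z)) ->
  (forall z, W z -> is_derive z (basis q) a (aq z)) ->
  (forall z, W z -> is_derive z (basis p) b (bp z)) ->
  W x -> {for x, continuous aq} -> {for x, continuous bp} -> aq x = bp x.
Proof.
move=> Da Db Daq Dbp Wx caq cbp.
apply/eqP; rewrite -subr_eq0 -normr_le0; apply/ler_addgt0Pr => e e0; rewrite add0r.
have e20 : 0 < e / 2 by rewrite divr_gt0.
have : \forall z \near x, [/\ W z, `|aq x - aq z| <= e / 2 & `|bp x - bp z| <= e / 2].
  near=> z; split; near: z.
  - exact: (open_nbhs_nbhs (conj oW Wx)).
  - by have /cvgrPdist_le := caq; exact.
  - by have /cvgrPdist_le := cbp; exact.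
move=> /near_norm1[r r0 rP].
(* Two legs of length at most t stay within distance 2 r / 3 < r. *)
pose t := r / 3.
have t0 : 0 < t by rewrite divr_gt0.
have near2 (s s' : R) : `|s| <= `|t| -> `|s'| <= `|t| ->
    norm1 (s *: basis p + s' *: basis q) < r.
  move=> h1 h2; rewrite (le_lt_trans (norm1D _ _))// !norm1_delta.
  rewrite (le_lt_trans (lerD h1 h2))// gtr0_norm// /t; lra.
pose x' (s s' : R) : 'rV[R]_d := x + s *: basis p + s' *: basis q.
have n2 (s s' : R) : `|s| <= `|t| -> `|s'| <= `|t| ->
    [/\ W (x' s s'), `|aq x - aq (x' s s')| <= e / 2 & `|bp x - bp (x' s s')| <= e / 2].
  by move=> h1 h2; rewrite /x' -addrA; apply: rP; exact: near2.
have x'C s s' : x' s s' = x + s' *: basis q + s *: basis p by rewrite /x' addrAC.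
have Dp (f df : 'rV[R]_d -> R) (s s' : R) : (forall z, W z -> is_derive z (basis p) f (df z)) ->
    `|s| <= `|t| -> `|s'| <= `|t| -> is_derive s 1 (fun u => f (x' u s')) (df (x' s s')).
  move=> Df h1 h2; under eq_fun do rewrite x'C.
  apply: (is_derive_line f _ _ _ _).1; rewrite -x'C; apply: Df.
  by have [] := n2 _ _ h1 h2.
have Dq (f df : 'rV[R]_d -> R) (s s' : R) : (forall z, W z -> is_derive z (basis q) f (df z)) ->
    `|s| <= `|t| -> `|s'| <= `|t| -> is_derive s' 1 (fun u => f (x' s u)) (df (x' s s')).
  move=> Df h1 h2; rewrite /x'.
  apply: (is_derive_line f _ _ _ _).1; apply: Df.
  by have [] := n2 _ _ h1 h2.
have tt0 : `|0 : R| <= `|t| by rewrite normr0.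
clearbody x' t.
pose D := w (x' t t) - w (x' t 0) - w (x' 0 t) + w (x' 0 0).
have [c [c' [hc hc' E1]]] : exists c c', [/\ `|c| <= `|t|, `|c'| <= `|t| & D = t * t * aq (x' c c')].
  have [|c] := @mean_value R (fun s => w (x' s t) - w (x' s 0))
     (fun s => a (x' s t) - a (x' s 0)) 0 t.
    by move=> s; rewrite !subr0 => hs; apply: is_deriveB; exact: Dp.
  rewrite !subr0 => hc Ec.
  have [|c'] := @mean_value R (fun s => a (x' c s)) (fun s => aq (x' c s)) 0 t.
    by move=> s; rewrite !subr0 => hs; exact: Dq.
  rewrite !subr0 => hc' Ec'; exists c, c'; split=> //.
  rewrite (_ : D = (w (x' t t) - w (x' t 0) - (w (x' 0 t) - w (x' 0 0)))); last by rewrite /D; ring.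
  by rewrite Ec Ec'; ring.
have [k [k' [hk hk' E2]]] : exists k k', [/\ `|k| <= `|t|, `|k'| <= `|t| & D = t * t * bp (x' k k')].
  have [|k'] := @mean_value R (fun s => w (x' t s) - w (x' 0 s))
     (fun s => b (x' t s) - b (x' 0 s)) 0 t.
    by move=> s; rewrite !subr0 => hs; apply: is_deriveB; exact: Dq.
  rewrite !subr0 => hk' Ek'.
  have [|k] := @mean_value R (fun s => b (x' s k')) (fun s => bp (x' s k')) 0 t.
    by move=> s; rewrite !subr0 => hs; exact: Dp.
  rewrite !subr0 => hk Ek; exists k, k'; split=> //.
  rewrite (_ : D = (w (x' t t) - w (x' 0 t) - (w (x' t 0) - w (x' 0 0)))); last by rewrite /D; ring.
  by rewrite Ek' Ek; ring.
have E : aq (x' c c') = bp (x' k k').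
  have t20 : t * t != 0 by rewrite mulf_neq0// gt_eqF.
  by apply: (mulfI t20); rewrite -E1 -E2.
have [_ h1 _] := n2 _ _ hc hc'.
have [_ _ h2] := n2 _ _ hk hk'.
rewrite (_ : aq x - bp x = (aq x - aq (x' c c')) - (bp x - bp (x' k k'))); last by rewrite E; ring.
by rewrite (le_trans (ler_normB _ _))// [leRHS](splitr e) lerD.
Unshelve. all: by end_near. Qed.

End RealPartials.

Section SmoothFunctions.
Variables (R : realType) (d : nat) (W : set 'rV[R]_d).
Hypothesis oW : open W.
Local Notation basis i := (delta_mx 0 i : 'rV[R]_d).
Implicit Types (u v : 'rV[R]_d -> R[i]) (x y : 'rV[R]_d) (c : R[i]).

Definition ccontinuous_at v x := {for x, continuous (re \o v)} /\ {for x, continuous (im \o v)}.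

Definition C1_on v := forall x, W x ->
  [/\ {for x, continuous (re \o v)}, {for x, continuous (im \o v)} &
      forall i, derivable (re \o v) x (basis i) /\ derivable (im \o v) x (basis i)].

(** [smooth_on] quantifies over words of derivatives, a form that the Leibniz rule does not preserve
    word by word. The recursion on the order is stable under products, and [smoothP] identifies the
    two notions. *)
Fixpoint Ck_on n v := C1_on v /\
  match n with 0 => True | n.+1 => forall i, Ck_on n (pderiv i v) end.

Lemma near_open x : W x -> \forall z \near x, W z.
Proof. by move=> Wx; apply: (open_nbhs_nbhs (conj oW Wx)). Qed.

Lemma cdir_val x v c i : is_cdir x (basis i) v c -> pderiv i v x = c.
Proof.
move=> [D1 D2]; apply: complex_eqP; first exact: (@derive_val _ _ _ _ _ _ _ D1).
exact: (@derive_val _ _ _ _ _ _ _ D2).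
Qed.

Lemma cdir_pderiv x v i : C1_on v -> W x -> is_cdir x (basis i) v (pderiv i v x).
Proof. by move=> Cv /Cv[_ _ /(_ i)[D1 D2]]; split; exact: derivableP. Qed.

(** Functions are total but constrained only on W, so identities between derivatives hold on W only.
    This lemma and its consequences play the role of functional extensionality, and rest on W being
    open. *)
Lemma cdir_ext x y u v c : W x -> (forall z, W z -> u z = v z) ->
  is_cdir x y u c -> is_cdir x y v c.
Proof.
move=> Wx uv [D1 D2]; split.
- by apply: near_eq_is_derive D1; near=> z; rewrite /= uv//; near: z; exact: near_open.
- by apply: near_eq_is_derive D2; near=> z; rewrite /= uv//; near: z; exact: near_open.
Unshelve. all: by end_near. Qed.

Lemma continuous_ext (f g : 'rV[R]_d -> R) x : W x -> (forall z, W z -> f z = g z) ->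
  {for x, continuous f} -> {for x, continuous g}.
Proof.
move=> Wx fg cf; rewrite /prop_for /continuous_at -fg//.
apply: cvg_trans cf.
have H : \forall z \near x, f z = g z.
  by near=> z; rewrite fg//; near: z; exact: near_open.
exact: (near_eq_cvg H).
Unshelve. all: by end_near. Qed.

Lemma C1_ext u v : (forall z, W z -> u z = v z) -> C1_on u -> C1_on v.
Proof.
move=> uv Cu x Wx; have [c1 c2 Du] := Cu x Wx; split.
- by apply: continuous_ext c1 => // z Wz /=; rewrite uv.
- by apply: continuous_ext c2 => // z Wz /=; rewrite uv.
- move=> i; have [D1 D2] := cdir_ext Wx uv (cdir_pderiv i Cu Wx).
  by split; [apply: (@ex_derive _ _ _ _ _ _ _ D1)|apply: (@ex_derive _ _ _ _ _ _ _ D2)].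
Qed.

Lemma pderiv_ext i u v x : C1_on u -> (forall z, W z -> u z = v z) -> W x ->
  pderiv i u x = pderiv i v x.
Proof.
move=> Cu uv Wx; apply/esym/cdir_val/(cdir_ext Wx uv); exact: cdir_pderiv.
Qed.

Lemma ccontinuous_atD u v x : ccontinuous_at u x -> ccontinuous_at v x ->
  ccontinuous_at (fun z => u z + v z) x.
Proof.
move=> [F1 F2] [G1 G2]; split.
- rewrite (_ : _ \o _ = (re \o u) + (re \o v)); first exact: continuousD.
  by apply/funext => z; rewrite /= ReD.
- rewrite (_ : _ \o _ = (im \o u) + (im \o v)); first exact: continuousD.
  by apply/funext => z; rewrite /= ImD.
Qed.

Lemma ccontinuous_atM u v x : ccontinuous_at u x -> ccontinuous_at v x ->
  ccontinuous_at (fun z => u z * v z) x.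
Proof.
move=> [F1 F2] [G1 G2]; split.
- rewrite (_ : _ \o _ = ((re \o u) \* (re \o v)) - ((im \o u) \* (im \o v))).
    by apply: continuousB; exact: continuousM.
  by apply/funext => z; rewrite /= ReM.
- rewrite (_ : _ \o _ = ((re \o u) \* (im \o v)) + ((im \o u) \* (re \o v))).
    by apply: continuousD; exact: continuousM.
  by apply/funext => z; rewrite /= ImM.
Qed.

Lemma C1D u v : C1_on u -> C1_on v -> C1_on (fun z => u z + v z).
Proof.
move=> Cu Cv x Wx; have [u1 u2 _] := Cu x Wx; have [v1 v2 _] := Cv x Wx.
have [c1 c2] := ccontinuous_atD (conj u1 u2) (conj v1 v2); split=> //.
by move=> i; have [D1 D2] := cdirD (cdir_pderiv i Cu Wx) (cdir_pderiv i Cv Wx);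
  split; [apply: (@ex_derive _ _ _ _ _ _ _ D1)|apply: (@ex_derive _ _ _ _ _ _ _ D2)].
Qed.

Lemma C1M u v : C1_on u -> C1_on v -> C1_on (fun z => u z * v z).
Proof.
move=> Cu Cv x Wx; have [u1 u2 _] := Cu x Wx; have [v1 v2 _] := Cv x Wx.
have [c1 c2] := ccontinuous_atM (conj u1 u2) (conj v1 v2); split=> //.
by move=> i; have [D1 D2] := cdirM (cdir_pderiv i Cu Wx) (cdir_pderiv i Cv Wx);
  split; [apply: (@ex_derive _ _ _ _ _ _ _ D1)|apply: (@ex_derive _ _ _ _ _ _ _ D2)].
Qed.

Lemma C1_cst c : C1_on (fun=> c).
Proof. by move=> x _; split; [exact: cst_continuous|exact: cst_continuous|]; split; exact: derivable_cst. Qed.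

Lemma pderivD i u v x : C1_on u -> C1_on v -> W x ->
  pderiv i (fun z => u z + v z) x = pderiv i u x + pderiv i v x.
Proof. by move=> Cu Cv Wx; apply: cdir_val; apply: cdirD; exact: cdir_pderiv. Qed.

Lemma pderivM i u v x : C1_on u -> C1_on v -> W x ->
  pderiv i (fun z => u z * v z) x = pderiv i u x * v x + u x * pderiv i v x.
Proof. by move=> Cu Cv Wx; apply: cdir_val; apply: cdirM; exact: cdir_pderiv. Qed.

Lemma pderiv_cst i c x : pderiv i (fun=> c) x = 0.
Proof. by apply: cdir_val; exact: cdir_cst. Qed.

Lemma Ck_C1 n u : Ck_on n u -> C1_on u.
Proof. by case: n => [|n] []. Qed.

Lemma Ck_ext n u v : (forall z, W z -> u z = v z) -> Ck_on n u -> Ck_on n v.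
Proof.
elim: n u v => [|n ih] u v uv [Cu Du]; (split; first exact: C1_ext Cu); first exact: I.
move=> i; apply: ih (Du i) => z Wz; exact: pderiv_ext.
Qed.

Lemma CkS n u : Ck_on n.+1 u -> Ck_on n u.
Proof.
elim: n u => [|n ih] u [Cu Du]; split; [exact: Cu|exact: I|exact: Cu|].
by move=> i; exact/ih/Du.
Qed.

Lemma CkD n u v : Ck_on n u -> Ck_on n v -> Ck_on n (fun z => u z + v z).
Proof.
elim: n u v => [|n ih] u v [Cu Du] [Cv Dv]; (split; first exact: C1D); first exact: I.
move=> i; apply: Ck_ext (ih _ _ (Du i) (Dv i)) => z Wz.
by rewrite pderivD.
Qed.

Lemma CkM n u v : Ck_on n u -> Ck_on n v -> Ck_on n (fun z => u z * v z).
Proof.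
elim: n u v => [|n ih] u v Hu Hv;
  (split; first by apply: C1M; apply: Ck_C1; eassumption); first exact: I.
move: (Hu) (Hv) => [Cu Du] [Cv Dv] i.
apply: Ck_ext (CkD (ih _ _ (Du i) (CkS Hv)) (ih _ _ (CkS Hu) (Dv i))) => z Wz.
by rewrite pderivM.
Qed.

Lemma smoothP u : smooth_on W u <-> forall n, Ck_on n u.
Proof.
split=> [Su n|Cu l].
  elim: n u Su => [|n ih] u Su; (split; first exact: (Su [::])); first exact: I.
  move=> i; apply: ih => l; have := Su (rcons l i).
  by rewrite foldr_rcons.
have : Ck_on (size l) u by [].
elim/last_ind: l u {Cu} => [|l i ih] u; first by case.
by rewrite size_rcons foldr_rcons => -[_ /(_ i)]; exact: ih.
Qed.

Lemma smooth_C1 u : smooth_on W u -> C1_on u.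
Proof. by move=> /smoothP/(_ 0%N)[]. Qed.

Lemma smooth_pderiv i u : smooth_on W u -> smooth_on W (pderiv i u).
Proof. by move=> Su l; have := Su (rcons l i); rewrite foldr_rcons. Qed.

Lemma smooth_ext u v : (forall z, W z -> u z = v z) -> smooth_on W u -> smooth_on W v.
Proof. by move=> uv /smoothP Su; apply/smoothP => n; exact: Ck_ext (Su n). Qed.

Lemma smoothD u v : smooth_on W u -> smooth_on W v -> smooth_on W (fun z => u z + v z).
Proof. by move=> /smoothP Su /smoothP Sv; apply/smoothP => n; exact: CkD. Qed.

Lemma smoothM u v : smooth_on W u -> smooth_on W v -> smooth_on W (fun z => u z * v z).
Proof. by move=> /smoothP Su /smoothP Sv; apply/smoothP => n; exact: CkM. Qed.

Lemma smooth_cst c : smooth_on W (fun=> c).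
Proof.
apply/smoothP; suff H n c' : Ck_on n (fun=> c') by move=> n; exact: H.
elim: n c' => [|n ih] c'; (split; first exact: C1_cst); first exact: I.
by move=> i; apply: Ck_ext (ih 0) => z _; rewrite pderiv_cst.
Qed.

Lemma smooth_sum (I : Type) (r : seq I) (F : I -> 'rV[R]_d -> R[i]) :
  (forall i, smooth_on W (F i)) -> smooth_on W (fun z => \sum_(i <- r) F i z).
Proof.
move=> SF; elim: r => [|i r ih].
  by apply: smooth_ext (smooth_cst 0) => z _; rewrite big_nil.
by apply: smooth_ext (smoothD (SF i) ih) => z _; rewrite big_cons.
Qed.

Lemma smoothX u n : smooth_on W u -> smooth_on W (fun z => u z ^+ n).
Proof.
move=> Su; elim: n => [|n ih].
  by apply: smooth_ext (smooth_cst 1) => z _; rewrite expr0.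
by apply: smooth_ext (smoothM Su ih) => z _; rewrite exprS.
Qed.

Lemma pderiv_sum i (I : Type) (r : seq I) (F : I -> 'rV[R]_d -> R[i]) x :
  (forall j, smooth_on W (F j)) -> W x ->
  pderiv i (fun z => \sum_(j <- r) F j z) x = \sum_(j <- r) pderiv i (F j) x.
Proof.
move=> SF Wx; elim: r => [|j r ih].
  transitivity (pderiv i (fun=> 0) x); last by rewrite pderiv_cst big_nil.
  have C := smooth_C1 (smooth_sum [::] SF).
  by apply: (pderiv_ext i C _ Wx) => z _; rewrite big_nil.
transitivity (pderiv i (fun z => F j z + \sum_(j <- r) F j z) x).
  have C := smooth_C1 (smooth_sum (j :: r) SF).
  by apply: (pderiv_ext i C _ Wx) => z _; rewrite big_cons.
rewrite big_cons -ih.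
exact: (pderivD i (smooth_C1 (SF j)) (smooth_C1 (smooth_sum r SF)) Wx).
Qed.

Lemma pderivZ i c u x : smooth_on W u -> W x ->
  pderiv i (fun z => c * u z) x = c * pderiv i u x.
Proof.
move=> Su Wx; rewrite (pderivM i (C1_cst c) (smooth_C1 Su) Wx).
by rewrite pderiv_cst mul0r add0r.
Qed.

Lemma cdir_coord x0 (j : 'I_d) x y : is_cdir x y (fun z => (z 0 j - x0 0 j)%:C%C) (y 0 j)%:C%C.
Proof.
split; last exact: is_derive_cst.
apply/is_derive_epsP => e e0; exists 1 => // h _ /=.
by rewrite !mxE (_ : _ - _ - _ = 0) ?normr0 ?mulr_ge0 ?(ltW e0)//; ring.
Qed.

Lemma pderiv_coord x0 (j i : 'I_d) x :
  pderiv i (fun z => (z 0 j - x0 0 j)%:C%C) x = (j == i)%:R.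
Proof.
apply: cdir_val; have := cdir_coord x0 j x (basis i).
by rewrite mxE eqxx; case: eqP.
Qed.

Lemma smooth_coord x0 (j : 'I_d) : smooth_on W (fun z => (z 0 j - x0 0 j)%:C%C).
Proof.
apply/smoothP; have C1 : C1_on (fun z => (z 0 j - x0 0 j)%:C%C).
  move=> x Wx; split; last first.
  - move=> i; have [D1 D2] := cdir_coord x0 j x (basis i).
    by split; [apply: (@ex_derive _ _ _ _ _ _ _ D1)|apply: (@ex_derive _ _ _ _ _ _ _ D2)].
  - exact: cst_continuous.
  - apply: continuousB; last exact: cst_continuous.
    exact: coord_continuous.
case=> [|n]; split=> // i.
have /smoothP/(_ n) := smooth_cst ((j == i)%:R).
by apply: Ck_ext => z _; rewrite pderiv_coord.
Qed.

Lemma pderivC p q v x : smooth_on W v -> W x ->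
  pderiv p (pderiv q v) x = pderiv q (pderiv p v) x.
Proof.
move=> Sv Wx.
have Cpq i j : C1_on (pderiv i (pderiv j v)).
  by apply: smooth_C1; do 2 apply: smooth_pderiv.
have C i : C1_on (pderiv i v) by apply: smooth_C1; apply: smooth_pderiv.
have C0 : C1_on v := smooth_C1 Sv.
apply: complex_eqP.
- apply: (@schwarz R d W oW (re \o v) (re \o pderiv q v) (re \o pderiv p v)
    (re \o pderiv p (pderiv q v)) (re \o pderiv q (pderiv p v)) q p x _ _ _ _ Wx).
  + by move=> z Wz; have [D1 D2] := cdir_pderiv q C0 Wz; exact: D1.
  + by move=> z Wz; have [D1 D2] := cdir_pderiv p C0 Wz; exact: D1.
  + by move=> z Wz; have [D1 D2] := cdir_pderiv p (C q) Wz; exact: D1.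
  + by move=> z Wz; have [D1 D2] := cdir_pderiv q (C p) Wz; exact: D1.
  + by have [c1 c2 _] := Cpq p q x Wx; exact: c1.
  + by have [c1 c2 _] := Cpq q p x Wx; exact: c1.
- apply: (@schwarz R d W oW (im \o v) (im \o pderiv q v) (im \o pderiv p v)
    (im \o pderiv p (pderiv q v)) (im \o pderiv q (pderiv p v)) q p x _ _ _ _ Wx).
  + by move=> z Wz; have [D1 D2] := cdir_pderiv q C0 Wz; exact: D2.
  + by move=> z Wz; have [D1 D2] := cdir_pderiv p C0 Wz; exact: D2.
  + by move=> z Wz; have [D1 D2] := cdir_pderiv p (C q) Wz; exact: D2.
  + by move=> z Wz; have [D1 D2] := cdir_pderiv q (C p) Wz; exact: D2.
  + by have [c1 c2 _] := Cpq p q x Wx; exact: c2.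
  + by have [c1 c2 _] := Cpq q p x Wx; exact: c2.
Qed.

Lemma cdir_smooth v x y : smooth_on W v -> W x ->
  is_cdir x y v (\sum_q (y 0 q)%:C%C * pderiv q v x).
Proof.
move=> Sv Wx; have C0 := smooth_C1 Sv.
have C i : C1_on (pderiv i v) by apply: smooth_C1; apply: smooth_pderiv.
split.
- rewrite Re_sum; under eq_bigr do rewrite ReZ.
  apply: (@is_derive_partials R d W oW (re \o v) (fun i => re \o pderiv i v) x y _ Wx).
  + by move=> z i Wz; have [D1 D2] := cdir_pderiv i C0 Wz; exact: D1.
  + by move=> i; have [c1 c2 _] := C i x Wx; exact: c1.
- rewrite Im_sum; under eq_bigr do rewrite ImZ.
  apply: (@is_derive_partials R d W oW (im \o v) (fun i => im \o pderiv i v) x y _ Wx).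
  + by move=> z i Wz; have [D1 D2] := cdir_pderiv i C0 Wz; exact: D2.
  + by move=> i; have [c1 c2 _] := C i x Wx; exact: c2.
Qed.

End SmoothFunctions.

#[local] Opaque pderiv Normc.normc.

(** * Directional derivatives and jets *)

Section DirectionalDerivatives.
Variables (R : realType) (d : nat).
Local Notation basis i := (delta_mx 0 i : 'rV[R]_d).
Implicit Types (u v : 'rV[R]_d -> R[i]) (x y : 'rV[R]_d) (c : R[i]).

(* [(y . \partial)^n v (x)] *)
Fixpoint dirD n v y x : R[i] :=
  if n is n'.+1 then \sum_q (y 0 q)%:C%C * dirD n' (pderiv q v) y x else v x.

(** The homogeneous part of degree n, in y, of the Taylor expansion of v (x + y). *)
Definition jet n v y x : R[i] := dirD n v y x / n`!%:R.

Section OnAnOpenSet.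
Variable W : set 'rV[R]_d.
Hypothesis oW : open W.

Lemma dirD_ext n u v y x : smooth_on W u -> (forall z, W z -> u z = v z) -> W x ->
  dirD n u y x = dirD n v y x.
Proof.
elim: n u v => [|n ih] u v Su uv Wx /=; first exact: uv.
apply: eq_bigr => q _; congr (_ * _); apply: (ih _ _ (smooth_pderiv q Su) _ Wx).
by move=> z Wz; apply: (pderiv_ext oW q (smooth_C1 Su) uv).
Qed.

Lemma dirDD n u v y x : smooth_on W u -> smooth_on W v -> W x ->
  dirD n (fun z => u z + v z) y x = dirD n u y x + dirD n v y x.
Proof.
elim: n u v => [|n ih] u v Su Sv Wx //=.
rewrite -big_split; apply: eq_bigr => q _ /=; rewrite -mulrDr; congr (_ * _).
have Su' := smooth_pderiv q Su; have Sv' := smooth_pderiv q Sv.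
rewrite -(ih _ _ Su' Sv' Wx); apply: (dirD_ext _ _ _ _ Wx).
  by apply: smooth_pderiv; exact: smoothD.
by move=> z Wz; exact: (pderivD q (smooth_C1 Su) (smooth_C1 Sv) Wz).
Qed.

Lemma dirDZ n c u y x : smooth_on W u -> W x ->
  dirD n (fun z => c * u z) y x = c * dirD n u y x.
Proof.
elim: n u => [|n ih] u Su Wx //=.
rewrite mulr_sumr; apply: eq_bigr => q _; rewrite mulrCA; congr (_ * _).
rewrite -(ih _ (smooth_pderiv q Su) Wx); apply: (dirD_ext _ _ _ _ Wx).
  exact: (smooth_pderiv q (smoothM oW (smooth_cst oW c) Su)).
by move=> z Wz; exact: (pderivZ q c Su Wz).
Qed.

Lemma cdir_dirD n v y x : smooth_on W v -> W x ->
  is_cdir x y (dirD n v y) (dirD n.+1 v y x).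
Proof.
elim: n v => [|n ih] v Sv Wx; first exact: (cdir_smooth oW).
by apply: cdir_sum => q; apply: cdirZ; exact: (ih _ (smooth_pderiv q Sv) Wx).
Qed.

Lemma cderive_dirD n v y x (t : R) : smooth_on W v -> W (x + t *: y) ->
  is_cderive t (fun s => dirD n v y (x + s *: y)) (dirD n.+1 v y (x + t *: y)).
Proof.
move=> Sv Wx; have [D1 D2] := cdir_dirD n y Sv Wx; split.
- exact: (is_derive_line (re \o dirD n v y) x y t _).1.
- exact: (is_derive_line (im \o dirD n v y) x y t _).1.
Qed.

(** As a function of its direction, (y . \partial)^n v is a homogeneous polynomial; commuting
    partial derivatives makes the n contributions equal. At n = 0 the factor n hides the default
    value of [n.-1]. This is the derivative needed to integrate moments by parts. *)
Lemma cdir_dirD_arg n v p x y : smooth_on W v -> W x ->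
  is_cdir y (basis p) (fun z => dirD n v z x) (n%:R * dirD n.-1 (pderiv p v) y x).
Proof.
elim: n v => [|n ih] v Sv Wx; first by rewrite mul0r; exact: cdir_cst.
have Dq q : is_cdir y (basis p) (fun z => (z 0 q)%:C%C * dirD n (pderiv q v) z x)
   ((q == p)%:R * dirD n (pderiv q v) y x +
    (y 0 q)%:C%C * (n%:R * dirD n.-1 (pderiv p (pderiv q v)) y x)).
  apply: cdirM (ih _ (smooth_pderiv q Sv) Wx).
  have := cdir_coord 0 q y (basis p); rewrite [(basis p) 0 q]mxE eqxx /=.
  have -> : (q == p)%:R = ((q == p)%:R : R)%:C%C by rewrite rmorph_nat.
  by under eq_fun do rewrite mxE subr0.
have := cdir_sum (index_enum 'I_d) Dq.
rewrite big_split /= (bigD1 p)//= eqxx mul1r big1 ?addr0; last first.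
  by move=> q /negbTE ->; rewrite mul0r.
rewrite (_ : \sum_q _ = n%:R * dirD n (pderiv p v) y x).
  by rewrite -[in n.+1%:R]add1n natrD mulrDl mul1r.
case: n {ih Dq} => [|n]; first by rewrite mul0r big1// => q _; rewrite mul0r mulr0.
rewrite -[n.+1.-1]/n -[dirD n.+1 _ _ _]/(\sum_q (y 0 q)%:C%C * dirD n (pderiv q (pderiv p v)) y x).
have E q : dirD n (pderiv p (pderiv q v)) y x = dirD n (pderiv q (pderiv p v)) y x.
  apply: (dirD_ext _ _ _ _ Wx); first by do 2 apply: smooth_pderiv.
  by move=> z Wz; exact: (pderivC oW p q Sv Wz).
rewrite mulr_sumr.
apply: eq_bigr => q _.
exact: (etrans (congr1 (fun t => (y 0 q)%:C%C * (n.+1%:R * t)) (E q)) (mulrCA _ _ _)).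
Qed.

Lemma dirDM n u v y x : smooth_on W u -> smooth_on W v -> W x ->
  dirD n (fun z => u z * v z) y x =
  \sum_(a < n.+1) 'C(n, a)%:R * (dirD a u y x * dirD (n - a) v y x).
Proof.
move=> + + Wx; elim: n u v => [|n ih] u v Su Sv.
  by rewrite big_ord1 bin0 mul1r.
rewrite -[LHS]/(\sum_q _).
transitivity (\sum_(a < n.+1) 'C(n, a)%:R * (dirD a.+1 u y x * dirD (n - a) v y x)
   + \sum_(a < n.+1) 'C(n, a)%:R * (dirD a u y x * dirD (n - a).+1 v y x)).
  transitivity (\sum_q (y 0 q)%:C%C *
    (\sum_(a < n.+1) 'C(n, a)%:R * (dirD a (pderiv q u) y x * dirD (n - a) v y x) +
     \sum_(a < n.+1) 'C(n, a)%:R * (dirD a u y x * dirD (n - a) (pderiv q v) y x))).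
    apply: eq_bigr => q _; congr (_ * _).
    have Su' := smooth_pderiv q Su; have Sv' := smooth_pderiv q Sv.
    rewrite -(ih _ _ Su' Sv) -(ih _ _ Su Sv').
    rewrite -(dirDD n y (smoothM oW Su' Sv) (smoothM oW Su Sv') Wx).
    apply: (dirD_ext _ _ _ _ Wx); first by apply: smooth_pderiv; exact: smoothM.
    by move=> z Wz; exact: (pderivM q (smooth_C1 Su) (smooth_C1 Sv) Wz).
  under eq_bigr do rewrite mulrDr.
  rewrite big_split /=; congr (_ + _).
  - under eq_bigr do rewrite mulr_sumr.
    rewrite exchange_big; apply: eq_bigr => a _ /=.
    rewrite mulr_suml mulr_sumr; apply: eq_bigr => q _; ring.
  - under eq_bigr do rewrite mulr_sumr.
    rewrite exchange_big; apply: eq_bigr => a _ /=.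
    rewrite !mulr_sumr; apply: eq_bigr => q _; ring.
rewrite [RHS]big_ord_recl bin0 mul1r subn0.
under [in RHS]eq_bigr do rewrite lift0 subSS binS natrD mulrDl.
rewrite big_split [RHS]addrCA addrA addrC; congr (_ + _).
rewrite big_ord_recl bin0 mul1r subn0 [RHS]addrC; congr (_ + _).
rewrite [RHS]big_ord_recr [X in _ = _ + X](_ : _ = 0) ?addr0; last first.
  by rewrite (bin_small (ltnSn n)) mul0r.
by apply: eq_bigr => a _; rewrite lift0 subnSK.
Qed.

(** Dividing by factorials turns the Leibniz rule into a Cauchy product, so jets multiply like
    coefficients of polynomials. *)
Lemma jetM n u v y x : smooth_on W u -> smooth_on W v -> W x ->
  jet n (fun z => u z * v z) y x = \sum_(a < n.+1) jet a u y x * jet (n - a) v y x.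
Proof.
move=> Su Sv Wx; rewrite /jet dirDM// mulr_suml; apply: eq_bigr => a _.
have an : (a <= n)%N by rewrite -ltnS.
have nz k : (k`!%:R : R[i]) != 0 by rewrite pnatr_eq0 -lt0n fact_gt0.
rewrite -(bin_fact an) !natrM; field.
by rewrite !nz pnatr_eq0 -lt0n bin_gt0 an.
Qed.

Lemma pderiv_foldrC i (l : seq 'I_d) v x : smooth_on W v -> W x ->
  pderiv i (foldr (@pderiv R d) v l) x = foldr (@pderiv R d) (pderiv i v) l x.
Proof.
move=> Sv; elim: l x => //= j l ih x Wx.
have S : smooth_on W (foldr (@pderiv R d) v l).
  by elim: l {ih} => [|k l ih]; [exact: Sv|exact: (smooth_pderiv k ih)].
rewrite (pderivC oW i j S Wx).
exact: (pderiv_ext oW j (smooth_C1 (smooth_pderiv i S)) ih Wx).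
Qed.

Lemma smooth_foldr (l : seq 'I_d) v : smooth_on W v -> smooth_on W (foldr (@pderiv R d) v l).
Proof. by move=> Sv; elim: l => [|k l ih]; [exact: Sv|exact: (smooth_pderiv k ih)]. Qed.

Lemma foldr_pderiv_catC (s1 s2 : seq 'I_d) v x : smooth_on W v -> W x ->
  foldr (@pderiv R d) v (s1 ++ s2) x = foldr (@pderiv R d) v (s2 ++ s1) x.
Proof.
move=> Sv; elim: s1 x => [|i s1 ih] x Wx; first by rewrite cats0.
rewrite cat_cons /= (pderiv_ext oW i (smooth_C1 (smooth_foldr _ Sv)) ih Wx).
rewrite !foldr_cat /=; exact: (pderiv_foldrC i s2 (smooth_foldr s1 Sv) Wx).
Qed.

Lemma perm_foldr_pderiv (l l' : seq 'I_d) v x : smooth_on W v -> W x -> perm_eq l l' ->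
  foldr (@pderiv R d) v l x = foldr (@pderiv R d) v l' x.
Proof.
move=> Sv Wx; move: l l'.
(* The second premise holds trivially; it gives the goal the shape of an invariant of one list
   carried along a permutation, as [catCA_perm_ind] requires. *)
suff H (l l' : seq 'I_d) : perm_eq l l' -> (forall z, W z -> foldr (@pderiv R d) v l z = foldr (@pderiv R d) v l z) ->
    (forall z, W z -> foldr (@pderiv R d) v l z = foldr (@pderiv R d) v l' z).
  by move=> l l' ll'; exact: (H l l').
move: l'; pose l0 := l; rewrite -/l0 => l'.
apply: (@catCA_perm_ind _ (fun l' => forall z, W z -> foldr (@pderiv R d) v l0 z = foldr (@pderiv R d) v l' z)).
move=> s1 s2 s3 E z Wz; have F s : foldr (@pderiv R d) v (s ++ s3) z = foldr (@pderiv R d) (foldr (@pderiv R d) v s3) s z.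
  by rewrite foldr_cat.
rewrite E// !catA !F.
exact: (foldr_pderiv_catC s1 s2 (smooth_foldr s3 Sv) Wz).
Qed.

(** Expanding directional derivatives produces words in arbitrary order, whereas the Gevrey bounds
    speak of multi-indices, that is of sorted words. *)
Lemma mderiv_count (l : seq 'I_d) v x : smooth_on W v -> W x ->
  foldr (@pderiv R d) v l x = mderiv [ffun i => count_mem i l] v x.
Proof.
move=> Sv Wx.
pose l' := flatten [seq nseq (count_mem i l) i | i <- enum 'I_d].
have pl : perm_eq l l'.
  apply/allP => j _; apply/eqP; rewrite /l' count_flatten -map_comp sumnE big_map.
  rewrite big_enum /= (bigD1 j)//= big1 ?addn0 => [|i /negbTE ij].
    by rewrite count_nseq /= eqxx mul1n.
  by rewrite count_nseq /= ij.
rewrite (perm_foldr_pderiv Sv Wx pl) /mderiv /l'.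
congr (_ x); elim: (enum 'I_d) => //= i e ih.
rewrite foldr_cat ffunE -ih; elim: (count_mem i l) => [//|k /= -> //].
Qed.

End OnAnOpenSet.

Lemma msize_count (l : seq 'I_d) : msize [ffun i => count_mem i l] = size l.
Proof.
rewrite /msize; under eq_bigr do rewrite ffunE.
elim: l => [|j l ih]; first by rewrite big1.
rewrite /= big_split /= ih (bigD1 j)//= eqxx big1 ?addn0 ?add1n// => i ij.
by rewrite eq_sym (negbTE ij).
Qed.

Lemma mfact_le (al : {ffun 'I_d -> nat}) : (mfact al <= (msize al)`!)%N.
Proof.
rewrite /mfact /msize; elim/big_ind2 : _ => // x1 x2 y1 y2 h1 h2.
rewrite (leq_trans (leq_mul h1 h2))//.
rewrite -(@bin_fact (x1 + y1) x1) ?leq_addr// addKn.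
by rewrite leq_pmull// bin_gt0 leq_addr.
Qed.

Lemma dirD_le n v y x (M : R) :
  (forall l : seq 'I_d, size l = n -> normc (foldr (@pderiv R d) v l x) <= M) ->
  normc (dirD n v y x) <= norm1 y ^+ n * M.
Proof.
suff H (l0 : seq 'I_d) : (forall l : seq 'I_d, size l = n -> normc (foldr (@pderiv R d) v (l ++ l0) x) <= M) ->
    normc (dirD n (foldr (@pderiv R d) v l0) y x) <= norm1 y ^+ n * M.
  by move=> h; apply: (H [::]) => l ln; rewrite cats0; exact: h.
elim: n l0 => [|n ih] l0 h.
  by rewrite expr0 mul1r; exact: (h [::]).
rewrite (le_trans (normc_sum _ _ _))// exprS -mulrA mulr_suml.
apply: ler_sum => q _; rewrite normcM normc_real ler_wpM2l//.
apply: (ih (q :: l0)) => l ln.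
by rewrite -cat_rcons; apply: h; rewrite size_rcons ln.
Qed.

(** The multi-index factorial is replaced by the larger factorial of the order, so that one bound
    serves all words of length n. *)
Lemma dirD_gevrey (W K : set 'rV[R]_d) (s : R) n v y x (A B : R) : open W ->
  smooth_on W v -> W x -> K x -> 0 <= s -> 0 < A -> 0 < B -> gevrey_bound s K v A B ->
  normc (dirD n v y x) <= norm1 y ^+ n * (A * B ^+ n * n`!%:R `^ s).
Proof.
move=> oW Sv Wx Kx s0 A0 B0 H; apply: dirD_le => l ln.
rewrite (mderiv_count oW l Sv Wx) -lecR.
apply: le_trans (H _ _ Kx) _; rewrite lecR msize_count ln ler_wpM2l//.
  by rewrite mulr_ge0 ?exprn_ge0 ?ltW.
apply: ge0_ler_powR; rewrite ?nnegrE// ler_nat.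
by rewrite (leq_trans (mfact_le _))// msize_count ln.
Qed.

End DirectionalDerivatives.

(** * Gaussian integrals *)

Section TupleMeasurability.
Variables (R : realType) (d : nat).
Local Notation T := (d.-tuple (measurableTypeR R)).

(** Tuples carry the product sigma-algebra and row vectors the topology. An open set is a countable
    union of boxes with rational corners, and boxes are measurable for the product. *)
Lemma measurable_preim_open (O : set 'rV[R]_d) : open O ->
  measurable (@row_of_tuple R d @^-1` O : set T).
Proof.
move=> oO.
pose box (b : {ffun 'I_d -> rat * rat}) : set T :=
  [set t | forall i, ratr (b i).1 < tnth t i < ratr (b i).2].
have mbox b : measurable (box b).
  rewrite (_ : box b = \big[setI/[set: T]]_(i <- index_enum 'I_d)
     ((fun t : T => tnth t i) @^-1` `]ratr (b i).1, ratr (b i).2[)); last first.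
    rewrite -bigcap_seq; apply/seteqP; split=> t /= H i.
      by move=> _; rewrite /= in_itv/=; exact: H.
    by have := H i; rewrite /= mem_index_enum in_itv; exact.
  apply: bigsetI_measurable => i _; rewrite -[X in measurable X]setTI.
  by apply: (@measurable_tnth _ (measurableTypeR R) d i) => //; exact: measurable_itv.
rewrite (_ : _ @^-1` _ = \bigcup_b [set t | box b t /\ box b `<=` @row_of_tuple R d @^-1` O]).
  apply: countable_bigcupT_measurable; first exact: countableP.
  move=> b; have [bO|bO] := pselect (box b `<=` @row_of_tuple R d @^-1` O).
    by rewrite (_ : [set _ | _] = box b)//; apply/seteqP; split=> t //= -[].
  by rewrite (_ : [set _ | _] = set0)//; apply/seteqP; split=> t //= -[_].
apply/seteqP; split=> t /=; last by move=> [b _ [tb bO]]; exact: bO.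
move=> Ot.
have /nbhs_ballP[r /= r0 rO] : nbhs (row_of_tuple t) O by apply: (open_nbhs_nbhs (conj oO Ot)).
have : forall i : 'I_d, exists pq : rat * rat,
   [/\ tnth t i - r < ratr pq.1, ratr pq.1 < tnth t i, tnth t i < ratr pq.2 & ratr pq.2 < tnth t i + r].
  move=> i.
  have /rat_in_itvoo[p] : tnth t i - r < tnth t i by rewrite ltrBlDr ltrDl.
  have /rat_in_itvoo[q] : tnth t i < tnth t i + r by rewrite ltrDl.
  by rewrite !in_itv/= => /andP[q1 q2] /andP[p1 p2]; exists (p, q).
move=> /fin_all_exists[b bP]; exists [ffun i => b i] => //; split.
  by move=> i; rewrite ffunE; have [_ -> -> _] := bP i.
move=> t' /= t'b; apply: rO; split=> // i j.
rewrite !mxE /ball/= ltr_distlC; have := t'b j; rewrite ffunE => /andP[h1 h2].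
have [b1 _ _ b2] := bP j.
by rewrite (lt_trans b1 h1) (lt_trans h2 b2).
Qed.

Lemma measurable_continuous_on (U : set 'rV[R]_d) (F : 'rV[R]_d -> R) : open U ->
  (forall x, U x -> {for x, continuous F}) ->
  measurable_fun (@row_of_tuple R d @^-1` U : set T) (fun t : T => F (row_of_tuple t)).
Proof.
move=> oU cF mU; apply: (measurability _ (RGenOInfty.measurableE R)) => //.
move=> _ [_ [a ->] <-].
rewrite (_ : _ `&` _ = @row_of_tuple R d @^-1` (U `&` (F @^-1` `]a, +oo[))).
  apply: measurable_preim_open; rewrite openE => x [Ux Fx].
  apply: filterI; first exact: (open_nbhs_nbhs (conj oU Ux)).
  apply: (cF x Ux); apply: open_nbhs_nbhs; split; first exact: interval_open.
  exact: Fx.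
by [].
Qed.

End TupleMeasurability.

Section Tonelli.
Variables (R : realType) (d : nat).
Local Notation T n := (n.-tuple (measurableTypeR R)).
Local Notation mu := (lebesgue_tuple R).
Local Notation leb := (@lebesgue_measure R).
Local Open Scope ereal_scope.
Implicit Types f : T d.+1 -> \bar R.

Let cons (p : measurableTypeR R * T d) : T d.+1 := tuple_consp p.

Let mcons : measurable_fun [set: measurableTypeR R * T d] cons.
Proof. exact: measurable_tuple_consp. Qed.

Lemma integral_consE f : measurable_fun [set: T d.+1] f -> (forall t, 0 <= f t) ->
  \int[mu d.+1]_t f t = \int[lebesgue_prod (mu d)]_p f (tuple_consp p).
Proof.
move=> mf f0.
by apply: (ge0_integral_pushforward mcons (lebesgue_prod (mu d)) measurableT mf).
Qed.

Lemma tonelli1 f : measurable_fun [set: T d.+1] f -> (forall t, 0 <= f t) ->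
  \int[mu d.+1]_t f t = \int[leb]_x \int[mu d]_t f (tuple_consp (x, t)).
Proof.
move=> mf f0; rewrite integral_consE//.
have mfc : measurable_fun [set: measurableTypeR R * T d] (f \o cons) by exact: measurableT_comp.
by apply: (fubini_tonelli1 (f \o cons) mfc) => p; exact: f0.
Qed.

Lemma integrable_cons f : (mu d.+1).-integrable [set: T d.+1] f ->
  (lebesgue_prod (mu d)).-integrable [set: measurableTypeR R * T d] (f \o cons).
Proof.
move=> /integrableP[mf foo]; apply/integrableP; split; first exact: measurableT_comp.
rewrite -(@integral_consE (fun t => `|f t|))//.
exact: measurableT_comp.
Qed.

Lemma integral_cons f : (mu d.+1).-integrable [set: T d.+1] f ->
  \int[mu d.+1]_t f t = \int[lebesgue_prod (mu d)]_p f (tuple_consp p).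
Proof.
move=> intf; have mf := measurable_int _ intf.
by apply: (integral_pushforward mcons (mu := lebesgue_prod (mu d)) mf) => //; exact: integrable_cons.
Qed.

Lemma fubini1 f : (mu d.+1).-integrable [set: T d.+1] f ->
  \int[mu d.+1]_t f t = \int[leb]_x \int[mu d]_t f (tuple_consp (x, t)).
Proof.
move=> intf; rewrite integral_cons//.
exact: (esym (integral12_prod_meas1 (integrable_cons intf))).
Qed.

Lemma fubini2 f : (mu d.+1).-integrable [set: T d.+1] f ->
  \int[mu d.+1]_t f t = \int[mu d]_t \int[leb]_x f (tuple_consp (x, t)).
Proof.
move=> intf; rewrite integral_cons//.
exact: (esym (integral21_prod_meas1 (integrable_cons intf))).
Qed.

End Tonelli.

Section GaussianIntegral.
Variable R : realType.
Local Notation T n := (n.-tuple (measurableTypeR R)).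
Local Notation mu := (lebesgue_tuple R).
Local Notation leb := (@lebesgue_measure R).

Definition sqdist n (a t : T n) : R := \sum_i (tnth t i - tnth a i) ^+ 2.

Lemma sqdist_cons n (a0 x : R) (a t : T n) :
  sqdist (tuple_consp (a0, a)) (tuple_consp (x, t)) = (x - a0) ^+ 2 + sqdist a t.
Proof.
rewrite /sqdist big_ord_recl; congr (_ + _).
by apply: eq_bigr => i _; rewrite !tnthS.
Qed.

Lemma measurable_sqdist n (a : T n) : measurable_fun [set: T n] (fun t => sqdist a t).
Proof.
apply: measurable_sum => i; apply: measurable_funX; apply: measurable_funB => //.
exact: (@measurable_tnth _ (measurableTypeR R) n i).
Qed.

Lemma gauss1 (c a : R) : 0 < c ->
  (\int[leb]_x (expR (- c * (x - a) ^+ 2))%:E = (Num.sqrt (pi / c))%:E)%E.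
Proof.
move=> c0.
(* The standard deviation for which the normal density is proportional to exp (- c (x - a)^2). *)
pose sg := Num.sqrt (2 * c)^-1.
have c20 : 0 < (2 * c)^-1 by rewrite invr_gt0 mulr_gt0.
have sg0 : sg != 0 by rewrite gt_eqF// sqrtr_gt0.
have sg2 : sg ^+ 2 *+ 2 = c^-1.
  rewrite sqr_sqrtr ?(ltW c20)// -mulr_natr; field; exact: lt0r_neq0.
have := integral_normal_pdf a sg; rewrite (normal_pdfE _ sg0).
have p0 : normal_peak sg != 0 by rewrite gt_eqF// normal_peak_gt0.
under eq_integral do rewrite EFinM.
rewrite ge0_integralZl//; first last.
- by rewrite lee_fin normal_peak_ge0.
- by move=> x _; rewrite lee_fin expR_ge0.
- apply/measurable_EFinP; apply: measurableT_comp => //.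
  by apply: measurable_funM => //; apply: measurableT_comp => //; apply: measurable_funX; exact: measurable_funB.
have -> : normal_peak sg = (Num.sqrt (pi / c))^-1.
  by rewrite /normal_peak mulrC -mulrnAr sg2.
have q0 : Num.sqrt (pi / c) != 0 :> R by rewrite gt_eqF// sqrtr_gt0 divr_gt0// pi_gt0.
have E x : normal_fun a sg x = expR (- c * (x - a) ^+ 2).
  by rewrite /normal_fun sg2 invrK; congr expR; ring.
under eq_integral => x _ do rewrite E.
move=> /(congr1 (fun z => ((Num.sqrt (pi / c))%:E * z)%E)).
by rewrite muleA -EFinM divff// mul1e mule1.
Qed.

Lemma gauss_tuple n (c : R) (a : T n) : 0 < c ->
  (\int[mu n]_t (expR (- c * sqdist a t))%:E = (Num.sqrt (pi / c) ^+ n)%:E)%E.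
Proof.
move=> c0; elim: n a => [|n ih] a.
  rewrite integral_dirac//; last first.
    by apply/measurable_EFinP; apply: measurableT_comp => //; apply: measurable_funM => //; exact: measurable_sqdist.
  by rewrite diracT mul1e /sqdist big_ord0 mulr0 expR0 expr0.
case/tupleP: a => a0 a.
have mg m (b : T m) : measurable_fun [set: T m] (fun t => (expR (- c * sqdist b t))%:E).
  apply/measurable_EFinP; apply: measurableT_comp => //.
  by apply: measurable_funM => //; exact: measurable_sqdist.
rewrite tonelli1//.
have E x t : (expR (- c * sqdist [tuple of a0 :: a] (tuple_consp (x, t))))%:E =
    ((expR (- c * (x - a0) ^+ 2))%:E * (expR (- c * sqdist a t))%:E)%E.
  by rewrite (sqdist_cons a0 x a t) mulrDr expRD EFinM.
have H x : (\int[mu n]_t (expR (- c * sqdist [tuple of a0 :: a] (tuple_consp (x, t))))%:E =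
    (expR (- c * (x - a0) ^+ 2))%:E * (Num.sqrt (pi / c) ^+ n)%:E)%E.
  under eq_integral do rewrite E.
  by rewrite ge0_integralZl// ?ih//; exact: mg.
under eq_integral => x _ do rewrite H.
rewrite ge0_integralZr//; last first.
  apply/measurable_EFinP; apply: measurableT_comp => //.
  by apply: measurable_funM => //; apply: measurable_funX; exact: measurable_funB.
by rewrite gauss1// -EFinM exprS.
Qed.

Lemma gauss_integrable n (c K : R) (a : T n) (f : T n -> R) : 0 < c ->
  measurable_fun [set: T n] f -> (forall t, `|f t| <= K * expR (- c * sqdist a t)) ->
  (mu n).-integrable [set: T n] (EFin \o f).
Proof.
move=> c0 mf fK.
have K0 : 0 <= K.
  have := le_trans (normr_ge0 _) (fK a).
  by rewrite pmulr_lge0// expR_gt0.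
have mg : measurable_fun [set: T n] (fun t => K * expR (- c * sqdist a t)).
  apply: measurable_funM => //; apply: measurableT_comp => //.
  by apply: measurable_funM => //; exact: measurable_sqdist.
apply: (@le_integrable _ _ _ _ _ _ _ (fun t => (K * expR (- c * sqdist a t))%:E)) => //.
- exact/measurable_EFinP.
- move=> t _ /=; rewrite lee_fin; apply: le_trans (fK t) _.
  exact: ler_norm.
apply/integrableP; split; first exact/measurable_EFinP.
under eq_integral => t _ do rewrite gee0_abs ?lee_fin ?mulr_ge0 ?expR_ge0// EFinM.
rewrite ge0_integralZl//; first by rewrite gauss_tuple// -EFinM ltry.
apply/measurable_EFinP; apply: measurableT_comp => //.
by apply: measurable_funM => //; exact: measurable_sqdist.
Qed.

Lemma gauss_Rintegral_le n (c K : R) (a : T n) (f : T n -> R) : 0 < c ->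
  measurable_fun [set: T n] f -> (forall t, `|f t| <= K * expR (- c * sqdist a t)) ->
  `|\int[mu n]_t f t| <= K * Num.sqrt (pi / c) ^+ n.
Proof.
move=> c0 mf fK.
have K0 : 0 <= K.
  have := le_trans (normr_ge0 _) (fK a).
  by rewrite pmulr_lge0// expR_gt0.
have mg : measurable_fun [set: T n] (fun t => expR (- c * sqdist a t)).
  apply: measurableT_comp => //.
  by apply: measurable_funM => //; exact: measurable_sqdist.
have intg : (mu n).-integrable [set: T n] (EFin \o (fun t => expR (- c * sqdist a t))).
  by apply: (@gauss_integrable n c 1 a) => // t; rewrite mul1r ger0_norm// expR_ge0.
have intf := gauss_integrable c0 mf fK.
rewrite (le_trans (le_normr_Rintegral measurableT intf))//.
rewrite (@le_trans _ _ (\int[mu n]_t (K * expR (- c * sqdist a t))))//.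
  apply: le_Rintegral => //; first exact: integrable_norm.
  by apply: (@gauss_integrable n c K a) => //; [exact: measurable_funM|move=> t; rewrite ger0_norm// mulr_ge0// expR_ge0].
by rewrite RintegralZl// /Rintegral gauss_tuple.
Qed.

End GaussianIntegral.

Section IntegrationByParts.
Variable R : realType.
Local Notation T n := (n.-tuple (measurableTypeR R)).
Local Notation mu := (lebesgue_tuple R).
Local Notation leb := (@lebesgue_measure R).

Lemma gauss_integrable1 (c K a : R) (f : R -> R) : 0 < c ->
  measurable_fun [set: R] f -> (forall x, `|f x| <= K * expR (- c * (x - a) ^+ 2)) ->
  leb.-integrable [set: R] (EFin \o f).
Proof.
move=> c0 mf fK.
have K0 : 0 <= K.
  have := le_trans (normr_ge0 _) (fK a).
  by rewrite pmulr_lge0// expR_gt0.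
have me : measurable_fun [set: R] (fun x => expR (- c * (x - a) ^+ 2)).
  apply: measurableT_comp => //.
  by apply: measurable_funM => //; apply: measurable_funX; exact: measurable_funB.
have intg : leb.-integrable [set: R] (EFin \o (fun t : R => K * expR (- c * (t - a) ^+ 2))).
  apply/integrableP; split; first by apply/measurable_EFinP; exact: measurable_funM.
  under eq_integral => t _ do rewrite /= ger0_norm ?mulr_ge0 ?expR_ge0// EFinM.
  rewrite ge0_integralZl//; first by rewrite gauss1// -EFinM ltry.
  exact/measurable_EFinP.
apply: (le_integrable measurableT _ _ intg); first exact/measurable_EFinP.
by move=> t _ /=; rewrite lee_fin (le_trans (fK t))// ler_norm.
Qed.

Lemma gauss_cvg0 (c K a sg : R) (F : R -> R) : 0 < c -> `|sg| = 1 ->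
  (forall x, `|F x| <= K * expR (- c * (x - a) ^+ 2)) ->
  F (sg * n.+1%:R) @[n --> \oo] --> 0.
Proof.
move=> c0 sg1 FK; have K0 : 0 <= K.
  have := le_trans (normr_ge0 _) (FK a).
  by rewrite pmulr_lge0// expR_gt0.
apply/cvgrPdist_le => e e0.
(* At distance at least M from [a] the Gaussian is at most exp (- c M), and e exp (c M) >= e (1 + c
   M) >= K. The summand 1 gives M <= M^2. *)
pose M := 1 + K / (c * e).
have M1 : 1 <= M by rewrite lerDl divr_ge0// mulr_ge0 ?ltW.
have M0 : 0 <= M by rewrite (le_trans _ M1).
near=> n; rewrite sub0r normrN (le_trans (FK _))//.
have nM : M <= `|sg * n.+1%:R - a|.
  rewrite (le_trans _ (lerB_dist _ _))// normrM sg1 mul1r ger0_norm// lerBrDr.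
  near: n; exists (Num.bound (M + `|a|)) => // n /= nn.
  by rewrite (le_trans (ltW (archi_boundP (addr_ge0 M0 (normr_ge0 a)))))// ler_nat (leq_trans nn).
have M2 : M <= (sg * n.+1%:R - a) ^+ 2.
  by rewrite -real_normK ?num_real// (le_trans nM)// expr2 ler_peMr// (le_trans M1 nM).
rewrite mulNr expRN ler_pdivrMr ?expR_gt0//.
apply: le_trans (_ : e * (1 + c * M) <= _); last first.
  rewrite ler_wpM2l ?(ltW e0)// (le_trans _ (expR_ge1Dx _))// lerD2l ler_wpM2l// ltW//.
rewrite /M mulrDr mulr1 mulrDr mulr1 mulrDr.
have -> : e * (c * (K / (c * e))) = K.
  by field; rewrite ?gt_eqF.
by rewrite addrA lerDr addr_ge0 ?mulr_ge0 ?ltW.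
Unshelve. all: by end_near. Qed.

(** The fundamental theorem of calculus on [- n - 1, n + 1], then dominated convergence for the
    integrals and Gaussian decay of [F] for the boundary terms. *)
Lemma integral_derive0 (c K a : R) (F f : R -> R) : 0 < c ->
  (forall x : R, is_derive x 1 F (f x)) -> continuous f ->
  (forall x, `|F x| <= K * expR (- c * (x - a) ^+ 2)) ->
  (forall x, `|f x| <= K * expR (- c * (x - a) ^+ 2)) ->
  (\int[leb]_x (f x)%:E = 0)%E.
Proof.
move=> c0 DF cf FK fK.
have mf : measurable_fun [set: R] f by exact: continuous_measurable_fun.
have intf := gauss_integrable1 c0 mf fK.
pose D n : set R := `[- n.+1%:R, n.+1%:R]%classic.
have ED n : (\int[leb]_(x in D n) (f x)%:E = (F n.+1%:R - F (- n.+1%:R))%:E)%E.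
  rewrite (@continuous_FTC2 R f F)//.
  - by rewrite gtrN.
  - by apply: continuous_subspaceT.
  - split=> [x _||].
    + exact: (@ex_derive _ _ _ _ _ _ _ (DF x)).
    + apply: cvg_at_right_filter.
      exact/differentiable_continuous/derivable1_diffP/(@ex_derive _ _ _ _ _ _ _ (DF _)).
    + apply: cvg_at_left_filter.
      exact/differentiable_continuous/derivable1_diffP/(@ex_derive _ _ _ _ _ _ _ (DF _)).
  - by move=> x _; rewrite derive1E; exact: (@derive_val _ _ _ _ _ _ _ (DF x)).
pose f_ n x := (((EFin \o f) \_ (D n)) x)%E.
have [|||||_ _] := @dominated_convergence _ _ R leb setT measurableT f_ (EFin \o f)
   (fun x => `|f x|%:E).
- move=> n; apply/(measurable_restrictT _ _).1 => //; first exact: measurable_itv.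
  by apply/measurable_EFinP; exact: measurable_funTS.
- exact/measurable_EFinP.
- apply: aeW => x _.
  apply: cvg_near_cst; near=> n.
  rewrite /f_ /patch ifT//; rewrite inE /D /= in_itv /= -ler_norml.
  near: n; exists (Num.bound `|x|) => // n /= nn.
  by rewrite (le_trans (ltW (archi_boundP _)))// ler_nat (leq_trans nn).
- exact: (integrable_norm intf).
- apply: aeW => x n _; rewrite /f_ /patch; case: ifP => //= _.
  by rewrite normr0 lee_fin.
move=> Hcv.
have H0 : (\int[leb]_x (f_ n x))%E @[n --> \oo] --> 0%E.
  under eq_fun => n do rewrite -integral_mkcond /= ED.
  apply: cvg_EFin; first by near=> n.
  rewrite [X in X @ _ --> _](_ : _ = (fun n => F (1 * n.+1%:R) - F (-1 * n.+1%:R))); last first.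
    by apply/funext => n /=; rewrite mul1r mulN1r.
  rewrite -[X in _ --> X]subr0; apply: cvgB.
    by apply: gauss_cvg0 FK => //; rewrite normr1.
  by apply: gauss_cvg0 FK => //; rewrite normrN1.
by apply: cvg_unique Hcv H0.
Unshelve. all: by end_near. Qed.

Definition upd n (t : T n) (p : 'I_n) (s : R) : T n :=
  [tuple (if i == p then s else tnth t i) | i < n].

(** Induction on the dimension, splitting off the first coordinate. If it is not the p-th it stays
    outside as a parameter, its Gaussian factor absorbed in [K]; if it is the p-th it is integrated
    first. *)
Lemma integral_partial0 n (p : 'I_n) (c K : R) (a : T n) (F f : T n -> R) : 0 < c ->
  measurable_fun [set: T n] f ->
  (forall t (s : R), is_derive s 1 (fun s => F (upd t p s)) (f (upd t p s))) ->
  (forall t, continuous (fun s : R => f (upd t p s))) ->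
  (forall t, `|F t| <= K * expR (- c * sqdist a t)) ->
  (forall t, `|f t| <= K * expR (- c * sqdist a t)) ->
  (\int[mu n]_t (f t)%:E = 0)%E.
Proof.
elim: n p K a F f => [|n ih] p K a F f c0 mf DF cf FK fK; first by have := ltn_ord p; rewrite ltn0.
have intf := gauss_integrable c0 mf fK.
case/tupleP: a FK fK => a0 a FK fK.
have K0 : 0 <= K.
  have := le_trans (normr_ge0 _) (FK [tuple of a0 :: a]).
  by rewrite pmulr_lge0// expR_gt0.
case: (unliftP ord0 p) => [q|] pE.
- rewrite fubini1//; rewrite integral0_eq// => x _.
  have upE t s : upd (tuple_consp (x, t)) p s = tuple_consp (x, upd t q s).
    apply: eq_from_tnth => i; rewrite tnth_mktuple pE.
    case: (unliftP ord0 i) => [j|] ->.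
      by rewrite !tnthS tnth_mktuple (inj_eq lift_inj).
    by rewrite !tnth0.
  apply: (ih q (K * expR (- c * (x - a0) ^+ 2)) a (fun t => F (tuple_consp (x, t)))) => //.
  + apply: (measurableT_comp mf).
    exact: (measurableT_comp (@measurable_tuple_consp R n) (pair1_measurable x)).
  + by move=> t s; have := DF (tuple_consp (x, t)) s; rewrite upE; under eq_fun do rewrite upE.
  + by move=> t; have := cf (tuple_consp (x, t)); under eq_fun do rewrite upE.
  + by move=> t; rewrite -mulrA -expRD -mulrDr -sqdist_cons; exact: FK.
  + by move=> t; rewrite -mulrA -expRD -mulrDr -sqdist_cons; exact: fK.
- rewrite fubini2//; rewrite integral0_eq// => t _.
  have upE x s : upd (tuple_consp (x, t)) p s = tuple_consp (s, t).
    apply: eq_from_tnth => i; rewrite tnth_mktuple pE.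
    case: (unliftP ord0 i) => [j|] ->; last by rewrite eqxx tnth0.
    by rewrite !tnthS.
  apply: (@integral_derive0 c (K * expR (- c * sqdist a t)) a0 (fun x => F (tuple_consp (x, t)))) => //.
  + by move=> s; have := DF (tuple_consp (0, t)) s; rewrite upE; under eq_fun do rewrite upE.
  + by have := cf (tuple_consp (0, t)); under eq_fun do rewrite upE.
  + by move=> x; rewrite mulrAC -mulrA -expRD -mulrDr -sqdist_cons; exact: FK.
  + by move=> x; rewrite mulrAC -mulrA -expRD -mulrDr -sqdist_cons; exact: fK.
Qed.

End IntegrationByParts.

Section SquaredNorm.
Variables (R : realType) (d : nat).
Implicit Types (y : 'rV[R]_d).

Definition sqnorm y : R := \sum_i (y 0 i) ^+ 2.

Lemma sqnorm_ge0 y : 0 <= sqnorm y.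
Proof. by apply: sumr_ge0 => i _; exact: sqr_ge0. Qed.

Lemma coord_le_sqnorm y i : (y 0 i) ^+ 2 <= sqnorm y.
Proof. by rewrite /sqnorm (bigD1 i)//= lerDl sumr_ge0// => j _; exact: sqr_ge0. Qed.

Lemma sqnorm_gt0 y : y != 0 -> 0 < sqnorm y.
Proof.
move=> y0; rewrite lt_neqAle sqnorm_ge0 andbT eq_sym; apply: contra_neq y0 => sy.
apply/rowP => i; rewrite mxE; apply/eqP; rewrite -sqrf_eq0 eq_le sqr_ge0 andbT.
by rewrite -sy coord_le_sqnorm.
Qed.

(** Cauchy-Schwarz, by summing |a| |b| <= (a^2 + b^2) / 2 over all pairs of coordinates. *)
Lemma norm1_le_sqnorm y : norm1 y ^+ 2 <= d%:R * sqnorm y.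
Proof.
rewrite /norm1 expr2 mulr_suml.
have E : \sum_i \sum_j (`|y 0 i| ^+ 2 + `|y 0 j| ^+ 2) / 2 = d%:R * sqnorm y.
  under eq_bigr do (under eq_bigr do rewrite mulrDl; rewrite big_split).
  rewrite big_split /= exchange_big /= -big_split.
  transitivity (\sum_(i < d) sqnorm y); last by rewrite sumr_const card_ord mulr_natl.
  apply: eq_bigr => i _; rewrite /= -mulr_suml -splitr.
  by apply: eq_bigr => j _; rewrite real_normK ?num_real.
rewrite -E; apply: ler_sum => i _; rewrite mulr_sumr; apply: ler_sum => j _.
rewrite ler_pdivlMr// -subr_ge0.
by rewrite (_ : _ - _ = (`|y 0 i| - `|y 0 j|) ^+ 2) ?sqr_ge0//; ring.
Qed.

End SquaredNorm.

(** * Integrals of Gaussian-dominated complex functions over the whole space *)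

Section FullIntegral.
Variables (R : realType) (d : nat).
Local Notation T := (d.-tuple (measurableTypeR R)).
Local Notation mu := (lebesgue_tuple R d).
Local Notation row := (@row_of_tuple R d).
Local Notation basis i := (delta_mx 0 i : 'rV[R]_d).
Implicit Types (F G : 'rV[R]_d -> R[i])  (x y : 'rV[R]_d).

Definition tuple_of_row x : T := [tuple x 0 i | i < d].

Lemma sqdist_row x0 (t : T) : sqdist (tuple_of_row x0) t = sqnorm (row t - x0).
Proof. by apply: eq_bigr => i _; rewrite !mxE tnth_mktuple. Qed.

Definition ccontinuous F := forall x, ccontinuous_at F x.

Definition cmeasurable F :=
  measurable_fun [set: T] (fun t => re (F (row t))) /\
  measurable_fun [set: T] (fun t => im (F (row t))).

Definition gauss_le x0 (c K : R) F := forall x, normc (F x) <= K * expR (- c * sqnorm (x - x0)).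

(** A class closed under sums and scalar multiples on which the integral is linear. The integrands
    compared below lie in it, so integrability is never argued separately. *)
Definition gauss_dom x0 F := cmeasurable F /\ exists c K : R, 0 < c /\ gauss_le x0 c K F.

Lemma ccontinuous_measurable F : ccontinuous F -> cmeasurable F.
Proof.
move=> cF; split.
- have := @measurable_continuous_on R d setT (re \o F) openT (fun x _ => (cF x).1).
  by rewrite preimage_setT.
- have := @measurable_continuous_on R d setT (im \o F) openT (fun x _ => (cF x).2).
  by rewrite preimage_setT.
Qed.

Lemma cmeasurableD F G : cmeasurable F -> cmeasurable G -> cmeasurable (fun x => F x + G x).
Proof.
move=> [F1 F2] [G1 G2]; split.
- by under eq_fun do rewrite ReD; exact: measurable_funD.
- by under eq_fun do rewrite ImD; exact: measurable_funD.
Qed.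

Lemma cmeasurableZ k F : cmeasurable F -> cmeasurable (fun x => k * F x).
Proof.
move=> [F1 F2]; split.
- by under eq_fun do rewrite ReM; apply: measurable_funB; exact: measurable_funM.
- by under eq_fun do rewrite ImM; apply: measurable_funD; exact: measurable_funM.
Qed.

Lemma gauss_le_ge0 x0 c K F : gauss_le x0 c K F -> 0 <= K.
Proof. by move=> /(_ 0) /(le_trans (normc_ge0 _)); rewrite pmulr_lge0// expR_gt0. Qed.

Lemma gauss_le_weaken x0 c c' K K' F : c' <= c -> K <= K' ->
  gauss_le x0 c K F -> gauss_le x0 c' K' F.
Proof.
move=> cc KK H x; apply: le_trans (H x) _; apply: ler_pM => //.
- exact: gauss_le_ge0 H.
- by rewrite ler_expR ler_wpM2r ?sqnorm_ge0// lerN2.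
Qed.

Lemma gauss_domD x0 F G : gauss_dom x0 F -> gauss_dom x0 G ->
  gauss_dom x0 (fun x => F x + G x).
Proof.
move=> [mF [c [K [c0 HF]]]] [mG [c' [K' [c'0 HG]]]]; split; first exact: cmeasurableD.
exists (Num.min c c'), (K + K'); split; first by rewrite lt_min c0.
move=> x; rewrite (le_trans (normcD _ _))// mulrDl lerD//.
- by apply: (gauss_le_weaken (c := c) (K := K)) => //; rewrite ge_min lexx.
- by apply: (gauss_le_weaken (c := c') (K := K')) => //; rewrite ge_min lexx orbT.
Qed.

Lemma gauss_domZ x0 k F : gauss_dom x0 F -> gauss_dom x0 (fun x => k * F x).
Proof.
move=> [mF [c [K [c0 HF]]]]; split; first exact: cmeasurableZ.
exists c, (normc k * K); split=> // x.
by rewrite normcM -mulrA ler_wpM2l// normc_ge0.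
Qed.

Lemma gauss_dom0 x0 : gauss_dom x0 (fun=> 0).
Proof.
split; first by split; exact: measurable_cst.
exists 1, 1; split=> // x; rewrite -[X in X <= _]/(normc 0%C) normc0.
by rewrite mul1r expR_ge0.
Qed.

Lemma gauss_dom_sum x0 (I : Type) (r : seq I) (F : I -> 'rV[R]_d -> R[i]) :
  (forall i, gauss_dom x0 (F i)) -> gauss_dom x0 (fun x => \sum_(i <- r) F i x).
Proof.
move=> H; elim: r => [|i r ih].
  by under eq_fun do rewrite big_nil; exact: gauss_dom0.
by under eq_fun do rewrite big_cons; exact: gauss_domD.
Qed.

Lemma gauss_dom_integrable x0 F : gauss_dom x0 F ->
  mu.-integrable [set: T] (EFin \o (fun t => re (F (row t)))) /\
  mu.-integrable [set: T] (EFin \o (fun t => im (F (row t)))).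
Proof.
move=> [[m1 m2] [c [K [c0 HF]]]]; split.
- apply: (@gauss_integrable R d c K (tuple_of_row x0)) => // t.
  by rewrite sqdist_row (le_trans (normr_Re _)).
- apply: (@gauss_integrable R d c K (tuple_of_row x0)) => // t.
  by rewrite sqdist_row (le_trans (normr_Im _)).
Qed.

Definition cint F : R[i] := cintegral setT F.

Lemma Re_cint F : re (cint F) = \int[mu]_t re (F (row t)).
Proof. by rewrite /cint /cintegral /= preimage_setT. Qed.

Lemma Im_cint F : im (cint F) = \int[mu]_t im (F (row t)).
Proof. by rewrite /cint /cintegral /= preimage_setT. Qed.

Lemma cintD x0 F G : gauss_dom x0 F -> gauss_dom x0 G ->
  cint (fun x => F x + G x) = cint F + cint G.
Proof.
move=> /gauss_dom_integrable[F1 F2] /gauss_dom_integrable[G1 G2].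
apply: complex_eqP.
- by rewrite ReD !Re_cint; under eq_Rintegral do rewrite ReD; rewrite RintegralD.
- by rewrite ImD !Im_cint; under eq_Rintegral do rewrite ImD; rewrite RintegralD.
Qed.

Lemma cintZ x0 k F : gauss_dom x0 F -> cint (fun x => k * F x) = k * cint F.
Proof.
move=> DF; have [F1 F2] := gauss_dom_integrable DF.
have iZ (a : R) (f : T -> R) : mu.-integrable [set: T] (EFin \o f) ->
    mu.-integrable [set: T] (EFin \o (fun t => a * f t)).
  by move=> intf; have := integrableZl measurableT a intf.
apply: complex_eqP.
- rewrite ReM !Re_cint !Im_cint; under eq_Rintegral do rewrite ReM.
  by rewrite RintegralB ?RintegralZl//; exact: iZ.
- rewrite ImM !Re_cint !Im_cint; under eq_Rintegral do rewrite ImM.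
  by rewrite RintegralD ?RintegralZl//; exact: iZ.
Qed.

Lemma cint0 : cint (fun=> 0) = 0.
Proof.
by apply: complex_eqP; rewrite ?Re_cint ?Im_cint /Rintegral integral0_eq.
Qed.

Lemma cint_sum x0 (I : Type) (r : seq I) (F : I -> 'rV[R]_d -> R[i]) :
  (forall i, gauss_dom x0 (F i)) ->
  cint (fun x => \sum_(i <- r) F i x) = \sum_(i <- r) cint (F i).
Proof.
move=> H; elim: r => [|i r ih].
  by rewrite big_nil; under eq_fun do rewrite big_nil; exact: cint0.
rewrite big_cons -ih; under eq_fun do rewrite big_cons.
by apply: (cintD (x0 := x0)) => //; exact: gauss_dom_sum.
Qed.

Lemma cint_le x0 (c K : R) F : 0 < c -> cmeasurable F -> gauss_le x0 c K F ->
  normc (cint F) <= 2 * (K * Num.sqrt (pi / c) ^+ d).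
Proof.
move=> c0 [m1 m2] HF; apply: normc_le2.
- rewrite Re_cint; apply: (@gauss_Rintegral_le R d c K (tuple_of_row x0)) => // t.
  by rewrite sqdist_row (le_trans (normr_Re _)).
- rewrite Im_cint; apply: (@gauss_Rintegral_le R d c K (tuple_of_row x0)) => // t.
  by rewrite sqdist_row (le_trans (normr_Im _)).
Qed.

Lemma cint_partial0 (p : 'I_d) (x0 : 'rV[R]_d) (c K : R) F f : 0 < c ->
  ccontinuous f -> (forall x, is_cdir x (basis p) F (f x)) ->
  gauss_le x0 c K F -> gauss_le x0 c K f -> cint f = 0.
Proof.
move=> c0 cf DF FK fK; have [m1 m2] := ccontinuous_measurable cf.
have rowU (t : T) (s : R) : row (upd t p s) = (row t - (row t 0 p) *: basis p) + s *: basis p.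
  apply/rowP => i; rewrite !mxE tnth_mktuple eqxx /=.
  by case: eqP => [->|_]; rewrite ?mulr1 ?mulr0; ring.
have cline (g : 'rV[R]_d -> R) : (forall x, {for x, continuous g}) ->
    forall t, continuous (fun s : R => g (row (upd t p s))).
  move=> cg t s; under eq_fun do rewrite rowU.
  apply: (@continuous_comp _ _ _ (fun s : R => (row t - (row t 0 p) *: basis p) + s *: basis p) g).
    apply: continuousD; first exact: cst_continuous.
    exact: scalel_continuous.
  by rewrite -rowU; exact: cg.
apply: complex_eqP; rewrite ?Re_cint ?Im_cint.
- suff H : (\int[mu]_t (re (f (row t)))%:E = 0)%E by rewrite /Rintegral H.
  apply: (@integral_partial0 R d p c K (tuple_of_row x0) (fun t => re (F (row t))) (fun t => re (f (row t)))) => //.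
  + move=> t s; rewrite rowU; under eq_fun do rewrite rowU.
    by apply: (is_derive_line (re \o F) _ _ _ _).1; exact: (DF _).1.
  + by apply: (cline (re \o f)) => x; exact: (cf x).1.
  + by move=> t; rewrite sqdist_row (le_trans (normr_Re _)).
  + by move=> t; rewrite sqdist_row (le_trans (normr_Re _)).
- suff H : (\int[mu]_t (im (f (row t)))%:E = 0)%E by rewrite /Rintegral H.
  apply: (@integral_partial0 R d p c K (tuple_of_row x0) (fun t => im (F (row t))) (fun t => im (f (row t)))) => //.
  + move=> t s; rewrite rowU; under eq_fun do rewrite rowU.
    by apply: (is_derive_line (im \o F) _ _ _ _).1; exact: (DF _).2.
  + by apply: (cline (im \o f)) => x; exact: (cf x).2.
  + by move=> t; rewrite sqdist_row (le_trans (normr_Im _)).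
  + by move=> t; rewrite sqdist_row (le_trans (normr_Im _)).
Qed.

End FullIntegral.

Section ContinuousComplexFunctions.
Variables (R : realType) (d : nat).
Implicit Types (F G : 'rV[R]_d -> R[i]) (x y : 'rV[R]_d).

Lemma ccontinuousD F G : ccontinuous F -> ccontinuous G -> ccontinuous (fun x => F x + G x).
Proof. by move=> cF cG x; exact: ccontinuous_atD. Qed.

Lemma ccontinuousM F G : ccontinuous F -> ccontinuous G -> ccontinuous (fun x => F x * G x).
Proof. by move=> cF cG x; exact: ccontinuous_atM. Qed.

Lemma ccontinuous_cst c : ccontinuous (fun _ : 'rV[R]_d => c).
Proof. by move=> x; split; exact: cst_continuous. Qed.

Lemma ccontinuous_sum (I : Type) (r : seq I) (F : I -> 'rV[R]_d -> R[i]) :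
  (forall i, ccontinuous (F i)) -> ccontinuous (fun x => \sum_(i <- r) F i x).
Proof.
move=> H; elim: r => [|i r ih].
  by under eq_fun do rewrite big_nil; exact: ccontinuous_cst.
by under eq_fun do rewrite big_cons; exact: ccontinuousD.
Qed.

Lemma ccontinuous_coord x0 j : ccontinuous (fun x => ((x - x0) 0 j)%:C%C).
Proof.
move=> x; split; last exact: cst_continuous.
rewrite (_ : _ \o _ = (fun z : 'rV[R]_d => z 0 j - x0 0 j)).
  by apply: continuousB; [exact: coord_continuous|exact: cst_continuous].
by apply/funext => z /=; rewrite !mxE.
Qed.

Lemma ccontinuous_at_cexp F x : ccontinuous_at F x -> ccontinuous_at (fun x => cexp (F x)) x.
Proof.
move=> [F1 F2].
have ce : {for x, continuous (fun z => expR (re (F z)))}.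
  exact: (continuous_comp F1 (@continuous_expR R _)).
split.
- apply: (@continuousM _ _ (fun z => expR (re (F z))) (fun z => cos (im (F z)))) => //.
  exact: (continuous_comp F2 (@continuous_cos R _)).
- apply: (@continuousM _ _ (fun z => expR (re (F z))) (fun z => sin (im (F z)))) => //.
  exact: (continuous_comp F2 (@continuous_sin R _)).
Qed.

Lemma ccontinuous_cexp F : ccontinuous F -> ccontinuous (fun x => cexp (F x)).
Proof. by move=> cF x; exact: ccontinuous_at_cexp. Qed.

Lemma ccontinuous_dirD n v x0 x1 : ccontinuous (fun x => dirD n v (x - x0) x1).
Proof.
elim: n v => [|n ih] v; first exact: ccontinuous_cst.
by apply: ccontinuous_sum => q; apply: ccontinuousM => //; exact: ccontinuous_coord.
Qed.

End ContinuousComplexFunctions.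

(** * Gaussian moments *)

Section GaussianWeight.
Variables (R : realType) (d : nat).
Local Notation basis i := (delta_mx 0 i : 'rV[R]_d).
Implicit Types (A Q : 'M[R[i]]_d) (x y : 'rV[R]_d) (v : 'rV[R]_d -> R[i]).

Definition qform A y : R[i] := \sum_p \sum_q (y 0 p)%:C%C * A p q * (y 0 q)%:C%C.

(** For [A = (h i)^-1 f''(x0)] this is exp (i f''(x0) y . y / 2 h) with y = x - x0. The real part of
    A is then Im f''(x0) / h, whence [coercive]. *)
Definition weight A x0 x : R[i] := cexp (- 2^-1 * qform A (x - x0)).

Definition coercive A (lam : R) := forall y, lam * sqnorm y <= re (qform A y).

Lemma ccontinuous_qform A x0 : ccontinuous (fun x => qform A (x - x0)).
Proof.
apply: ccontinuous_sum => p; apply: ccontinuous_sum => q.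
apply: ccontinuousM; last exact: ccontinuous_coord.
by apply: ccontinuousM; [exact: ccontinuous_coord|exact: ccontinuous_cst].
Qed.

Lemma ccontinuous_weight A x0 : ccontinuous (weight A x0).
Proof.
apply: ccontinuous_cexp; apply: ccontinuousM; first exact: ccontinuous_cst.
exact: ccontinuous_qform.
Qed.

Lemma Re_half (z : R[i]) : re (- 2^-1 * z) = - 2^-1 * re z.
Proof.
have -> : - 2^-1 = (- 2^-1)%:C%C :> R[i] by rewrite rmorphN fmorphV rmorph_nat.
by rewrite ReZ.
Qed.

Lemma normc_weight A x0 x : normc (weight A x0 x) = expR (- 2^-1 * re (qform A (x - x0))).
Proof. by rewrite /weight normc_cexp Re_half. Qed.

Lemma weight_le A lam x0 x : coercive A lam ->
  normc (weight A x0 x) <= expR (- (lam / 2) * sqnorm (x - x0)).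
Proof.
move=> cA; rewrite normc_weight ler_expR !mulNr lerN2 mulrAC mulrC.
by rewrite ler_wpM2l.
Qed.

Lemma cdir_qform A x0 x p : A^T = A ->
  is_cdir x (basis p) (fun z => qform A (z - x0)) (2 * \sum_q A p q * ((x - x0) 0 q)%:C%C).
Proof.
move=> symA; set y := x - x0.
have Dc q : is_cdir x (basis p) (fun z => ((z - x0) 0 q)%:C%C) (q == p)%:R.
  have := cdir_coord x0 q x (basis p); rewrite [(basis p) 0 q]mxE eqxx /=.
  have -> : (q == p)%:R = ((q == p)%:R : R)%:C%C by rewrite rmorph_nat.
  by under [in X in _ -> X]eq_fun do rewrite !mxE.
have Dt r q := cdirM (cdirM (Dc r) (cdir_cst x (basis p) (A r q))) (Dc q).
have := cdir_sum (index_enum 'I_d) (fun r => cdir_sum (index_enum 'I_d) (Dt r)).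
rewrite (_ : \sum_r \sum_q _ = 2 * \sum_q A p q * (y 0 q)%:C%C)//.
under eq_bigr do rewrite big_split.
rewrite big_split /= mulrDl mul1r; congr (_ + _).
- rewrite (bigD1 p)//= [X in _ + X]big1 ?addr0 => [|r /negbTE rp].
    by apply: eq_bigr => q _; rewrite eqxx mul1r mulr0 addr0.
  by rewrite big1// => q _; rewrite rp mul0r mulr0 addr0 mul0r.
- rewrite exchange_big /= (bigD1 p)//= [X in _ + X]big1 ?addr0 => [|r /negbTE rp].
    apply: eq_bigr => q _; rewrite eqxx mulr1 mulrC.
    by rewrite -[in LHS]symA mxE.
  by rewrite big1// => q _; rewrite rp mulr0.
Qed.

Lemma cdir_weight A x0 x p : A^T = A ->
  is_cdir x (basis p) (weight A x0)
    (- (\sum_q A p q * ((x - x0) 0 q)%:C%C) * weight A x0 x).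
Proof.
move=> symA.
have := cdir_cexp (cdirZ (- 2^-1) (cdir_qform x0 x p symA)).
by rewrite mulrA mulNr mulVf ?mulN1r// pnatr_eq0.
Qed.

(** One term of the exponential series. Applied to |y|^2 it yields the factor k! of the moments of
    order 2 k. *)
Lemma expr_le_expR (n : nat) (a b : R) : 0 < a -> 0 <= b ->
  b ^+ n <= n`!%:R / a ^+ n * expR (a * b).
Proof.
move=> a0 b0; have fn : 0 < (n`!%:R : R) by rewrite ltr0n fact_gt0.
rewrite mulrAC ler_pdivlMr ?exprn_gt0// -exprMn (mulrC b).
rewrite -ler_pdivrMl// mulrC; case: n fn => [|n] fn.
  by rewrite expr0 fact0 invr1 mulr1 -{1}expR0 ler_expR mulr_ge0// ltW.
have h : 0 <= b * a by rewrite mulr_ge0// ltW.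
apply: (le_trans _ (expR_ge1Dxn n h)).
by rewrite [leLHS]mulrC lerDr.
Qed.

Lemma norm1_expr_le (n : nat) (a : R) : 0 < a ->
  exists2 K : R, 0 <= K & forall y : 'rV[R]_d, norm1 y ^+ n <= K * expR (a * sqnorm y).
Proof.
move=> a0; exists (1 + d%:R ^+ n * (n`!%:R / a ^+ n)).
  by rewrite addr_ge0// mulr_ge0 ?exprn_ge0// divr_ge0// exprn_ge0// ltW.
move=> y; have n0 := norm1_ge0 y; have s0 := sqnorm_ge0 y.
have e1 : 1 <= expR (a * sqnorm y) by rewrite -{1}expR0 ler_expR mulr_ge0// ltW.
rewrite mulrDl mul1r.
(* An odd power is not a power of the squared norm, so the even exponent 2 n is used when the norm
   exceeds 1, and the bound 1 otherwise. *)
apply: le_trans (_ : 1 + (norm1 y ^+ 2) ^+ n <= _).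
  have [n1|/ltW n1] := leP (norm1 y) 1.
    by rewrite (le_trans (exprn_ile1 _ n0 n1))// lerDl !exprn_ge0.
  rewrite (@le_trans _ _ ((norm1 y ^+ 2) ^+ n)) ?lerDr//.
  by rewrite -exprM ler_weXn2l// leq_pmull.
rewrite lerD// (@le_trans _ _ ((d%:R * sqnorm y) ^+ n))//.
  by rewrite lerXn2r ?nnegrE ?exprn_ge0 ?mulr_ge0// norm1_le_sqnorm.
by rewrite exprMn -mulrA ler_wpM2l ?exprn_ge0// expr_le_expR.
Qed.

Lemma dirD_growth n v x1 :
  exists M : R, forall y, normc (dirD n v y x1) <= norm1 y ^+ n * M.
Proof.
elim: n v => [|n ih] v; first by exists (normc (v x1)) => y; rewrite expr0 mul1r.
have /fin_all_exists[M HM] q := ih (pderiv q v).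
exists (\sum_q `|M q|) => y; rewrite mulr_sumr (le_trans (normc_sum _ _ _))//.
apply: ler_sum => q _; rewrite normcM normc_real exprS -mulrA.
apply: ler_pM => //; [exact: normc_ge0|exact: le_norm1|].
by rewrite (le_trans (HM q y))// ler_wpM2l ?exprn_ge0 ?norm1_ge0// ler_norm.
Qed.

Lemma gauss_dom_polyweight A lam n x0 (F : 'rV[R]_d -> R[i]) : 0 < lam -> coercive A lam ->
  ccontinuous F -> (exists M : R, forall x, normc (F x) <= norm1 (x - x0) ^+ n * M) ->
  gauss_dom x0 (fun x => F x * weight A x0 x).
Proof.
move=> l0 cA cF [M HM]; split.
  by apply: ccontinuous_measurable; apply: ccontinuousM => //; exact: ccontinuous_weight.
(* The weight decays at rate lam / 2: one half absorbs the polynomial growth, the other half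
   remains. *)
have l4 : 0 < lam / 4 by rewrite divr_gt0.
have [K K0 HK] := norm1_expr_le n l4.
exists (lam / 4), (`|M| * K); split=> // x; rewrite normcM.
set y := x - x0.
apply: le_trans (_ : (norm1 y ^+ n * `|M|) * expR (- (lam / 2) * sqnorm y) <= _).
  apply: ler_pM; try exact: normc_ge0; last exact: weight_le.
  by rewrite (le_trans (HM x))// ler_wpM2l ?exprn_ge0 ?norm1_ge0// ler_norm.
rewrite (mulrC _ `|M|) -!mulrA ler_wpM2l//.
apply: le_trans (ler_wpM2r (expR_ge0 _) (HK y)) _.
rewrite -mulrA ler_wpM2l// -expRD ler_expR.
by rewrite (_ : _ + _ = - (lam / 4) * sqnorm y)//; field.
Qed.

Lemma gauss_dom_dirDweight A lam n v x0 x1 : 0 < lam -> coercive A lam ->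
  gauss_dom x0 (fun x => dirD n v (x - x0) x1 * weight A x0 x).
Proof.
move=> l0 cA; apply: (gauss_dom_polyweight (n := n) l0 cA); first exact: ccontinuous_dirD.
by have [M HM] := dirD_growth n v x1; exists M.
Qed.

Lemma cint_partial_dom (p : 'I_d) (x0 : 'rV[R]_d) (F f : 'rV[R]_d -> R[i]) :
  ccontinuous f -> (forall x, is_cdir x (basis p) F (f x)) ->
  gauss_dom x0 F -> gauss_dom x0 f -> cint f = 0.
Proof.
move=> cf DF [_ [c [K [c0 FK]]]] [_ [c' [K' [c'0 fK]]]].
apply: (@cint_partial0 R d p x0 (Num.min c c') (Num.max K K') F) => //.
- by rewrite lt_min c0.
- by apply: gauss_le_weaken FK; rewrite ?ge_min ?le_max lexx.
- by apply: gauss_le_weaken fK; rewrite ?ge_min ?le_max lexx orbT.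
Qed.

Lemma cdir_shift (F : 'rV[R]_d -> R[i]) x x0 y c :
  is_cdir (x - x0) y F c -> is_cdir x y (fun z => F (z - x0)) c.
Proof.
move=> [/is_derive_epsP D1 /is_derive_epsP D2]; split; apply/is_derive_epsP => e e0.
- have [r r0 H] := D1 e e0; exists r => // h hr.
  by rewrite /= (_ : x + h *: y - x0 = x - x0 + h *: y); [exact: H|rewrite addrAC].
- have [r r0 H] := D2 e e0; exists r => // h hr.
  by rewrite /= (_ : x + h *: y - x0 = x - x0 + h *: y); [exact: H|rewrite addrAC].
Qed.

(* The value at [x1] of [(x - x0) . \partial]^n v, integrated against the
   Gaussian weight centred at [x0]. *)
Definition moment A x0 n v x1 := cint (fun x => dirD n v (x - x0) x1 * weight A x0 x).

Section Wick.
Variables (W : set 'rV[R]_d) (A : 'M[R[i]]_d) (lam : R) (x0 x1 : 'rV[R]_d).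
Hypotheses (oW : open W) (Wx1 : W x1) (symA : A^T = A) (unitA : A \in unitmx).
Hypotheses (lam0 : 0 < lam) (coA : coercive A lam).

Let coordmoment n v q :=
  cint (fun x => ((x - x0) 0 q)%:C%C * dirD n v (x - x0) x1 * weight A x0 x).

Let dom_coord n v q :
  gauss_dom x0 (fun x => ((x - x0) 0 q)%:C%C * dirD n v (x - x0) x1 * weight A x0 x).
Proof.
apply: (gauss_dom_polyweight (n := n.+1) lam0 coA).
  by apply: ccontinuousM; [exact: ccontinuous_coord|exact: ccontinuous_dirD].
have [M HM] := dirD_growth n v x1; exists M => x.
rewrite normcM normc_real exprS -mulrA ler_pM ?normc_ge0 ?le_norm1//.
Qed.

(** The integral of a p-th partial derivative vanishes. Differentiating the polynomial gives the
    left side, differentiating the weight the right side; [coordmomentE] then inverts A. *)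
Lemma moment_partial n v p : smooth_on W v ->
  n%:R * moment A x0 n.-1 (pderiv p v) x1 = \sum_q A p q * coordmoment n v q.
Proof.
move=> Sv.
pose F x := dirD n v (x - x0) x1 * weight A x0 x.
pose f x := n%:R * (dirD n.-1 (pderiv p v) (x - x0) x1 * weight A x0 x) +
  \sum_q (- A p q) * (((x - x0) 0 q)%:C%C * dirD n v (x - x0) x1 * weight A x0 x).
have d1 := gauss_domZ n%:R (gauss_dom_dirDweight n.-1 (pderiv p v) x0 x1 lam0 coA).
have d2 q := gauss_domZ (- A p q) (dom_coord n v q).
have d3 := gauss_dom_sum (index_enum 'I_d) d2.
have : cint f = 0.
  apply: (@cint_partial_dom p x0 F f).
  - apply: ccontinuousD.
      apply: ccontinuousM; first exact: ccontinuous_cst.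
      by apply: ccontinuousM; [exact: ccontinuous_dirD|exact: ccontinuous_weight].
    apply: ccontinuous_sum => q; apply: ccontinuousM; first exact: ccontinuous_cst.
    apply: ccontinuousM; last exact: ccontinuous_weight.
    by apply: ccontinuousM; [exact: ccontinuous_coord|exact: ccontinuous_dirD].
  - move=> x.
    have := cdirM (cdir_shift (cdir_dirD_arg oW n p (x - x0) Sv Wx1)) (cdir_weight x0 x p symA).
    rewrite (_ : _ + _ = f x)//; rewrite /f; congr (_ + _); first by rewrite mulrA.
    rewrite mulNr mulrN mulr_suml mulr_sumr -sumrN; apply: eq_bigr => q _.
    by rewrite !mulNr; congr (- _); ring.
  - exact: (gauss_dom_dirDweight n v x0 x1 lam0 coA).
  - exact: (gauss_domD d1 d3).
rewrite /f (cintD d1 d3) (cintZ _ (gauss_dom_dirDweight _ _ _ _ lam0 coA)).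
rewrite (cint_sum _ d2) => /eqP; rewrite addr_eq0 => /eqP ->.
rewrite -sumrN; apply: eq_bigr => q _.
by rewrite (cintZ _ (dom_coord n v q)) mulNr opprK.
Qed.

Lemma coordmomentE n v q : smooth_on W v ->
  coordmoment n v q = n%:R * \sum_p invmx A q p * moment A x0 n.-1 (pderiv p v) x1.
Proof.
move=> Sv; rewrite mulr_sumr.
under eq_bigr => p _ do rewrite mulrCA moment_partial// mulr_sumr.
rewrite exchange_big /=.
under eq_bigr => r _ do (under eq_bigr do rewrite mulrA; rewrite -mulr_suml).
have E r : \sum_p invmx A q p * A p r = (q == r)%:R.
  by have /matrixP/(_ q r) := mulVmx unitA; rewrite !mxE.
under eq_bigr => r _ do rewrite E.
rewrite (bigD1 q)//= eqxx mul1r big1 ?addr0// => r rq.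
by rewrite eq_sym (negbTE rq) mul0r.
Qed.

(* Wick's recursion: [(x - x0)_q w] is minus a combination of the partial
   derivatives of [w], with coefficients the entries of [A^-1]; integrate by
   parts. *)
Lemma momentS n v : smooth_on W v ->
  moment A x0 n.+1 v x1 = n%:R * moment A x0 n.-1 (quad_op (invmx A) v) x1.
Proof.
move=> Sv.
have -> : moment A x0 n.+1 v x1 = \sum_r coordmoment n (pderiv r v) r.
  rewrite /moment /coordmoment -(cint_sum _ (fun r => dom_coord n (pderiv r v) r)).
  by congr cint; apply/funext => x; rewrite /= mulr_suml.
under eq_bigr => r _ do rewrite (coordmomentE n r (smooth_pderiv r Sv)).
rewrite -mulr_sumr; congr (_ * _).
set m := n.-1.
have SW r p : smooth_on W (pderiv p (pderiv r v)) by do 2 apply: smooth_pderiv.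
have dW r p := gauss_domZ (invmx A r p) (gauss_dom_dirDweight m (pderiv p (pderiv r v)) x0 x1 lam0 coA).
have -> : moment A x0 m (quad_op (invmx A) v) x1 =
   cint (fun x => \sum_r \sum_p invmx A r p * (dirD m (pderiv p (pderiv r v)) (x - x0) x1 * weight A x0 x)).
  congr cint; apply/funext => x; under eq_bigr do under eq_bigr do rewrite mulrA.
  under eq_bigr do rewrite -mulr_suml.
  rewrite -mulr_suml; congr (_ * _).
  have symQ p q : invmx A q p = invmx A p q by rewrite -[in LHS]symA -trmx_inv mxE.
  have E (I : Type) (s : seq I) (G : I -> 'rV[R]_d -> R[i]) : (forall i, smooth_on W (G i)) ->
      dirD m (fun z => \sum_(i <- s) G i z) (x - x0) x1 = \sum_(i <- s) dirD m (G i) (x - x0) x1.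
    move=> SG; elim: s => [|i s ih].
      rewrite big_nil; under eq_fun do rewrite big_nil.
      have := dirDZ oW m 0 (x - x0) (smooth_cst oW 0) Wx1.
      by rewrite !mul0r.
    rewrite big_cons -ih -(dirDD oW m (x - x0) (SG i) (smooth_sum oW s SG) Wx1).
    by congr dirD; apply/funext => z; rewrite big_cons.
  have SZ p q : smooth_on W (fun z => invmx A p q * pderiv p (pderiv q v) z).
    exact: (smoothM oW (smooth_cst oW _) (SW q p)).
  rewrite /quad_op E => [|p]; last by apply: smooth_sum.
  rewrite exchange_big /=; apply: eq_bigr => p _.
  rewrite E//; apply: eq_bigr => q _.
  by rewrite (dirDZ oW m _ (x - x0) (SW q p) Wx1) symQ.
rewrite (cint_sum _ (fun r => gauss_dom_sum (index_enum 'I_d) (dW r))).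
apply: eq_bigr => r _; rewrite (cint_sum _ (dW r)); apply: eq_bigr => p _.
by rewrite (cintZ _ (gauss_dom_dirDweight _ _ _ _ lam0 coA)).
Qed.

Lemma smooth_quad_op Q v : smooth_on W v -> smooth_on W (quad_op Q v).
Proof.
move=> Sv; apply: (smooth_sum oW) => p; apply: (smooth_sum oW) => q.
by apply: (smoothM oW); [exact: smooth_cst|do 2 apply: smooth_pderiv].
Qed.

Lemma moment0 v : moment A x0 0 v x1 = v x1 * cint (weight A x0).
Proof.
have D : gauss_dom x0 (weight A x0).
  rewrite (_ : weight A x0 = fun x => dirD 0 (fun=> 1) (x - x0) x1 * weight A x0 x).
    exact: gauss_dom_dirDweight lam0 coA.
  by apply/funext => x; rewrite /= mul1r.
by rewrite /moment /= (cintZ _ D).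
Qed.

Lemma moment_odd n v : smooth_on W v -> moment A x0 n.*2.+1 v x1 = 0.
Proof.
elim: n v => [|n ih] v Sv; first by rewrite momentS// mul0r.
by rewrite doubleS momentS//= ih ?mulr0//; exact: smooth_quad_op.
Qed.

(** Iterating Wick's recursion multiplies the odd numbers up to 2 n - 1, whose product is (2 n)! /
    (2^n n!); hence the denominators 2^nu nu! in [Lop]. *)
Lemma moment_even n v : smooth_on W v ->
  moment A x0 n.*2 v x1 / (n.*2)`!%:R =
  iter n (quad_op (invmx A)) v x1 / (2 ^+ n * n`!%:R) * cint (weight A x0).
Proof.
elim: n v => [|n ih] v Sv.
  by rewrite moment0 double0 fact0 expr0 mul1r !divr1.
rewrite doubleS momentS// [n.*2.+1.-1]/= iterSr.
have nz m : (m.+1%:R : R[i]) != 0 by rewrite pnatr_eq0.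
have fz m : (m`!%:R : R[i]) != 0 by rewrite pnatr_eq0 -lt0n fact_gt0.
transitivity (moment A x0 n.*2 (quad_op (invmx A) v) x1 / (n.*2)`!%:R / (2 * n.+1%:R)).
  have e : (n.*2.+2%:R : R[i]) = 2 * n.+1%:R by rewrite -natrM mul2n doubleS.
  rewrite !factS !natrM e; move: (nz n) (nz n.*2) (fz n.*2).
  move: (n.+1%:R : R[i]) (n.*2.+1%:R : R[i]) ((n.*2)`!%:R : R[i]) => a b c a0 b0 c0.
  by field; rewrite a0 b0 c0.
rewrite (ih _ (smooth_quad_op _ Sv)) factS natrM exprS.
have p2 : (2 ^+ n : R[i]) != 0 by rewrite expf_neq0// pnatr_eq0.
move: (nz n) (fz n) p2; move: (n.+1%:R : R[i]) (n`!%:R : R[i]) (2 ^+ n : R[i]) => a b c a0 b0 c0.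
by field; rewrite a0 b0 c0.
Qed.

End Wick.

End GaussianWeight.

Section QuadraticFunctions.
Variables (R : realType) (d : nat).
Implicit Types (A E : 'M[R[i]]_d) (x y : 'rV[R]_d).
Local Notation basis i := (delta_mx 0 i : 'rV[R]_d).

Lemma smooth_qform E x0 : smooth_on setT (fun z : 'rV[R]_d => qform E (z - x0)).
Proof.
apply: (smooth_sum openT) => p; apply: (smooth_sum openT) => q.
have Sc j : smooth_on setT (fun z : 'rV[R]_d => ((z - x0) 0 j)%:C%C).
  apply: (smooth_ext openT _ (smooth_coord openT x0 j)) => z _.
  by rewrite !mxE.
exact: (smoothM openT (smoothM openT (Sc p) (smooth_cst openT _)) (Sc q)).
Qed.

Lemma pderiv_half_qform E x0 p x : E^T = E ->
  pderiv p (fun z => 2^-1 * qform E (z - x0)) x = \sum_q E p q * ((x - x0) 0 q)%:C%C.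
Proof.
move=> symE; apply: cdir_val; have := cdirZ 2^-1 (cdir_qform x0 x p symE).
by rewrite mulrA mulVf ?mul1r// pnatr_eq0.
Qed.

Lemma pderiv2_half_qform E x0 p q x : E^T = E ->
  pderiv q (pderiv p (fun z => 2^-1 * qform E (z - x0))) x = E p q.
Proof.
move=> symE.
have -> : pderiv p (fun z => 2^-1 * qform E (z - x0)) =
    (fun z => \sum_r E p r * (z 0 r - x0 0 r)%:C%C).
  by apply/funext => z; rewrite pderiv_half_qform//; apply: eq_bigr => r _; rewrite !mxE.
have Sc r := smooth_coord openT x0 r.
rewrite (pderiv_sum openT q _ (fun r => smoothM openT (smooth_cst openT (E p r)) (Sc r)) I).
under eq_bigr => r _ do rewrite (pderivZ q _ (Sc r) I) pderiv_coord.
rewrite (bigD1 q)//= eqxx mulr1 big1 ?addr0// => r /negbTE ->.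
by rewrite mulr0.
Qed.

Lemma dirD_cst0 n y x : dirD n (fun _ : 'rV[R]_d => 0) y x = 0.
Proof.
elim: n => [//|n ih] /=; apply: big1 => q _.
have -> : pderiv q (fun _ : 'rV[R]_d => 0) = (fun=> 0).
  by apply/funext => z; exact: pderiv_cst.
by rewrite ih mulr0.
Qed.

Lemma dirD_half_qform E x0 n y : E^T = E ->
  dirD n (fun z => 2^-1 * qform E (z - x0)) y x0 = if n == 2%N then qform E y else 0.
Proof.
move=> symE.
have z0 q : (x0 - x0) 0 q = 0 :> R by rewrite mxE mxE subrr.
case: n => [|[|[|n]]].
- rewrite /= /qform big1 ?mulr0// => p _; rewrite big1// => q _.
  by rewrite z0 mul0r mul0r.
- rewrite /=; apply: big1 => q _; rewrite pderiv_half_qform// big1 ?mulr0// => r _.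
  by rewrite z0 mulr0.
- rewrite /= /qform; apply: eq_bigr => p _; rewrite mulr_sumr; apply: eq_bigr => q _.
  by rewrite pderiv2_half_qform// mulrA mulrAC.
- rewrite -[LHS]/(\sum_p (y 0 p)%:C%C * \sum_q (y 0 q)%:C%C *
     \sum_r (y 0 r)%:C%C * dirD n (pderiv r (pderiv q (pderiv p _))) y x0).
  apply: big1 => p _; rewrite big1 ?mulr0// => q _; rewrite big1 ?mulr0// => r _.
  have -> : pderiv r (pderiv q (pderiv p (fun z => 2^-1 * qform E (z - x0)))) = (fun=> 0).
    apply/funext => z; rewrite -[RHS](pderiv_cst r (E p q) z); congr (pderiv r _ z).
    by apply/funext => z'; exact: pderiv2_half_qform.
  by rewrite dirD_cst0 mulr0.
Qed.

Lemma normc_qform E (e : R) y : (forall p q, normc (E p q) <= e) ->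
  normc (qform E y) <= e * norm1 y ^+ 2.
Proof.
move=> Ee; rewrite /qform (le_trans (normc_sum _ _ _))//.
rewrite expr2 {1}/norm1 mulr_suml mulr_sumr; apply: ler_sum => p _.
rewrite (le_trans (normc_sum _ _ _))// !mulr_sumr; apply: ler_sum => q _.
rewrite !normcM !normc_real mulrAC [leLHS]mulrC.
by rewrite ler_wpM2r// mulr_ge0.
Qed.

Lemma qformD A E y : qform (A + E) y = qform A y + qform E y.
Proof.
rewrite /qform -big_split; apply: eq_bigr => p _; rewrite -big_split.
by apply: eq_bigr => q _; rewrite mxE mulrDr mulrDl.
Qed.

Lemma qformZ k E y : qform (k *: E) y = k * qform E y.
Proof.
rewrite /qform mulr_sumr; apply: eq_bigr => p _; rewrite mulr_sumr.
by apply: eq_bigr => q _; rewrite mxE; ring.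
Qed.

Lemma weightD A E x0 x : weight (A + E) x0 x = weight A x0 x * cexp (- 2^-1 * qform E (x - x0)).
Proof. by rewrite /weight -cexpD qformD mulrDr. Qed.

End QuadraticFunctions.

(** * Dependence of the Gaussian integral on its matrix *)

Section Perturbation.
Variables (R : realType) (d : nat).
Implicit Types (A E : 'M[R[i]]_d) (x y : 'rV[R]_d).

Lemma gauss_dom_weight A lam x0 : 0 < lam -> coercive A lam -> gauss_dom x0 (weight A x0).
Proof.
move=> l0 cA; rewrite (_ : weight A x0 = fun x => dirD 0 (fun=> 1) (x - x0) x0 * weight A x0 x).
  exact: gauss_dom_dirDweight l0 cA.
by apply/funext => x; rewrite /= mul1r.
Qed.

Lemma coerciveD A E lam (e : R) : coercive A lam -> (forall p q, normc (E p q) <= e) ->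
  0 <= e -> e * d%:R <= lam / 2 -> coercive (A + E) (lam / 2).
Proof.
move=> cA Ee e0 ed y; rewrite qformD ReD.
have h1 := cA y.
have h2 : `|re (qform E y)| <= lam / 2 * sqnorm y.
  rewrite (le_trans (normr_Re _))// (le_trans (normc_qform y Ee))//.
  rewrite (le_trans (ler_wpM2l e0 (norm1_le_sqnorm y)))// mulrA ler_wpM2r//.
  exact: sqnorm_ge0.
have h3 : - (lam / 2 * sqnorm y) <= re (qform E y) by move: h2; rewrite ler_norml => /andP[].
by rewrite (_ : _ * _ = lam * sqnorm y - lam / 2 * sqnorm y) ?lerD//; field.
Qed.

Lemma weight_perturb A E lam (e : R) x0 x n : coercive A lam ->
  (forall p q, normc (E p q) <= e) -> 0 < lam -> 0 <= e -> e * d%:R <= lam / 4 ->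
  normc (weight (A + E) x0 x -
     (\sum_(j < n) (- 2^-1 * qform E (x - x0)) ^+ j / j`!%:R) * weight A x0 x)
  <= 2 * (e * d%:R / (lam / 8)) ^+ n * expR (- (lam / 8) * sqnorm (x - x0)).
Proof.
move=> cA Ee l0 e0 ed; rewrite weightD mulrC -mulrBl normcM.
set z := - 2^-1 * _; set S := sqnorm _.
have S0 : 0 <= S by exact: sqnorm_ge0.
have zle : normc z <= e * d%:R * S.
  rewrite /z normcM normcN.
  rewrite normcVnat.
  have h := normc_qform (x - x0) Ee.
  have h' := ler_wpM2l e0 (norm1_le_sqnorm (x - x0)).
  have h'' : 0 <= e * d%:R * S by rewrite !mulr_ge0.
  rewrite (le_trans (ler_wpM2l _ h)) ?invr_ge0// (le_trans (ler_wpM2l _ h')) ?invr_ge0//.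
  by rewrite -/S (mulrA e) ler_piMl// invf_le1// ler1n.
have h1 := cexp_taylor z n.
have h2 : normc (weight A x0 x) <= expR (- (lam / 2) * S) by exact: weight_le.
have fn : 0 < (n`!%:R : R) by rewrite ltr0n fact_gt0.
apply: le_trans (ler_pM (normc_ge0 _) (normc_ge0 _) h1 h2) _.
have h3 : normc z ^+ n <= (e * d%:R) ^+ n * (n`!%:R / (lam / 8) ^+ n * expR (lam / 8 * S)).
  apply: le_trans (_ : (e * d%:R * S) ^+ n <= _).
    by rewrite lerXn2r ?nnegrE ?normc_ge0// !mulr_ge0.
  rewrite exprMn ler_wpM2l ?exprn_ge0 ?mulr_ge0// expr_le_expR// divr_gt0//.
have h4 : expR (normc z) <= expR (lam / 4 * S).
  by rewrite ler_expR (le_trans zle)// ler_wpM2r.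
have h5 : normc z ^+ n * expR (normc z) / n`!%:R <=
    (e * d%:R / (lam / 8)) ^+ n * (expR (lam / 8 * S) * expR (lam / 4 * S)).
  rewrite ler_pdivrMr//.
  apply: le_trans (ler_pM _ (expR_ge0 _) h3 h4) _; first by rewrite exprn_ge0// normc_ge0.
  rewrite [X in _ <= X * _ * _]exprMn exprVn; apply: le_of_eq; ring.
apply: le_trans (ler_wpM2r (expR_ge0 _) (ler_wpM2l _ h5)) _ => //.
have h6 : expR (lam / 8 * S) * expR (lam / 4 * S) * expR (- (lam / 2) * S) =
    expR (- (lam / 8) * S).
  by rewrite -!expRD; congr expR; field.
by rewrite -h6; apply: le_of_eq; ring.
Qed.

Definition gaussJ A x0 : R[i] := cint (weight A x0).

(** Differentiability with quadratic remainder, for the derivative along a segment, and a Lipschitz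
    bound, for the continuity of the branch: orders 2 and 1 of the same expansion. *)
Lemma gaussJ_perturb A lam x0 : 0 < lam -> coercive A lam ->
  exists2 K : R, 0 <= K & forall E (e : R), (forall p q, normc (E p q) <= e) -> 0 <= e ->
    e * d%:R <= lam / 4 ->
    normc (gaussJ (A + E) x0 - gaussJ A x0 - cint (fun x => - 2^-1 * qform E (x - x0) * weight A x0 x))
      <= K * e ^+ 2 /\
    normc (gaussJ (A + E) x0 - gaussJ A x0) <= K * e.
Proof.
move=> l0 cA.
have l8 : 0 < lam / 8 by rewrite divr_gt0.
pose k := d%:R / (lam / 8); pose G := Num.sqrt (pi / (lam / 8)) ^+ d.
have k0 : 0 <= k by rewrite divr_ge0// ltW.
have G0 : 0 <= G by rewrite exprn_ge0// sqrtr_ge0.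
(* (1 + k)^2 dominates both k and k^2, so one constant serves both estimates. *)
exists (2 * (2 * (1 + k) ^+ 2 * G)).
  by rewrite !mulr_ge0// ?exprn_ge0 ?addr_ge0.
move=> E e Ee e0 ed.
have cAE : coercive (A + E) (lam / 2).
  apply: (coerciveD cA Ee) => //; rewrite (le_trans ed)// ler_pM2l// lef_pV2 ?posrE// ler_nat//.
have l2 : 0 < lam / 2 by rewrite divr_gt0.
have dA := gauss_dom_weight x0 l0 cA.
have dAE := gauss_dom_weight x0 l2 cAE.
have dq : gauss_dom x0 (fun x => - 2^-1 * qform E (x - x0) * weight A x0 x).
  apply: (gauss_dom_polyweight (n := 2) l0 cA).
    by apply: ccontinuousM; [exact: ccontinuous_cst|exact: ccontinuous_qform].
  exists (normc (- 2^-1 : R[i]) * e) => x; rewrite normcM mulrCA ler_wpM2l ?normc_ge0//.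
  by rewrite mulrC normc_qform.
have k1 : k <= (1 + k) ^+ 2.
  by rewrite (@le_trans _ _ (1 + k)) ?lerDr// expr2 ler_peMr ?addr_ge0// lerDl.
have k2 : k ^+ 2 <= (1 + k) ^+ 2 by rewrite lerXn2r ?nnegrE ?addr_ge0// lerDr.
have ek : e * k = e * d%:R / (lam / 8) by rewrite /k mulrA.
have dN F : gauss_dom x0 F -> cint (fun x => -1 * F x) = - cint F.
  by move=> dF; rewrite (cintZ _ dF) mulN1r.
split.
- rewrite (_ : _ - _ = cint (fun x => weight (A + E) x0 x + (-1 * weight A x0 x +
     -1 * (- 2^-1 * qform E (x - x0) * weight A x0 x)))); last first.
    rewrite (cintD dAE (gauss_domD (gauss_domZ _ dA) (gauss_domZ _ dq))).
    by rewrite (cintD (gauss_domZ _ dA) (gauss_domZ _ dq)) !dN// addrA.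
  apply: le_trans (@cint_le R d x0 (lam / 8) (2 * (e * k) ^+ 2) _ l8 _ _) _.
  + by apply: (gauss_domD dAE (gauss_domD (gauss_domZ _ dA) (gauss_domZ _ dq))).1.
  + move=> x; have := weight_perturb x0 x 2 cA Ee l0 e0 ed.
    rewrite !big_ord_recl big_ord0 addr0 expr0 divr1 expr1 divr1 mulrDl mul1r opprD.
    by rewrite !mulN1r ek.
  + rewrite -/G [leLHS](_ : _ = (2 * 2 * G * e ^+ 2) * k ^+ 2); last by ring.
    rewrite [leRHS](_ : _ = (2 * 2 * G * e ^+ 2) * (1 + k) ^+ 2); last by ring.
    by rewrite ler_wpM2l// !mulr_ge0 ?exprn_ge0.
- rewrite (_ : _ - _ = cint (fun x => weight (A + E) x0 x + -1 * weight A x0 x)); last first.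
    by rewrite (cintD dAE (gauss_domZ _ dA)) dN.
  apply: le_trans (@cint_le R d x0 (lam / 8) (2 * (e * k)) _ l8 _ _) _.
  + by apply: (gauss_domD dAE (gauss_domZ _ dA)).1.
  + move=> x; have := weight_perturb x0 x 1 cA Ee l0 e0 ed.
    by rewrite big_ord1 expr0 divr1 mul1r expr1 mulN1r ek.
  + rewrite -/G [leLHS](_ : _ = (2 * 2 * G * e) * k); last by ring.
    rewrite [leRHS](_ : _ = (2 * 2 * G * e) * (1 + k) ^+ 2); last by ring.
    by rewrite ler_wpM2l// !mulr_ge0.
Qed.

(** A quadratic form is the second directional derivative of half of itself, so one Wick step
    evaluates its integral, and contracting its Hessian E with A^-1 gives the trace. *)
Lemma cint_qform_weight A E lam x0 : A^T = A -> E^T = E -> A \in unitmx -> 0 < lam ->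
  coercive A lam ->
  cint (fun x => - 2^-1 * qform E (x - x0) * weight A x0 x) =
  - 2^-1 * \tr (invmx A *m E) * gaussJ A x0.
Proof.
move=> symA symE uA l0 cA; pose v (z : 'rV[R]_d) := 2^-1 * qform E (z - x0).
have Sv : smooth_on setT v.
  exact: (smoothM openT (smooth_cst openT _) (smooth_qform E x0)).
have := momentS x0 (x1 := x0) openT I symA uA l0 cA 1 Sv.
rewrite mul1r /= (moment0 _ _ l0 cA) /moment.
have E2 x : dirD 2 v (x - x0) x0 = qform E (x - x0) by rewrite /v dirD_half_qform.
move=> H.
have -> : (fun x => - 2^-1 * qform E (x - x0) * weight A x0 x) =
   (fun x => - 2^-1 * (dirD 2 v (x - x0) x0 * weight A x0 x)).
  by apply/funext => x; rewrite E2 mulrA.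
rewrite (cintZ _ (gauss_dom_dirDweight 2 v x0 x0 l0 cA)) H -mulrA; congr (_ * (_ * _)).
rewrite /quad_op /mxtrace; apply: eq_bigr => p _; rewrite mxE; apply: eq_bigr => q _.
by rewrite pderiv2_half_qform// -[in RHS]symE mxE.
Qed.

End Perturbation.

Section ComplexValuedDerivatives.
Variable R : realType.
Implicit Types (F : R -> R[i]) (t : R).

Lemma is_cderive_quad F t c (K r : R) : 0 < r -> 0 <= K ->
  (forall h, `|h| < r -> normc (F (t + h) - F t - h%:C%C * c) <= K * h ^+ 2) ->
  is_cderive t F c.
Proof.
move=> r0 K0 H.
have key (p : R[i] -> R) : (forall z, `|p z| <= normc z) -> (forall z w, p (z - w) = p z - p w) ->
    (forall (a : R) z, p (a%:C%C * z) = a * p z) -> is_derive t 1 (fun s => p (F s)) (p c).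
  move=> pn pB pZ; apply/is_derive_epsP => e e0.
  have K1 : 0 < K + 1 by rewrite ltr_wpDl.
  exists (Num.min r (e / (K + 1))); first by rewrite lt_min r0 divr_gt0.
  move=> h; rewrite lt_min => /andP[hr he].
  rewrite -[h *: 1]/(h * 1) mulr1 -pZ -!pB (le_trans (pn _))// (le_trans (H _ hr))//.
  rewrite -real_normK ?num_real// expr2 mulrA ler_wpM2r//.
  have : `|h| * (K + 1) < e by rewrite -ltr_pdivlMr.
  move/ltW; apply: le_trans; rewrite mulrC ler_wpM2l// lerDl//.
split.
- by apply: (key re) => *; [exact: normr_Re|exact: ReB|exact: ReZ].
- by apply: (key im) => *; [exact: normr_Im|exact: ImB|exact: ImZ].
Qed.

Lemma is_cderive0_cst F : (forall t, 0 <= t <= 1 -> is_cderive t F 0) -> F 0 = F 1.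
Proof.
move=> DF.
have h (f : R -> R) : (forall t, 0 <= t <= 1 -> is_derive t 1 f 0) -> f 0 = f 1.
  move=> Df; apply/eqP; rewrite eq_sym -subr_eq0; apply/eqP.
  have Doo (s : R) : s \in `]0, 1[ -> is_derive s 1 f ((fun=> 0) s).
    by rewrite in_itv/= => /andP[/ltW s0 /ltW s1]; apply: Df; rewrite s0.
  have cf : {within `[0, 1], continuous f}.
    apply: derivable_within_continuous => x; rewrite in_itv/= => xab.
    exact: (@ex_derive _ _ _ _ _ _ _ (Df x xab)).
  by have [c _ ->] := MVT_segment ler01 Doo cf; rewrite mul0r.
apply: complex_eqP.
- by apply: (h (fun s => re (F s))) => t t1; exact: (DF t t1).1.
- by apply: (h (fun s => im (F s))) => t t1; exact: (DF t t1).2.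
Qed.

End ComplexValuedDerivatives.

(** * The square root of the determinant *)

Section DeterminantExpansion.
Variables (R : realType).

(** det (1 + t M) is t^d times the characteristic polynomial of - M at 1/t, so its leading
    coefficients 1 and tr M become those of low order in t. *)
Lemma det_scalar_add (K : fieldType) (d : nat) (M : 'M[K]_d) (t : K) : t != 0 ->
  \det (1%:M + t *: M) = \sum_(i < d.+1) (char_poly (- M))`_i * t ^+ (d - i).
Proof.
move=> t0.
have E : \det (t^-1%:M + M) = (char_poly (- M)).[t^-1].
  rewrite /char_poly -[RHS]/(horner_eval t^-1 _) -det_map_mx; congr (\det _).
  apply/matrixP => i j; rewrite [RHS]mxE -[RHS]/((char_poly_mx (- M) i j).[t^-1]) !mxE.
  by rewrite hornerD hornerMn hornerX hornerN hornerC opprK.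
have -> : 1%:M + t *: M = t *: (t^-1%:M + M).
  by rewrite scalerDr scale_scalar_mx mulfV.
rewrite detZ E horner_coef size_char_poly mulr_sumr; apply: eq_bigr => i _.
have id : (i <= d)%N by rewrite -ltnS.
rewrite mulrCA; congr (_ * _); rewrite -{1}(subnK id) exprD -mulrA -exprMn mulfV//.
by rewrite expr1n mulr1.
Qed.

Lemma det_perturb (d : nat) (M : 'M[R[i]]_d) :
  exists2 K : R, 0 <= K & forall t : R, `|t| <= 1 ->
    normc (\det (1%:M + t%:C%C *: M) - 1 - t%:C%C * \tr M) <= K * t ^+ 2.
Proof.
exists (\sum_(i < d.+1) normc (char_poly (- M))`_i).
  by apply: sumr_ge0 => i _; exact: normc_ge0.
move=> t t1.
have [->|t0] := eqVneq t 0.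
  rewrite scale0r addr0 det1 subrr mul0r subr0 expr0n mulr0.
  by rewrite -[X in X <= _]/(normc 0%C) normc0.
have tC0 := realC_neq0 t0.
rewrite det_scalar_add//; set p := char_poly _.
have pd : p`_d = 1.
  by have /monicP := char_poly_monic (- M); rewrite lead_coefE size_char_poly.
have step (i : nat) (c : R[i]) : (2 <= i)%N -> normc (c * t%:C%C ^+ i) <= normc c * t ^+ 2.
  move=> i2; rewrite normcM ler_wpM2l ?normc_ge0// normcX normc_real -[t ^+ 2]real_normK ?num_real//.
  by rewrite ler_wiXn2l.
(* In dimension 0 there is no trace coefficient to read off. *)
case: d M @p pd => [|d] M p pd.
  rewrite big_ord1 subn0 expr0 mulr1 pd /mxtrace big_ord0 mulr0 subr0 subrr.
  rewrite -[X in X <= _]/(normc 0%C) normc0 mulr_ge0 ?sqr_ge0//.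
  by apply: sumr_ge0 => i _; exact: normc_ge0.
have tr : p`_d = \tr M by rewrite (@char_poly_trace _ d.+1)// raddfN opprK.
rewrite !big_ord_recr /= subnn expr0 mulr1 pd subSnn expr1 tr.
rewrite (_ : _ - _ - _ = \sum_(i < d) p`_i * t%:C%C ^+ (d.+1 - i)); last by ring.
rewrite (le_trans (normc_sum _ _ _))//.
apply: le_trans (_ : (\sum_(i < d) normc p`_i) * t ^+ 2 <= _).
  rewrite mulr_suml; apply: ler_sum => i _; apply: step.
  by have := ltn_ord i; lia.
rewrite ler_wpM2r ?sqr_ge0// -addrA lerDl addr_ge0// normc_ge0//.
Qed.

End DeterminantExpansion.

Section GaussianNormalisation.
Variables (R : realType) (d : nat).
Implicit Types (A E : 'M[R[i]]_d) (x y : 'rV[R]_d).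

(** If v = a + i b is in the kernel, pairing v A with the conjugate of v gives 0. By symmetry the
    cross terms cancel, leaving the quadratic form at a plus that at b, which coercivity forces to
    vanish only for a = b = 0. *)
Lemma coercive_unit A lam : A^T = A -> 0 < lam -> coercive A lam -> A \in unitmx.
Proof.
move=> symA l0 cA; rewrite unitmxE unitfE; apply/negP => /det0P[v v0 vA].
pose a : 'rV[R]_d := map_mx (@complex.Re R) v; pose b : 'rV[R]_d := map_mx (@complex.Im R) v.
have vE p : v 0 p = (a 0 p)%:C%C + 'i%C * (b 0 p)%:C%C by rewrite !mxE -complexE.
have S : \sum_p \sum_q v 0 p * A p q * ((a 0 q)%:C%C - 'i%C * (b 0 q)%:C%C) = 0.
  rewrite exchange_big /= big1// => q _; rewrite -mulr_suml.
  by have /rowP/(_ q) := vA; rewrite !mxE => ->; rewrite mul0r.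
have E : qform A a + qform A b = 0.
  rewrite -{}[RHS]S /qform -big_split /=.
  pose X p q := (a 0 p)%:C%C * A p q * (b 0 q)%:C%C.
  pose Y p q := (b 0 p)%:C%C * A p q * (a 0 q)%:C%C.
  have XY : \sum_p \sum_q X p q = \sum_p \sum_q Y p q.
    rewrite exchange_big /=; apply: eq_bigr => p _; apply: eq_bigr => q _.
    have sA : A q p = A p q by rewrite -{1}symA mxE.
    by rewrite /X /Y sA; ring.
  transitivity (\sum_p (\sum_q (a 0 p)%:C%C * A p q * (a 0 q)%:C%C +
      \sum_q (b 0 p)%:C%C * A p q * (b 0 q)%:C%C) +
     'i%C * (\sum_p \sum_q Y p q - \sum_p \sum_q X p q)).
    by rewrite XY subrr mulr0 addr0.
  rewrite -sumrB mulr_sumr -big_split /=; apply: eq_bigr => p _.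
  rewrite -sumrB mulr_sumr -!big_split /=; apply: eq_bigr => q _.
  rewrite vE /X /Y.
  set aa := (a 0 p)%:C%C; set bb := (b 0 p)%:C%C; set a' := (a 0 q)%:C%C; set b' := (b 0 q)%:C%C.
  rewrite (_ : (aa + 'i%C * bb) * A p q * (a' - 'i%C * b') =
    aa * A p q * a' - 'i%C * 'i%C * (bb * A p q * b') + 'i%C * (bb * A p q * a' - aa * A p q * b')); last by ring.
  by rewrite mulCii mulN1r opprK.
have h : lam * (sqnorm a + sqnorm b) <= 0.
  rewrite mulrDr; apply: le_trans (lerD (cA a) (cA b)) _.
  by rewrite -ReD E.
have s0 : sqnorm a + sqnorm b <= 0 by rewrite -(pmulr_rle0 _ l0).
have sa := sqnorm_ge0 a; have sb := sqnorm_ge0 b.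
have ab p : a 0 p = 0 /\ b 0 p = 0.
  have h1 : a 0 p ^+ 2 <= 0.
    by rewrite (le_trans (coord_le_sqnorm a p))// (le_trans _ s0)// lerDl.
  have h2 : b 0 p ^+ 2 <= 0.
    by rewrite (le_trans (coord_le_sqnorm b p))// (le_trans _ s0)// lerDr.
  by split; apply/eqP; rewrite -sqrf_eq0 eq_le sqr_ge0 andbT.
move/negP: v0; apply; apply/eqP/rowP => p; rewrite vE [RHS]mxE.
by have [-> ->] := ab p; rewrite [(0%:C)%C]rmorph0 mulr0 addr0.
Qed.

Lemma qform1 y : qform 1%:M y = (sqnorm y)%:C%C.
Proof.
rewrite /qform /sqnorm rmorph_sum; apply: eq_bigr => p _.
rewrite (bigD1 p)//= big1 ?addr0 => [|q /negbTE qp].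
  by rewrite mxE eqxx mulr1 -rmorphM.
by rewrite mxE eq_sym qp mulr0 mul0r.
Qed.

Lemma gaussJ_real A x0 : (forall y, im (qform A y) = 0) ->
  gaussJ A x0 = (\int[lebesgue_tuple R d]_t expR (- 2^-1 * re (qform A (row_of_tuple t - x0))))%:C%C.
Proof.
move=> iA.
have E x : weight A x0 x = (expR (- 2^-1 * re (qform A (x - x0))))%:C%C.
  rewrite /weight [qform A _]complexE iA [(0%:C)%C]rmorph0 mulr0 addr0.
  by rewrite -cexp_real rmorphM rmorphN fmorphV rmorph_nat.
apply: complex_eqP; rewrite ?Re_cint ?Im_cint.
- by apply: eq_Rintegral => t _; rewrite E.
- under eq_Rintegral do rewrite E.
  by rewrite /Rintegral integral0_eq.
Qed.

Lemma gaussJ1 x0 : gaussJ 1%:M x0 ^+ 2 = ((2 * pi) ^+ d)%:C%C.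
Proof.
rewrite gaussJ_real => [|y]; last by rewrite qform1.
rewrite -rmorphXn; congr (_%:C%C).
under eq_Rintegral do rewrite qform1 /= -sqdist_row.
have h : 0 < (2^-1 : R) by rewrite invr_gt0.
rewrite /Rintegral (gauss_tuple _ h) /= exprAC sqr_sqrtr; first by rewrite invrK mulrC.
by rewrite divr_ge0 ?pi_ge0.
Qed.

Lemma gaussJ_det A lam x0 : A^T = A -> 0 < lam -> coercive A lam ->
  gaussJ A x0 ^+ 2 * \det A = ((2 * pi) ^+ d)%:C%C.
Proof.
move=> symA l0 cA; pose E := A - 1%:M; pose At (t : R) := 1%:M + t%:C%C *: E.
have symE : E^T = E by rewrite /E linearB /= symA trmx1.
have symAt t : (At t)^T = At t by rewrite /At linearD /= linearZ /= symE trmx1.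
(* A coercivity constant valid on the whole segment from the identity to A. *)
pose l := Num.min 1 lam.
have lpos : 0 < l by rewrite lt_min ltr01.
have cAt t : 0 <= t <= 1 -> coercive (At t) l.
  move=> /andP[t0 t1] y; rewrite /At qformD qformZ qform1 ReD ReZ /= /E.
  have -> : qform (A - 1%:M) y = qform A y - (sqnorm y)%:C%C.
    by rewrite -scaleN1r qformD qformZ qform1 mulN1r.
  rewrite ReB /=; have h := cA y; have s0 := sqnorm_ge0 y.
  have h1 : l * sqnorm y <= sqnorm y by rewrite ler_piMl// ge_min lexx.
  have h2 : l * sqnorm y <= re (qform A y).
    by rewrite (le_trans _ h)// ler_wpM2r// ge_min lexx orbT.
  rewrite (_ : _ + _ = (1 - t) * sqnorm y + t * re (qform A y)); last by ring.
  rewrite (_ : l * _ = (1 - t) * (l * sqnorm y) + t * (l * sqnorm y)); last by ring.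
  by rewrite lerD// ler_wpM2l// subr_ge0.
have uAt t : 0 <= t <= 1 -> At t \in unitmx.
  by move=> t01; exact: (coercive_unit (symAt t) lpos (cAt t t01)).
pose P t := gaussJ (At t) x0 * gaussJ (At t) x0 * \det (At t).
have Atadd t h : At (t + h) = At t + h%:C%C *: E by rewrite /At rmorphD scalerDl addrA.
(* [J'/J = - tr (A^-1 E) / 2] by the second moments, while
   [det'/det = tr (A^-1 E)]. *)
have DP (t : R) : 0 <= t <= 1 -> is_cderive t P 0.
  move=> t01; pose s := \tr (invmx (At t) *m E).
  pose M := \sum_p \sum_q normc (E p q).
  have M0 : 0 <= M by apply: sumr_ge0 => p _; apply: sumr_ge0 => q _; exact: normc_ge0.
  have EM p q : normc (E p q) <= M.
    rewrite /M (bigD1 p)//= (bigD1 q)//= -addrA lerDl addr_ge0// sumr_ge0// => *.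
    - exact: normc_ge0.
    - by apply: sumr_ge0 => *; exact: normc_ge0.
  have DJ : is_cderive t (fun t => gaussJ (At t) x0) (- 2^-1 * s * gaussJ (At t) x0).
    have [K K0 HK] := gaussJ_perturb x0 lpos (cAt t t01).
    (* The radius below keeps |h| M d at most l / 4, the range of [gaussJ_perturb]. *)
    have den : 0 < M * d%:R + 1 by rewrite ltr_wpDl// mulr_ge0.
    apply: (@is_cderive_quad _ _ _ _ (K * M ^+ 2) (l / 4 / (M * d%:R + 1))).
    - by rewrite !divr_gt0.
    - by rewrite mulr_ge0// exprn_ge0.
    - move=> h hr; rewrite Atadd.
      have hE p q : normc ((h%:C%C *: E) p q) <= `|h| * M.
        by rewrite mxE normcM normc_real ler_wpM2l.
      have [|//|H _] := HK (h%:C%C *: E) (`|h| * M) hE.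
        by rewrite mulr_ge0.
      + rewrite -mulrA; move: hr; rewrite ltr_pdivlMr// => /ltW; apply: le_trans.
        by rewrite ler_wpM2l// lerDl.
      + move: H; rewrite (cint_qform_weight _ (symAt t) _ (uAt t t01) lpos (cAt t t01)); last first.
          by rewrite linearZ /= symE.
        rewrite -scalemxAr mxtraceZ -/s exprMn real_normK ?num_real// mulrCA [leRHS]mulrC mulrA.
        set u := gaussJ _ _ - _; set v := gaussJ _ _.
        have -> : h%:C%C * (- 2^-1 * s * v) = h%:C%C * - 2^-1 * s * v by ring.
        by move=> H; rewrite (le_trans H)//; apply: le_of_eq; ring.
  have DD : is_cderive t (fun t => \det (At t)) (\det (At t) * s).
    have [K K0 HK] := det_perturb (invmx (At t) *m E).
    apply: (@is_cderive_quad _ _ _ _ (normc (\det (At t)) * K) 1) => //.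
      by rewrite mulr_ge0// normc_ge0.
    move=> h /ltW h1; rewrite Atadd.
    have -> : At t + h%:C%C *: E = At t *m (1%:M + h%:C%C *: (invmx (At t) *m E)).
      by rewrite mulmxDr mulmx1 -scalemxAr mulmxA mulmxV ?uAt// mul1mx.
    rewrite det_mulmx -mulrA.
    have alg (D D' c r : R[i]) : D * D' - D - c * (D * r) = D * (D' - 1 - c * r) by ring.
    by rewrite alg normcM; apply: ler_wpM2l; [exact: normc_ge0|exact: HK].
  have := cdirM (cdirM DJ DJ) DD.
  have alg (J D r : R[i]) : (- 2^-1 * r * J * J + J * (- 2^-1 * r * J)) * D + J * J * (D * r) = 0.
    by field.
  by rewrite alg.
have := is_cderive0_cst DP.
rewrite /P /At rmorph0 rmorph1 scale0r scale1r addr0 det1 mulr1 /E addrCA subrr addr0 -!expr2.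
by rewrite gaussJ1 => <-.
Qed.

End GaussianNormalisation.

Section SquareRootOfDeterminant.
Variables (R : realType) (d : nat).
Implicit Types (A B E : 'M[R[i]]_d) (x y : 'rV[R]_d).

(** Since t < |a| / 2, also |b| > |a| / 2, and |1/a - 1/b| = |b - a| / |a b|. *)
Lemma normc_invB_lt (a b : R[i]) (t e : R) : a != 0 -> b != 0 -> normc (b - a) <= t ->
  t * 2 < normc a -> t * 2 < e * normc a ^+ 2 -> 0 < e -> normc (a^-1 - b^-1) < e.
Proof.
move=> an bn ab ta te e0.
have -> : a^-1 - b^-1 = (b - a) * (a^-1 * b^-1) by field; rewrite an bn.
have a0 := normc_gt0 an; have b0 := normc_gt0 bn.
have h := normcD (- (b - a)) b; rewrite normcN opprB subrK in h.
rewrite normcM normcM !normcV.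
move: (normc a) (normc b) (normc (b - a)) a0 b0 ab ta te h => x y z x0 y0 zt tx te h.
rewrite -invfM ltr_pdivrMr; last exact: mulr_gt0.
have xy : x <= y * 2 by lra.
have : e * (x * x) <= e * (x * (y * 2)) by rewrite !ler_wpM2l ?(ltW e0) ?(ltW x0).
by rewrite expr2 in te; lra.
Qed.

Lemma normc_dist_lt (a b a' b' : R[i]) (e : R) : normc (a - a') < e / 4 -> normc (b - b') < e / 4 ->
  `|(normc (a - b) - normc (a + b)) - (normc (a' - b') - normc (a' + b'))| < e.
Proof.
have lip (z w : R[i]) : `|normc z - normc w| <= normc (z - w) :> R.
  rewrite ler_norml; apply/andP; split.
    have := normcD (- (z - w)) z; rewrite normcN opprB subrK; lra.
  have := normcD (z - w) w; rewrite subrK; lra.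
have k1 := lip (a - b) (a' - b'); have k2 := lip (a + b) (a' + b').
have k3 := normcB (a - a') (b - b'); have k4 := normcD (a - a') (b - b').
have e3 : a - a' - (b - b') = a - b - (a' - b') by ring.
have e4 : a - a' + (b - b') = a + b - (a' + b') by ring.
rewrite e3 in k3; rewrite e4 in k4.
have final (x y x' y' u v f g : R) : `|x - x'| <= u -> `|y - y'| <= v -> u <= f + g ->
    v <= f + g -> f < e / 4 -> g < e / 4 -> `|(x - y) - (x' - y')| < e.
  rewrite !ler_norml ltr_norml => /andP[? ?] /andP[? ?] *.
  by apply/andP; split; lra.
exact: final k1 k2 k3 k4.
Qed.

Lemma qform0 A : qform A (0 : 'rV[R]_d) = 0.
Proof. by rewrite /qform big1// => p _; rewrite big1// => q _; rewrite !mxE mulr0. Qed.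

Lemma re_qformE A y : re (qform A y) = (y *m map_mx re A *m y^T) 0 0.
Proof.
rewrite /qform exchange_big Re_sum mxE /=; apply: eq_bigr => p _.
rewrite !mxE mulr_suml Re_sum; apply: eq_bigr => q _.
by rewrite !mxE !ReM /= !mul0r !mulr0 !subr0.
Qed.

Lemma sqnormE y : sqnorm y = (y *m y^T) 0 0.
Proof. by rewrite mxE; apply: eq_bigr => p _; rewrite !mxE expr2. Qed.

Lemma qform_scale A (c : R) y : qform A (c *: y) = (c ^+ 2)%:C%C * qform A y.
Proof.
rewrite /qform mulr_sumr; apply: eq_bigr => p _; rewrite mulr_sumr.
by apply: eq_bigr => q _; rewrite !mxE !rmorphM; ring.
Qed.

Lemma continuous_re_qform A : continuous (fun y => re (qform A y)).
Proof.
move=> y; have := (@ccontinuous_qform R d A 0 y).1.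
rewrite /continuous_at (_ : _ \o _ = fun y => re (qform A y))//.
by apply/funext => z /=; rewrite subr0.
Qed.

(** The minimum on the unit sphere, extended to all vectors by homogeneity. *)
Lemma posdef_coercive A : posdef (map_mx re A) -> exists2 lam : R, 0 < lam & coercive A lam.
Proof.
move=> pA; pose S := [set y : 'rV[R]_d | sqnorm y = 1].
have csq : continuous (fun y : 'rV[R]_d => sqnorm y).
  move=> y; have := @continuous_re_qform 1%:M y.
  rewrite /continuous_at (_ : (fun y => _) = fun y => sqnorm y)//.
    by rewrite qform1.
  by apply/funext => z /=; rewrite qform1.
have cS : compact S.
  have cl : closed S.
    rewrite (_ : S = (fun y : 'rV[R]_d => sqnorm y) @^-1` [set 1])//.
    by apply: closed_comp => [y _|]; [exact: csq|exact: closed_eq].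
  apply: subclosed_compact cl (@rV_compact R d (fun=> `[-1, 1]%classic) _) _.
    by move=> _; exact: segment_compact.
  move=> y yS i /=; rewrite in_itv /= -ler_norml.
  by rewrite -(@ler_pXn2r _ 2)// ?nnegrE// expr1n real_normK ?num_real// -yS; exact: coord_le_sqnorm.
have pos y : y != 0 -> 0 < re (qform A y) by rewrite re_qformE; exact: pA.
have snz y : sqnorm y != 0 -> y != 0.
  by apply: contra_neq => ->; rewrite /sqnorm big1// => i _; rewrite mxE expr0n.
(* The sphere is empty exactly in dimension 0, where any constant works. *)
have [S0|S0] := pselect (S !=set0); last first.
  exists 1 => // y; have [y0|y0] := eqVneq (sqnorm y) 0.
    by rewrite y0 mulr0; have [->|/pos/ltW//] := eqVneq y 0; rewrite qform0.
  have sp : 0 < sqnorm y by rewrite lt_neqAle eq_sym y0 sqnorm_ge0.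
  exfalso; apply: S0; exists ((Num.sqrt (sqnorm y))^-1 *: y).
  rewrite /S /=; have := congr1 re (qform_scale 1%:M (Num.sqrt (sqnorm y))^-1 y).
  by rewrite !qform1 -rmorphM /= => ->; rewrite exprVn sqr_sqrtr ?mulVf// ltW.
have [c cS' cmin] := EVT_min_rV S0 cS (continuous_subspaceT (@continuous_re_qform A)).
have cn : c != 0.
  by apply: snz; rewrite inE in cS'; rewrite cS' oner_neq0.
exists (re (qform A c)); first exact: pos.
move=> y; have [y0|y0] := eqVneq (sqnorm y) 0.
  by rewrite y0 mulr0; have [->|/pos/ltW//] := eqVneq y 0; rewrite qform0.
have sp : 0 < sqnorm y by rewrite lt_neqAle eq_sym y0 sqnorm_ge0.
have : (Num.sqrt (sqnorm y))^-1 *: y \in S.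
  rewrite inE /S /=; have := congr1 re (qform_scale 1%:M (Num.sqrt (sqnorm y))^-1 y).
  by rewrite !qform1 -rmorphM /= => ->; rewrite exprVn sqr_sqrtr ?mulVf// ltW.
move=> /cmin; rewrite qform_scale ReZ exprVn sqr_sqrtr ?(ltW sp)//.
by rewrite mulrC ler_pdivlMr.
Qed.

(** In the order of R[i] a positive radius is a positive real number, so the complex epsilons of the
    topology reduce to real ones. *)
Lemma within_mx_epsP (phi : 'M[R[i]]_d -> R[i]) (K : set 'M[R[i]]_d) :
  {within (K : set 'M[R[i]^o]_d), continuous (phi : _ -> R[i]^o)} <->
  forall B, K B -> forall e : R, 0 < e -> exists2 r : R, 0 < r &
    forall B', K B' -> (forall p q, normc (B p q - B' p q) < r) -> normc (phi B - phi B') < e.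
Proof.
split=> [/subspace_continuousP H B KB e e0|H].
  have e0C : 0 < e%:C%C :> R[i]^o by rewrite ltcR.
  have /cvgrPdist_lt/(_ _ e0C) := H B KB.
  rewrite near_withinE => /nbhs_ballP[r /= r0 rP].
  have rr : r = (re r)%:C%C by case: r r0 {rP} => a b; rewrite ltcE /= => /andP[/eqP-> _].
  exists (re r); first by move: r0; rewrite {1}rr ltcR.
  move=> B' KB' BB'; rewrite -ltcR; apply: (rP B') => //.
  by split=> // p q; have := BB' p q; rewrite -ltcR -rr; exact.
apply/subspace_continuousP => B KB; apply/cvgrPdist_lt => e e0.
have ee : e = (re e)%:C%C by case: e e0 => a b; rewrite ltcE /= => /andP[/eqP-> _].
have e1 : 0 < re e by move: e0; rewrite {1}ee ltcR.
have [r r0 rP] := H B KB _ e1.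
rewrite near_withinE; apply/nbhs_ballP; exists r%:C%C => /=; first by rewrite ltcR.
move=> B' [_ BB'] KB'; rewrite ee ltcR; apply: rP => // p q.
by rewrite -ltcR; exact: BB'.
Qed.

Lemma re_posdef_sym_segment B (t : R) : re_posdef_sym B -> 0 <= t <= 1 ->
  re_posdef_sym ((1 - t)%:C%C *: 1%:M + t%:C%C *: B).
Proof.
move=> [symB pB] /andP[t0 t1]; split.
  by rewrite linearD !linearZ /= symB trmx1.
move=> v v0; rewrite -re_qformE qformD !qformZ qform1 ReD !ReZ /=.
have h : 0 < re (qform B v) by rewrite re_qformE pB.
have s := sqnorm_gt0 v0.
have [->|tn] := eqVneq t 0; first by rewrite subr0 mul1r mul0r addr0.
by rewrite ltr_wpDl// ?mulr_ge0 ?subr_ge0// ?ltW// mulr_gt0// lt_neqAle eq_sym tn.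
Qed.

(** Two branches agree up to sign and never vanish. The sign cannot change along the segment from
    the identity to B, and at the identity both are positive. *)
Lemma is_sqrt_det_unique (phi psi : 'M[R[i]]_d -> R[i]) B :
  is_sqrt_det phi -> is_sqrt_det psi -> re_posdef_sym B -> phi B = psi B.
Proof.
move=> [/within_mx_epsP cphi phi2 phip] [/within_mx_epsP cpsi psi2 psip] KB.
pose P (t : R) := (1 - t)%:C%C *: 1%:M + t%:C%C *: B.
have KP t : 0 <= t <= 1 -> re_posdef_sym (P t) by exact: re_posdef_sym_segment.
have nz M : re_posdef_sym M -> psi M != 0.
  move=> KM; have [lam l0 cM] := posdef_coercive KM.2.
  have := coercive_unit KM.1 l0 cM; rewrite unitmxE unitfE -(psi2 _ KM).
  by rewrite expf_eq0.
have or M : re_posdef_sym M -> phi M = psi M \/ phi M = - psi M.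
  move=> KM; have /eqP := phi2 _ KM; rewrite -(psi2 _ KM) eqf_sqr.
  by case/orP => /eqP ->; [left|right].
(* [N t < 0] where the branches agree, [N t > 0] where they are opposite, and
   [N t = 0] would make both vanish. *)
pose N t := normc (phi (P t) - psi (P t)) - normc (phi (P t) + psi (P t)).
have Pdist t t' p q : normc (P t p q - P t' p q) <= `|t - t'| * \sum_i \sum_j normc ((B - 1%:M) i j).
  have -> : P t p q - P t' p q = (t - t')%:C%C * (B - 1%:M) p q.
    by rewrite /P !mxE !rmorphB rmorph1; ring.
  rewrite normcM normc_real ler_wpM2l// (bigD1 p)//= (bigD1 q)//= -addrA lerDl.
  by rewrite addr_ge0// sumr_ge0// => *; rewrite ?sumr_ge0// => *; exact: normc_ge0.
have cN : {within `[0, 1], continuous N}.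
  apply/subspace_continuousP => t /=; rewrite in_itv /= => t01.
  apply/cvgrPdist_lt => e e0.
  have e4 : 0 < e / 4 by rewrite divr_gt0.
  have [r1 r10 H1] := cphi _ (KP t t01) _ e4.
  have [r2 r20 H2] := cpsi _ (KP t t01) _ e4.
  set M := \sum_i \sum_j normc ((B - 1%:M) i j) in Pdist.
  have M0 : 0 <= M by rewrite sumr_ge0// => *; rewrite ?sumr_ge0// => *; exact: normc_ge0.
  have M1 : 0 < M + 1 by rewrite ltr_wpDl.
  rewrite near_withinE; apply/nbhs_ballP.
  exists (Num.min r1 r2 / (M + 1)); first by rewrite /= divr_gt0// lt_min r10.
  move=> t' btt'; have {btt'} : `|t - t'| < Num.min r1 r2 / (M + 1) := btt'.
  rewrite ltr_pdivlMr// => tt'; rewrite /= in_itv /= => t'01.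
  have dist p q : normc (P t p q - P t' p q) < Num.min r1 r2.
    rewrite (le_lt_trans (Pdist _ _ _ _))// (le_lt_trans _ tt')// ler_wpM2l//.
    by rewrite lerDl.
  have h1 : normc (phi (P t) - phi (P t')) < e / 4.
    by apply: H1 => [|p q]; [exact: KP|have := dist p q; rewrite lt_min => /andP[]].
  have h2 : normc (psi (P t) - psi (P t')) < e / 4.
    by apply: H2 => [|p q]; [exact: KP|have := dist p q; rewrite lt_min => /andP[]].
  exact: normc_dist_lt h1 h2.
have N0 : N 0 < 0.
  have P0 : P 0 = 1%:M by rewrite /P subr0 rmorph1 rmorph0 scale1r scale0r addr0.
  have K1 : re_posdef_sym (P 0) by apply: KP; rewrite lexx ler01.
  have im0 p q : im (P 0 p q) = 0 by rewrite P0 mxE; case: (p == q).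
  have p1 := phip _ K1 im0; have p2 := psip _ K1 im0.
  rewrite /N; case: (or _ K1) => E; last first.
    by move: p1; rewrite E oppr_gt0 => p1; have := lt_trans p1 p2; rewrite ltxx.
  have n0 : 0 < normc (psi (P 0) + psi (P 0)).
    by apply: normc_gt0; rewrite -mulr2n mulrn_eq0 /=; exact: nz.
  by rewrite E subrr normc0 sub0r oppr_lt0.
case: (or _ KB) => [EB|EB]; [exact: EB|exfalso].
have P1 : P 1 = B by rewrite /P subrr rmorph1 rmorph0 scale1r scale0r add0r.
have N1 : 0 < N 1.
  rewrite /N P1 EB addNr normc0.
  rewrite subr0; apply: normc_gt0; rewrite -opprD oppr_eq0 -mulr2n mulrn_eq0 /=.
  exact: nz.
have mm : Num.min (N 0) (N 1) <= 0 <= Num.max (N 0) (N 1).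
  move: (N 0) (N 1) N0 N1 => a b a0 b0.
  by rewrite ge_min le_max (ltW a0) (ltW b0) orbT.
have [t] := IVT ler01 cN mm.
rewrite in_itv /= => t01 Nt.
have KPt := KP t t01; have := nz _ KPt.
move: Nt; rewrite /N; case: (or _ KPt) => ->.
- rewrite subrr normc0.
  move/eqP; rewrite sub0r oppr_eq0 => /eqP/eq0_normc/eqP.
  by rewrite -mulr2n mulrn_eq0 /= => ->.
- rewrite addNr normc0.
  rewrite subr0 => /eq0_normc/eqP.
  by rewrite -opprD oppr_eq0 -mulr2n mulrn_eq0 /= => ->.
Qed.

(** The branch is produced as an inverse Gaussian integral; the scaling by 2 pi cancels the constant
    (2 pi)^d of [gaussJ_det]. *)
Lemma is_sqrt_det_gauss x0 : is_sqrt_det (fun B => (gaussJ ((2 * pi)%:C%C *: B) x0)^-1).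
Proof.
have pi2 : 0 < 2 * pi :> R by rewrite mulr_gt0// pi_gt0.
have scal B lam : 0 < lam -> coercive B lam ->
    0 < 2 * pi * lam /\ coercive ((2 * pi)%:C%C *: B) (2 * pi * lam).
  by move=> l0 cB; split=> [|y]; [rewrite mulr_gt0|rewrite qformZ ReZ -mulrA ler_wpM2l// ltW].
have detE B : re_posdef_sym B -> gaussJ ((2 * pi)%:C%C *: B) x0 ^+ 2 * \det B = 1.
  move=> [symB pB]; have [lam l0 cB] := posdef_coercive pB.
  have [l1 c1] := scal _ _ l0 cB.
  have symB' : ((2 * pi)%:C%C *: B)^T = (2 * pi)%:C%C *: B by rewrite linearZ /= symB.
  have := gaussJ_det x0 symB' l1 c1; rewrite detZ -rmorphXn mulrCA => h.
  have nz : ((2 * pi) ^+ d)%:C%C != 0 :> R[i].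
    by apply: contra_neq (lt0r_neq0 (exprn_gt0 d pi2)) => /(congr1 re).
  by apply: (mulfI nz); rewrite h mulr1.
have Jnz B : re_posdef_sym B -> gaussJ ((2 * pi)%:C%C *: B) x0 != 0.
  move=> /detE h; apply: contra_eq_neq h => ->.
  by rewrite expr0n mul0r eq_sym oner_neq0.
split.
- apply/within_mx_epsP => B KB e e0.
  have [lam l0 cB] := posdef_coercive KB.2.
  have [l1 c1] := scal _ _ l0 cB.
  have [K K0 HK] := gaussJ_perturb x0 l1 c1.
  set J := gaussJ _ _ in HK; have J0 : 0 < normc J.
    exact/normc_gt0/Jnz.
  have den1 : 0 < 2 * pi * K * 2 + 1 by rewrite ltr_wpDl// !mulr_ge0// ltW ?pi_gt0.
  have den2 : 0 < 2 * pi * d%:R + 1 :> R by rewrite ltr_wpDl// !mulr_ge0// ltW ?pi_gt0.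
  (* The first bound makes the change of the integral small enough for [normc_invB_lt], the second
     keeps the perturbation within coercivity. The summands 1 in the denominators keep them positive
     and the inequality strict. *)
  pose r := Num.min (Num.min (normc J) (e * normc J ^+ 2) / (2 * pi * K * 2 + 1))
     (2 * pi * lam / 4 / (2 * pi * d%:R + 1)).
  have r0 : 0 < r.
    rewrite lt_min !divr_gt0// ?lt_min ?J0 ?mulr_gt0// ?pi_gt0// exprn_gt0//.
  exists r => // B' KB' BB'.
  pose E := (2 * pi)%:C%C *: (B' - B).
  have EB : (2 * pi)%:C%C *: B' = (2 * pi)%:C%C *: B + E by rewrite -scalerDr addrCA subrr addr0.
  have Ee p q : normc (E p q) <= 2 * pi * r.
    rewrite mxE normcM normc_real gtr0_norm// ler_wpM2l ?(ltW pi2)// -normcN !mxE opprB.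
    exact/ltW/BB'.
  have [||_ H2] := HK E (2 * pi * r) Ee.
  + by rewrite mulr_ge0// ltW.
  + have : r <= 2 * pi * lam / 4 / (2 * pi * d%:R + 1) by rewrite ge_min lexx orbT.
    rewrite ler_pdivlMr//; apply: le_trans.
    by rewrite (_ : 2 * pi * r * d%:R = r * (2 * pi * d%:R)) ?ler_wpM2l ?lerDl ?(ltW r0)//; ring.
  have J'nz : gaussJ ((2 * pi)%:C%C *: B') x0 != 0 by exact: Jnz.
  move: J'nz; rewrite EB; set J' := gaussJ _ _ in H2 * => J'nz.
  have rle : K * (2 * pi * r) * 2 < Num.min (normc J) (e * normc J ^+ 2).
    have : r <= Num.min (normc J) (e * normc J ^+ 2) / (2 * pi * K * 2 + 1) by rewrite ge_min lexx.
    rewrite ler_pdivlMr//; apply: lt_le_trans.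
    by rewrite [ltRHS](_ : _ = K * (2 * pi * r) * 2 + r) ?ltrDl//; ring.
  move: rle; rewrite lt_min => /andP[rle1 rle2].
  exact: normc_invB_lt (Jnz _ KB) J'nz H2 rle1 rle2 e0.
- by move=> B KB; rewrite exprVn -[RHS]mulr1 -(mulfV (expf_neq0 2 (Jnz _ KB))) mulrA [\det B * _]mulrC detE// mul1r.
- move=> B KB iB; rewrite invr_gt0.
  have JR := gaussJ_real (A := (2 * pi)%:C%C *: B) x0 _.
  have := Jnz _ KB; rewrite JR => [|y]; last first.
    rewrite qformZ ImM /= mul0r addr0 /qform Im_sum big1 ?mulr0// => p _.
    by rewrite Im_sum big1// => q _; rewrite mulrAC -rmorphM ImM iB /= mulr0 mul0r addr0.
  move=> nz; rewrite ltcR lt_neqAle.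
  have h : 0 <= \int[lebesgue_tuple R d]_t expR (- 2^-1 * re (qform ((2 * pi)%:C%C *: B) (row_of_tuple t - x0))).
    by apply: Rintegral_ge0 => t _; exact: expR_ge0.
  apply/andP; split; last exact: h.
  by rewrite eq_sym; apply: contra_neq nz => ->.
Qed.

Lemma sqrt_detE B x0 : re_posdef_sym B -> sqrt_det B = (gaussJ ((2 * pi)%:C%C *: B) x0)^-1.
Proof.
move=> KB; apply: (is_sqrt_det_unique _ (is_sqrt_det_gauss x0) KB).
by apply: (@xgetPex _ _ [set phi | is_sqrt_det phi]); exists (fun B => (gaussJ ((2 * pi)%:C%C *: B) x0)^-1); exact: is_sqrt_det_gauss.
Qed.

End SquareRootOfDeterminant.

(** * The expansion as a Gaussian integral *)

Section IteratedQuadraticOperators.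
Variables (R : realType) (d : nat) (W : set 'rV[R]_d).
Hypothesis oW : open W.
Implicit Types (M : 'M[R[i]]_d) (v w : 'rV[R]_d -> R[i]) (x : 'rV[R]_d).

Lemma iter_quad_op_ext n M v w x : smooth_on W v -> (forall z, W z -> v z = w z) -> W x ->
  iter n (quad_op M) v x = iter n (quad_op M) w x.
Proof.
elim: n v w x => [|n ih] v w x Sv vw Wx; first exact: vw.
have Sw := smooth_ext oW vw Sv.
rewrite !iterSr; apply: ih => [|z Wz|//]; first exact: smooth_quad_op.
rewrite /quad_op; apply: eq_bigr => p _; apply: eq_bigr => q _.
apply: (congr1 (fun c => M p q * c)).
apply: (pderiv_ext oW p (smooth_C1 (smooth_pderiv q Sv)) _ Wz) => z' Wz'.
exact: (pderiv_ext oW q (smooth_C1 Sv) vw Wz').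
Qed.

Lemma quad_opZ M c v x : smooth_on W v -> W x ->
  quad_op M (fun z => c * v z) x = c * quad_op M v x.
Proof.
move=> Sv Wx; rewrite /quad_op mulr_sumr; apply: eq_bigr => p _; rewrite mulr_sumr.
apply: eq_bigr => q _; rewrite mulrCA; congr (_ * _).
have Scv : smooth_on W (fun z => c * v z) by exact: (smoothM oW (smooth_cst oW c) Sv).
rewrite -(pderivZ p c (smooth_pderiv q Sv) Wx).
apply: (pderiv_ext oW p (smooth_C1 (smooth_pderiv q Scv)) _ Wx) => z Wz.
exact: (pderivZ q c Sv Wz).
Qed.

Lemma iter_quad_opZ n M c v x : smooth_on W v -> W x ->
  iter n (quad_op M) (fun z => c * v z) x = c * iter n (quad_op M) v x.
Proof.
elim: n v x => [|n ih] v x Sv Wx; first exact: erefl.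
rewrite !iterSr -(ih _ _ (smooth_quad_op oW M Sv) Wx).
have Scv := smooth_quad_op oW M (smoothM oW (smooth_cst oW c) Sv).
by apply: (iter_quad_op_ext n M Scv _ Wx) => z Wz; exact: (quad_opZ M c Sv Wz).
Qed.

Lemma iter_quad_op_scale n M c v x : smooth_on W v -> W x ->
  iter n (quad_op (c *: M)) v x = c ^+ n * iter n (quad_op M) v x.
Proof.
elim: n v x => [|n ih] v x Sv Wx; first by rewrite mul1r.
rewrite !iterSr.
have -> : quad_op (c *: M) v = fun z => c * quad_op M v z.
  apply/funext => z; rewrite /quad_op mulr_sumr; apply: eq_bigr => p _; rewrite mulr_sumr.
  by apply: eq_bigr => q _; rewrite mxE mulrA.
have SM := smooth_quad_op oW M Sv.
have ScM := smoothM oW (smooth_cst oW c) SM.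
by rewrite (ih _ _ ScM Wx) (iter_quad_opZ n M c SM Wx) mulrA exprSr.
Qed.

End IteratedQuadraticOperators.

Section StationaryExpansion.
Variables (R : realType) (d : nat) (W : set 'rV[R]_d).
Variables (f u : 'rV[R]_d -> R[i]) (x0 : 'rV[R]_d).
Hypotheses (oW : open W) (Wx0 : W x0) (Sf : smooth_on W f) (Su : smooth_on W u).
Hypotheses (f0 : f x0 = 0) (df0 : forall i, pderiv i f x0 = 0).
Implicit Types (x y : 'rV[R]_d).
Local Notation B := (hessian f x0).
Local Notation g := (cubic_part f x0).

Lemma hessian_sym : B^T = B.
Proof. by apply/matrixP => p q; rewrite !mxE; exact: (pderivC oW q p Sf Wx0). Qed.

Lemma cubic_partE x : g x = f x + -1 * (2^-1 * qform B (x - x0)).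
Proof.
rewrite /cubic_part mulN1r; congr (_ - _ * _).
rewrite /qform exchange_big mxE /=; apply: eq_bigr => p _.
rewrite !mxE mulr_suml; apply: eq_bigr => q _; by rewrite !mxE.
Qed.

Lemma smooth_half_hessian : smooth_on W (fun x => 2^-1 * qform B (x - x0)).
Proof.
have S := smoothM openT (smooth_cst openT (2^-1 : R[i])) (smooth_qform B x0).
by move=> l x Wx; exact: S.
Qed.

Lemma smooth_cubic : smooth_on W g.
Proof.
rewrite (_ : g = fun x => f x + -1 * (2^-1 * qform B (x - x0))); last exact/funext/cubic_partE.
apply: (smoothD oW Sf); apply: (smoothM oW (smooth_cst oW _)).
exact: smooth_half_hessian.
Qed.

Lemma dirD2_hessian y : dirD 2 f y x0 = qform B y.
Proof.
rewrite /= /qform; apply: eq_bigr => p _; rewrite mulr_sumr; apply: eq_bigr => q _.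
by rewrite mxE (pderivC oW p q Sf Wx0) mulrA mulrAC.
Qed.

(** Subtracting the quadratic part kills the jets below order 3 and changes no other, so the Gevrey
    bounds of f apply to g directly. *)
Lemma jet_cubic n y : jet n g y x0 = if (n < 3)%N then 0 else jet n f y x0.
Proof.
rewrite /jet (_ : g = fun x => f x + -1 * (2^-1 * qform B (x - x0))); last exact/funext/cubic_partE.
have Sq := smooth_half_hessian.
rewrite (dirDD oW n y Sf (smoothM oW (smooth_cst oW _) Sq) Wx0).
rewrite (dirDZ oW n (-1) y Sq Wx0) dirD_half_qform; last exact: hessian_sym.
case: n => [|[|[|n]]] /=.
- by rewrite f0 mulr0 addr0 mul0r.
- by rewrite big1 ?mulr0 ?addr0 ?mul0r// => p _; rewrite df0 mulr0.
- by rewrite -[X in X + _]/(dirD 2 f y x0) dirD2_hessian mulN1r subrr mul0r.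
- by rewrite mulr0 addr0.
Qed.

Let Sgu mu : smooth_on W (fun x => g x ^+ mu * u x).
Proof. exact: (smoothM oW (smoothX oW mu smooth_cubic) Su). Qed.

Let jetS mu N y : jet N (fun x => g x ^+ mu.+1 * u x) y x0 =
  \sum_(a < N.+1) jet a g y x0 * jet (N - a) (fun x => g x ^+ mu * u x) y x0.
Proof.
rewrite (_ : (fun _ => _) = fun x => g x * (g x ^+ mu * u x)).
  exact: (jetM oW N y smooth_cubic (Sgu mu) Wx0).
by apply/funext => x; rewrite exprS mulrA.
Qed.

Lemma jet_cubicX_small mu N y : (N < 3 * mu)%N -> jet N (fun x => g x ^+ mu * u x) y x0 = 0.
Proof.
elim: mu N => [//|mu ih] N hN; rewrite jetS big1// => a _.
rewrite jet_cubic; case: ltnP => a3; first by rewrite mul0r.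
by rewrite ih ?mulr0//; have := ltn_ord a; lia.
Qed.

(* Up to higher order, [g (x0 + e y) = e^2 (phase_poly n y).[e]]. *)
Definition phase_poly n y : {poly R[i]} :=
  \poly_(l < n) (if l == 0 then 0 else jet l.+2 f y x0).

Definition amplitude_poly n y : {poly R[i]} := \poly_(l < n) jet l u y x0.

(** Jets multiply like coefficients, with a shift of the index by 2 for each factor g. Coefficients
    below n do not feel the truncation of the polynomials. *)
Lemma coef_phase_amplitude n mu m y : (m < n)%N ->
  (phase_poly n y ^+ mu * amplitude_poly n y)`_m =
  jet (m + 2 * mu) (fun x => g x ^+ mu * u x) y x0.
Proof.
elim: mu m => [|mu ih] m mn.
  rewrite mul1r coef_poly mn muln0 addn0; congr (jet _ _ _ _).
  by apply/funext => x; rewrite mul1r.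
rewrite exprS -mulrA coefM jetS.
(* Beyond a = m + 2 the remaining mu factors g would have fewer than 3 mu derivatives. The jets of
   order 0 and 1 of the first factor vanish too, which gives the shift by 2. *)
have -> : (m + 2 * mu.+1).+1 = (2 + m.+1 + 2 * mu)%N by lia.
rewrite -(big_mkord xpredT (fun a => jet a g y x0 * jet (m + 2 * mu.+1 - a) (fun x => g x ^+ mu * u x) y x0)).
rewrite (big_cat_nat (n := 2 + m.+1)%N) ?leq_addr//= [X in _ = _ + X]big_nat_cond.
rewrite [X in _ = _ + X]big1 ?addr0 => [|a /andP[/andP[h1 h2] _]]; last first.
  rewrite jet_cubicX_small ?mulr0//; lia.
rewrite !big_nat_recl//= !jet_cubic /= !mul0r !add0r big_mkord.
rewrite big_ord_recl [X in X * _ + _]coef_poly if_same mul0r add0r.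
apply: eq_bigr => b _; have bm := ltn_ord b.
rewrite lift0 ih; last by lia.
rewrite coef_poly (leq_ltn_trans bm mn) jet_cubic /=.
by congr (_ * jet _ _ _ _); lia.
Qed.

(* Under the Gaussian weight [y] has size [h^(1/2)], so the [m]-th term, of degree
   [m + 2 mu] in [y] with a factor [h^-mu], is of order [h^(m/2)]: cutting at
   [m < 2 k] keeps exactly the powers [h^j] with [j < k]. *)
Definition formal_integrand (h : R) n y : R[i] :=
  \sum_(m < n) \sum_(mu < n) ('i%C / h%:C%C) ^+ mu / mu`!%:R *
     (phase_poly n y ^+ mu * amplitude_poly n y)`_m.

Lemma sum_double (V : nmodType) (F : nat -> V) k :
  \sum_(m < k.*2) F m = \sum_(j < k) (F j.*2 + F j.*2.+1).
Proof.
by elim: k => [|k ih]; rewrite ?big_ord0// doubleS !big_ord_recr /= ih addrA.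
Qed.

(** With nu = mu + j the condition 3 mu <= 2 nu reads mu <= 2 j. *)
Lemma LopE j : Lop f x0 j u = \sum_(mu < (2 * j).+1)
  'i%C ^+ (mu + (mu + j)) / (2 ^+ (mu + j) * mu`!%:R * (mu + j)`!%:R) *
  iter (mu + j) (quad_op (invmx B)) (fun x => g x ^+ mu * u x) x0.
Proof.
rewrite /Lop (exchange_big_dep xpredT)//=; apply: eq_bigr => mu _.
have hm : (mu + j < (3 * j).+1)%N by have := ltn_ord mu; lia.
rewrite (big_pred1 (Ordinal hm)) => [//|nu]; rewrite /= -[RHS]/(nu == mu + j :> nat)%N.
case: eqP => //= ->; have := ltn_ord mu; lia.
Qed.

Lemma sum_widen_zero (V : nmodType) (F : nat -> V) a b : (a <= b)%N ->
  (forall m, (a <= m)%N -> F m = 0) -> \sum_(m < b) F m = \sum_(m < a) F m.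
Proof.
move=> ab F0; rewrite -!(big_mkord xpredT) (big_cat_nat (n := a))//=.
by rewrite [X in _ + X]big_nat_cond [X in _ + X]big1 ?addr0// => m /andP[/andP[/F0]].
Qed.

Lemma formal_integrand_weightE (h : R) A n : (fun x => formal_integrand h n (x - x0) * weight A x0 x) =
  fun x => \sum_(m < n) \sum_(mu < n) ('i%C / h%:C%C) ^+ mu / mu`!%:R / (m + 2 * mu)`!%:R *
    (dirD (m + 2 * mu) (fun x => g x ^+ mu * u x) (x - x0) x0 * weight A x0 x).
Proof.
apply/funext => x; rewrite mulr_suml; apply: eq_bigr => m _; rewrite mulr_suml.
apply: eq_bigr => mu _; rewrite coef_phase_amplitude// /jet.
by rewrite !mulrA; congr (_ * _); rewrite mulrAC.
Qed.

Lemma gauss_dom_formal_integrand (h lam : R) A n : 0 < lam -> coercive A lam ->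
  gauss_dom x0 (fun x => formal_integrand h n (x - x0) * weight A x0 x).
Proof.
move=> l0 cA; rewrite formal_integrand_weightE.
apply: gauss_dom_sum => m; apply: gauss_dom_sum => mu; apply: gauss_domZ.
exact: gauss_dom_dirDweight _ _ _ _ l0 cA.
Qed.

(** Powers of h: a moment of order 2 (mu + j) contributes (h i)^(mu + j) through the inverse of A,
    and the exponential series contributes (i / h)^mu, so h^j i^(2 mu + j) is left, which is h^j
    i^(mu + nu). *)
Lemma cint_formal_integrand (h lam : R) k : 0 < h -> 0 < lam ->
  coercive ((h%:C%C * 'i%C)^-1 *: B) lam ->
  cint (fun x => formal_integrand h k.*2 (x - x0) * weight ((h%:C%C * 'i%C)^-1 *: B) x0 x) =
  gaussJ ((h%:C%C * 'i%C)^-1 *: B) x0 * \sum_(j < k) h%:C%C ^+ j * Lop f x0 j u.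
Proof.
move=> h0 l0; set e := h%:C%C * 'i%C; set A := e^-1 *: B => cA; set n := k.*2.
have hn := realC_neq0 (lt0r_neq0 h0).
have en : e != 0 by rewrite mulf_neq0 ?Ci_neq0.
have symA : A^T = A by rewrite /A linearZ /= hessian_sym.
have uA := coercive_unit symA l0 cA.
have uB : B \in unitmx.
  by move: uA; rewrite /A !unitmxE detZ unitrM => /andP[].
have iA : invmx A = e *: invmx B.
  by rewrite /A invmxZ ?unitfE ?invr_eq0// invrK.
pose V mu x := g x ^+ mu * u x.
pose c mu : R[i] := ('i%C / h%:C%C) ^+ mu / mu`!%:R.
pose F m mu := c mu / (m + 2 * mu)`!%:R * moment A x0 (m + 2 * mu) (V mu) x0.
have dom N v a : gauss_dom x0 (fun x => a * (dirD N v (x - x0) x0 * weight A x0 x)).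
  exact: gauss_domZ (gauss_dom_dirDweight _ _ _ _ l0 cA).
transitivity (\sum_(m < n) \sum_(mu < n) F m mu).
  rewrite formal_integrand_weightE.
  rewrite (cint_sum (x0 := x0)); last by move=> m; apply: gauss_dom_sum => mu; exact: dom.
  apply: eq_bigr => m _; rewrite (cint_sum (x0 := x0)); last by move=> mu; exact: dom.
  apply: eq_bigr => mu _; rewrite (cintZ (x0 := x0))//.
  exact: gauss_dom_dirDweight _ _ _ _ l0 cA.
rewrite (sum_double (fun m => \sum_(mu < n) F m mu)) mulr_sumr; apply: eq_bigr => j _.
(* Odd m give odd moments, which vanish. *)
rewrite [X in _ + X]big1 ?addr0 => [|mu _]; last first.
  rewrite /F (_ : (j.*2.+1 + 2 * mu)%N = (j + mu).*2.+1); last lia.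
  by rewrite (moment_odd x0 oW Wx0 symA uA l0 cA (j + mu) (Sgu mu)) mulr0.
(* For mu > 2 j the order 2 j + 2 mu is below 3 mu, the order to which g^mu vanishes. *)
rewrite (@sum_widen_zero _ (F j.*2) (2 * j).+1); first last.
- move=> mu hmu; rewrite /F /moment (_ : (fun _ => _) = fun=> 0) ?cint0 ?mulr0//.
  apply/funext => x; have := @jet_cubicX_small mu (j.*2 + 2 * mu) (x - x0).
  rewrite /jet -/(V mu) => H; have /eqP := H ltac:(lia).
  by rewrite mulf_eq0 invr_eq0 pnatr_eq0 -[(_`! == _)%N]negbK -lt0n fact_gt0 orbF => /eqP->; rewrite mul0r.
- by have := ltn_ord j; rewrite /n; lia.
rewrite LopE !mulr_sumr; apply: eq_bigr => mu _; rewrite /F.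
have -> : (j.*2 + 2 * mu)%N = (mu + j).*2 by lia.
rewrite mulrAC -mulrA (moment_even x0 oW Wx0 symA uA l0 cA); last exact: Sgu.
rewrite iA (iter_quad_op_scale oW _ _ _ (Sgu mu) Wx0) -/(gaussJ A x0) -/(V mu).
move: (iter _ _ _ _) (gaussJ A x0) => X J.
rewrite /c /e !exprMn exprVn !exprD.
have fn m : (m`!%:R : R[i]) != 0 by rewrite pnatr_eq0 -lt0n fact_gt0.
have pn m : ((2 : R[i]) ^+ m) != 0 by rewrite expf_neq0// pnatr_eq0.
move: (expf_neq0 mu hn) (fn mu) (fn (mu + j)%N) (pn mu) (pn j).
move: (h%:C%C ^+ mu) (h%:C%C ^+ j) ('i%C ^+ mu) ('i%C ^+ j) => a b i1 i3.
move: (mu`!%:R : R[i]) ((mu + j)`!%:R : R[i]) ((2 : R[i]) ^+ mu) ((2 : R[i]) ^+ j) => p q r s *.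
by field; do ?[apply/andP; split].
Qed.

End StationaryExpansion.

Section Normalisation.
Variables (R : realType) (d : nat).

(** The 2 pi of the Gaussian branch turns (2 pi h i)^-1 into (h i)^-1, so the prefactor of the
    expansion is the integral of the weight itself. *)
Lemma sqrt_det_hessian (B : 'M[R[i]]_d) (h lam : R) (x0 : 'rV[R]_d) : 0 < h -> B^T = B -> 0 < lam ->
  (forall y, lam * sqnorm y <= im (qform B y)) ->
  coercive ((h%:C%C * 'i%C)^-1 *: B) (lam / h) /\
  (sqrt_det (((2 * pi * h)%:C%C * 'i%C)^-1 *: B))^-1 = gaussJ ((h%:C%C * 'i%C)^-1 *: B) x0.
Proof.
move=> h0 symB l0 cB.
have iV (a : R) (z : R[i]) : re ((a%:C%C * 'i%C)^-1 * z) = a^-1 * im z.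
  by rewrite inv_realCi mulNr ReN Re_idiv opprK mulrC.
have pi2 : 0 < 2 * pi :> R by rewrite mulr_gt0// pi_gt0.
split.
  by move=> y; rewrite qformZ iV mulrAC [leLHS]mulrC ler_wpM2l ?invr_ge0 ?(ltW h0).
rewrite (sqrt_detE x0); last first.
  split; first by rewrite linearZ /= symB.
  have pih : 0 < 2 * pi * h by rewrite mulr_gt0.
  move=> v v0; rewrite -re_qformE qformZ iV mulr_gt0 ?invr_gt0//.
  by rewrite (lt_le_trans _ (cB v))// mulr_gt0// sqnorm_gt0.
have pn := realC_neq0 (lt0r_neq0 pi2).
have E : (2 * pi)%:C%C * ((2 * pi * h)%:C%C * 'i%C)^-1 = (h%:C%C * 'i%C)^-1 :> R[i].
  by rewrite (rmorphM _ (2 * pi)) -mulrA invfM mulrA mulfV ?mul1r.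
by rewrite scalerA E invrK.
Qed.

End Normalisation.

(** * Majorants *)

Section Majorants.
Variable R : realType.
Implicit Types (P : {poly R[i]}) (Q : {poly R}) (th : R).

(** Cauchy's majorants after rescaling the variable by [th]. *)
Definition majorized th P Q := forall m, normc P`_m <= th ^+ m * Q`_m.

Lemma majorized1 th : majorized th 1 1.
Proof.
move=> m; rewrite !coef1; case: m => [|m].
  by rewrite mul1r -(rmorph1 (real_complex R)) normc_real normr1.
by rewrite mulr0 normc0.
Qed.

Lemma majorizedM th P1 P2 Q1 Q2 : majorized th P1 Q1 -> majorized th P2 Q2 ->
  majorized th (P1 * P2) (Q1 * Q2).
Proof.
move=> h1 h2 m; rewrite !coefM (le_trans (normc_sum _ _ _))// mulr_sumr; apply: ler_sum => j _.
rewrite normcM (le_trans (ler_pM (normc_ge0 _) (normc_ge0 _) (h1 _) (h2 _)))//.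
by rewrite mulrACA -exprD subnKC// -ltnS.
Qed.

Lemma majorizedX th P Q n : majorized th P Q -> majorized th (P ^+ n) (Q ^+ n).
Proof.
move=> h; elim: n => [|n ih]; first by rewrite !expr0; exact: majorized1.
by rewrite !exprS; exact: majorizedM.
Qed.

Lemma coefM_ge0 Q1 Q2 : (forall m, 0 <= Q1`_m) -> (forall m, 0 <= Q2`_m) ->
  forall m, 0 <= (Q1 * Q2)`_m.
Proof. by move=> h1 h2 m; rewrite coefM sumr_ge0// => j _; rewrite mulr_ge0. Qed.

Lemma coefX_ge0 Q n : (forall m, 0 <= Q`_m) -> forall m, 0 <= (Q ^+ n)`_m.
Proof.
move=> h; elim: n => [|n ih] m; first by rewrite expr0 coef1; case: m.
by rewrite exprS; exact: coefM_ge0.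
Qed.

Lemma sum_coef_le_horner Q (x : R) a b : (forall m, 0 <= Q`_m) -> 0 <= x ->
  \sum_(a <= m < b) x ^+ m * Q`_m <= Q.[x].
Proof.
move=> Q0 x0; rewrite (@horner_coef_wide _ (maxn b (size Q))) ?leq_maxr//.
rewrite -(big_mkord xpredT (fun i => Q`_i * x ^+ i)).
apply: le_trans (_ : \sum_(0 <= m < b) Q`_m * x ^+ m <= _).
  have [ab|/ltnW ba] := leqP a b; last first.
    by rewrite big_geq// sumr_ge0// => m _; rewrite mulr_ge0// exprn_ge0.
  rewrite [leRHS](big_cat_nat (n := a))//= -[leLHS]add0r lerD//.
    by rewrite sumr_ge0// => m _; rewrite mulr_ge0// exprn_ge0.
  by apply: le_of_eq; apply: eq_bigr => m _; rewrite mulrC.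
rewrite [leRHS](big_cat_nat (n := b)) ?leq_maxl//= lerDl.
by rewrite sumr_ge0// => m _; rewrite mulr_ge0// exprn_ge0.
Qed.

Lemma geometric_le (x : R) n : 0 <= x -> x < 1 -> \sum_(i < n) x ^+ i <= (1 - x)^-1.
Proof.
move=> x0 x1; have h : 0 < 1 - x by rewrite subr_gt0.
rewrite -[leRHS]mul1r ler_pdivlMr// mulrC.
by rewrite -opprB mulNr -subrX1 opprB lerBlDr lerDl exprn_ge0.
Qed.

Lemma exp_sum_le (z : R) n : 0 <= z -> \sum_(j < n) z ^+ j / j`!%:R <= expR z.
Proof.
move=> z0; rewrite -(big_mkord xpredT (fun j => z ^+ j / j`!%:R)).
have nd : nondecreasing_seq (series (exp_coeff z)).
  by apply: nondecreasing_series => i _ _; exact: exp_coeff_ge0.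
exact: (nondecreasing_cvgn_le nd (is_cvg_series_exp_coeff z) n).
Qed.

Variables (a b th M : R) (n : nat) (K U : {poly R[i]}) (c : R[i]).
Hypotheses (a0 : 0 <= a) (b0 : 0 <= b) (th0 : 0 <= th) (M2 : 2 <= M).
Hypotheses (Kn : (size K <= n)%N) (Un : (size U <= n)%N) (K00 : K`_0 = 0).
Hypotheses (Ka : forall l, (l < n)%N -> normc K`_l <= a * th ^+ l).
Hypotheses (Ub : forall l, (l < n)%N -> normc U`_l <= b * th ^+ l).

(* All sums below are bounded by values at [x = 1/M] of the majorant series
   obtained from [QK] and [QU]; since [th = x (M th)], cutting at order [n] costs
   [(M th)^n] once [M th <= 1]. *)
Let QK : {poly R} := \poly_(l < n) (a * (l != 0)%:R).
Let QU : {poly R} := \poly_(l < n) b.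
Let x : R := M^-1.
Let M0 : 0 < M. Proof. exact: lt_le_trans M2. Qed.
Let M1 : 0 < M - 1. Proof. by rewrite subr_gt0 (lt_le_trans _ M2)// ltr1n. Qed.
Let x0 : 0 <= x. Proof. by rewrite invr_ge0 ltW. Qed.
Let x1 : x < 1. Proof. by rewrite invf_lt1// -subr_gt0. Qed.
Let x1V : (1 - x)^-1 = M / (M - 1).
Proof. by rewrite /x; field; rewrite (lt0r_neq0 M1) (lt0r_neq0 M0). Qed.

Let Mr : M / (M - 1) <= 2.
Proof. by rewrite ler_pdivrMr// mulrBr mulr1 lerBrDr mulr_natl mulr2n lerD2l. Qed.

Let majK : majorized th K QK.
Proof.
move=> m; rewrite coef_poly; case: ltnP => mn; last first.
  by rewrite nth_default ?(leq_trans Kn)// normc0 mulr0.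
case: m mn => [|m] mn; first by rewrite K00 normc0 eqxx !mulr0.
by rewrite mulr1 mulrC; exact: Ka.
Qed.

Let majU : majorized th U QU.
Proof.
move=> m; rewrite coef_poly; case: ltnP => mn; last first.
  by rewrite nth_default ?(leq_trans Un)// normc0 mulr0.
by rewrite mulrC; exact: Ub.
Qed.

Let QK0 m : 0 <= QK`_m.
Proof. by rewrite coef_poly; case: ifP => // _; rewrite mulr_ge0. Qed.

Let QU0 m : 0 <= QU`_m.
Proof. by rewrite coef_poly; case: ifP. Qed.

Let geomS (y : R) : 0 <= y -> y < 1 -> \sum_(l < n) (l != 0 :> nat)%:R * y ^+ l <= y / (1 - y).
Proof.
move=> y0 y1; case: n => [|n']; first by rewrite big_ord0 divr_ge0// subr_ge0 ltW.
rewrite big_ord_recl mul0r add0r.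
under eq_bigr => i _ do rewrite lift0 mul1r exprS.
by rewrite -mulr_sumr ler_wpM2l// geometric_le.
Qed.

(** As there is no constant term, the geometric series starts at x = 1/M and sums to 1 / (M - 1). A
    large M therefore makes the phase small, while the amplitude, which has a constant term, is only
    bounded. *)
Let QKx : QK.[x] <= a / (M - 1).
Proof.
rewrite (horner_coef_wide _ (size_poly _ _)).
under eq_bigr => l _ do rewrite coef_poly ltn_ord -mulrA.
rewrite -mulr_sumr ler_wpM2l// (le_trans (geomS x0 x1))// x1V /x.
by rewrite mulrA mulVf ?mul1r// lt0r_neq0.
Qed.

Let QUx : QU.[x] <= 2 * b.
Proof.
rewrite (horner_coef_wide _ (size_poly _ _)).
under eq_bigr => l _ do rewrite coef_poly ltn_ord.
rewrite -mulr_sumr mulrC ler_wpM2r// (le_trans (geometric_le n x0 x1))// x1V.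
exact: Mr.
Qed.

Let Hexp := expR (normc c * a / (M - 1)).

Let term_le mu m : normc (K ^+ mu * U)`_m <= (M * th) ^+ m * (x ^+ m * (QK ^+ mu * QU)`_m).
Proof.
have := majorizedM (majorizedX mu majK) majU m.
by rewrite mulrA -exprMn mulrAC /x mulfV ?lt0r_neq0// mul1r.
Qed.

Let QKQU0 mu m : 0 <= (QK ^+ mu * QU)`_m.
Proof. by apply: coefM_ge0 => // m'; exact: coefX_ge0. Qed.

Let partial_le mu i j : \sum_(i <= m < j) x ^+ m * (QK ^+ mu * QU)`_m <= (a / (M - 1)) ^+ mu * (2 * b).
Proof.
rewrite (le_trans (sum_coef_le_horner _ _ (QKQU0 mu) x0))// hornerM horner_exp.
have hK : 0 <= QK.[x] by rewrite horner_coef sumr_ge0// => l _; rewrite mulr_ge0 ?exprn_ge0.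
have hU : 0 <= QU.[x] by rewrite horner_coef sumr_ge0// => l _; rewrite mulr_ge0 ?exprn_ge0.
apply: ler_pM QUx => //; first exact: exprn_ge0.
by apply: lerXn2r QKx; rewrite ?nnegrE// divr_ge0// ltW.
Qed.

Let coef_le mu : normc (c ^+ mu / mu`!%:R) = normc c ^+ mu / mu`!%:R.
Proof.
by rewrite normcM normcX normcVnat.
Qed.

(** Summing over mu gives a partial sum of the exponential series at |c| a / (M - 1). *)
Let outer_le (T : R) (F : nat -> R) : 0 <= T ->
  (forall mu, F mu <= T * ((a / (M - 1)) ^+ mu * (2 * b))) ->
  \sum_(mu < n) normc c ^+ mu / mu`!%:R * F mu <= T * (2 * b) * Hexp.
Proof.
move=> T0 h.
have z0 : 0 <= normc c * a / (M - 1) by rewrite divr_ge0 ?mulr_ge0 ?normc_ge0// ltW.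
apply: le_trans (_ : T * (2 * b) * \sum_(mu < n) (normc c * a / (M - 1)) ^+ mu / mu`!%:R <= _); last first.
  by rewrite ler_wpM2l ?exp_sum_le// mulr_ge0// mulr_ge0.
rewrite mulr_sumr; apply: ler_sum => mu _.
rewrite (le_trans (ler_wpM2l _ (h mu)))//.
  by rewrite divr_ge0// exprn_ge0// normc_ge0.
rewrite -[normc c * a / _]mulrA; move: (a / _) => r.
by rewrite exprMn; apply: le_of_eq; ring.
Qed.

Definition truncated_exp := \sum_(m < n) \sum_(mu < n) c ^+ mu / mu`!%:R * (K ^+ mu * U)`_m.

(** Without a bound on [M * th] each power of degree below n is at most the n-th power of max (1, M
    th). *)
Lemma truncated_exp_le : normc truncated_exp <= Num.max 1 (M * th) ^+ n * (2 * b) * Hexp.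
Proof.
rewrite /truncated_exp exchange_big /= (le_trans (normc_sum _ _ _))//.
have mx1 : 1 <= Num.max 1 (M * th) by rewrite le_max lexx.
have T0 : 0 <= Num.max 1 (M * th) ^+ n by rewrite exprn_ge0// (le_trans ler01).
apply: le_trans (outer_le (F := fun mu => \sum_(m < n) normc (K ^+ mu * U)`_m) T0 _).
  apply: ler_sum => mu _; rewrite -mulr_sumr normcM coef_le ler_wpM2l ?normc_sum//.
  by rewrite divr_ge0// exprn_ge0// normc_ge0.
move=> mu; rewrite (le_trans _ (ler_wpM2l T0 (partial_le mu 0 n)))// big_mkord mulr_sumr.
apply: ler_sum => m _; rewrite (le_trans (term_le mu m))// ler_wpM2r//.
  by rewrite mulr_ge0// exprn_ge0.
rewrite (@le_trans _ _ (Num.max 1 (M * th) ^+ m))//.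
  by rewrite lerXn2r ?nnegrE ?mulr_ge0// ?(ltW M0)// ?le_max ?lexx ?orbT// (le_trans ler01).
by rewrite ler_weXn2l// ltnW.
Qed.

Hypothesis th1 : M * th <= 1.

Let thx : th <= x * (M * th).
Proof. by rewrite /x mulrA mulVf ?mul1r// lt0r_neq0. Qed.

Let T0 : 0 <= M * th. Proof. by rewrite mulr_ge0// ltW. Qed.

Lemma horner1_phase_le : normc K.[1] <= a / (M - 1) * (M * th).
Proof.
rewrite (horner_coef_wide _ Kn) (le_trans (normc_sum _ _ _))//.
apply: le_trans (_ : \sum_(l < n) (a * (M * th)) * ((l != 0 :> nat)%:R * x ^+ l) <= _).
  apply: ler_sum => l _; rewrite expr1n mulr1.
  case: l => -[|l] ln /=; first by rewrite K00 normc0 mul0r mulr0.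
  rewrite mul1r (le_trans (Ka ln))// -mulrA ler_wpM2l//.
  rewrite (_ : th ^+ l.+1 = (M * th) ^+ l.+1 * x ^+ l.+1); last first.
    by rewrite -exprMn mulrAC /x mulfV ?mul1r// lt0r_neq0.
  rewrite ler_wpM2r ?exprn_ge0// exprS ler_piMr// exprn_ile1//.
rewrite -mulr_sumr mulrAC ler_wpM2r//.
rewrite ler_wpM2l// (le_trans (geomS x0 x1))// x1V /x.
by rewrite mulrA mulVf ?mul1r// lt0r_neq0.
Qed.

Lemma horner1_amplitude_le : normc U.[1] <= 2 * b.
Proof.
rewrite (horner_coef_wide _ Un) (le_trans (normc_sum _ _ _))//.
apply: le_trans (_ : \sum_(l < n) b * x ^+ l <= _).
  apply: ler_sum => l _; rewrite expr1n mulr1 (le_trans (Ub (ltn_ord l)))// ler_wpM2l//.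
  rewrite lerXn2r ?nnegrE// (le_trans thx)// ler_piMr//.
rewrite -mulr_sumr mulrC ler_wpM2r// (le_trans (geometric_le n x0 x1))// x1V.
exact: Mr.
Qed.

(** Two truncations. Cutting the exponential series in mu gains (M th)^n because the phase at 1 is
    at most a / (M - 1) times M th; cutting the powers of the formal variable gains it from the tail
    of the majorant series. The constants 4 and 2 add up to 6. *)
Lemma cexp_truncated_exp :
  normc (cexp (c * K.[1]) * U.[1] - truncated_exp) <=
  6 * b * (M * th) ^+ n * expR (2 * (normc c * a / (M - 1))).
Proof.
set z := normc c * a / (M - 1).
have z0 : 0 <= z by rewrite divr_ge0 ?mulr_ge0 ?normc_ge0// ltW.
pose Sf := \sum_(mu < n) c ^+ mu / mu`!%:R * (K ^+ mu * U).[1].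
have S1 : (\sum_(mu < n) (c * K.[1]) ^+ mu / mu`!%:R) * U.[1] = Sf.
  rewrite mulr_suml; apply: eq_bigr => mu _; rewrite hornerM horner_exp exprMn.
  by rewrite [RHS]mulrA; congr (_ * _); rewrite mulrAC.
have nz : normc (c * K.[1]) <= z * (M * th).
  by rewrite normcM /z -!mulrA ler_wpM2l ?normc_ge0// mulrA horner1_phase_le.
have e1 : normc (cexp (c * K.[1]) * U.[1] - Sf) <= 4 * b * (M * th) ^+ n * expR (2 * z).
  rewrite -S1 -mulrBl normcM.
  apply: le_trans (ler_pM (normc_ge0 _) (normc_ge0 _) (cexp_taylor _ n) horner1_amplitude_le) _.
  rewrite mulrC (_ : 4 * b * _ * _ = 2 * b * (2 * ((M * th) ^+ n * expR (2 * z)))); last by ring.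
  rewrite ler_wpM2l ?mulr_ge0// ler_wpM2l//.
  have fn : 0 < (n`!%:R : R) by rewrite ltr0n fact_gt0.
  rewrite ler_pdivrMr//.
  have h1 : normc (c * K.[1]) ^+ n <= (M * th) ^+ n * (n`!%:R * expR z).
    apply: le_trans (_ : (z * (M * th)) ^+ n <= _).
      by rewrite lerXn2r ?nnegrE ?normc_ge0// mulr_ge0.
    rewrite exprMn mulrC ler_wpM2l ?exprn_ge0//.
    by have := expr_le_expR n (a := 1) ltr01 z0; rewrite expr1n divr1 mul1r.
  have h2 : expR (normc (c * K.[1])) <= expR z.
    by rewrite ler_expR (le_trans nz)// ler_piMr.
  rewrite (le_trans (ler_pM _ (expR_ge0 _) h1 h2)) ?exprn_ge0 ?normc_ge0//.
  rewrite (_ : 2 * z = z + z); last by ring.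
  by rewrite expRD; apply: le_of_eq; ring.
have e2 : normc (Sf - truncated_exp) <= (M * th) ^+ n * (2 * b) * Hexp.
  rewrite /Sf /truncated_exp exchange_big /= -sumrB.
  apply: le_trans (outer_le (F := fun mu => normc ((K ^+ mu * U).[1] - \sum_(m < n) (K ^+ mu * U)`_m)) _ _).
  - rewrite (le_trans (normc_sum _ _ _))//; apply: ler_sum => mu _.
    by rewrite -mulr_sumr -mulrBr normcM coef_le.
  - by rewrite exprn_ge0.
  move=> mu; set P := _ * _.
  rewrite (@horner_coef_wide _ (maxn n (size P))) ?leq_maxr//.
  under eq_bigr do rewrite expr1n mulr1.
  rewrite -!(big_mkord xpredT (fun m => P`_m)) (big_cat_nat (n := n)) ?leq_maxl//=.
  rewrite addrAC subrr add0r (le_trans (normc_sum _ _ _))//.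
  rewrite (le_trans _ (ler_wpM2l _ (partial_le mu n (maxn n (size P)))))//; last by rewrite exprn_ge0.
  rewrite mulr_sumr !big_nat; apply: ler_sum => m /andP[nm _].
  rewrite (le_trans (term_le mu m))// ler_wpM2r//; first by rewrite mulr_ge0// exprn_ge0.
  by rewrite ler_wiXn2l.
rewrite (_ : _ - _ = (cexp (c * K.[1]) * U.[1] - Sf) + (Sf - truncated_exp)); last by ring.
rewrite (le_trans (normcD _ _))// (le_trans (lerD e1 e2))//.
have h : Hexp <= expR (2 * z).
  by rewrite /Hexp -/z ler_expR mulr_natl mulr2n lerDl.
have T : 0 <= (M * th) ^+ n * (2 * b) by rewrite mulr_ge0 ?exprn_ge0// mulr_ge0.
rewrite (le_trans (lerD (lexx _) (ler_wpM2l T h)))//; apply: le_of_eq; ring.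
Qed.

End Majorants.

(** * The error estimate *)

Section RestrictedIntegrals.
Variables (R : realType) (d : nat).
Implicit Types (U : set 'rV[R]_d) (G : 'rV[R]_d -> R[i]).

Lemma cintegral_cint U G : cintegral U G = cint (fun x => if x \in U then G x else 0).
Proof.
have E (p : R[i] -> R) : p 0 = 0 ->
   \int[lebesgue_tuple R d]_(t in @row_of_tuple R d @^-1` U) p (G (row_of_tuple t)) =
   \int[lebesgue_tuple R d]_t p (if row_of_tuple t \in U then G (row_of_tuple t) else 0).
  move=> p0; rewrite Rintegral_mkcond; apply: eq_Rintegral => t _; rewrite patchE.
  have -> : (t \in @row_of_tuple R d @^-1` U) = (row_of_tuple t \in U).
    by apply/idP/idP; rewrite !inE.
  by case: ifP => // _; rewrite p0.
by apply: complex_eqP; rewrite ?Re_cint ?Im_cint /= E.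
Qed.

Lemma cmeasurable_restrict U G : open U -> (forall x, U x -> ccontinuous_at G x) ->
  cmeasurable (fun x => if x \in U then G x else 0).
Proof.
move=> oU cG.
have E (p : R[i] -> R) : p 0 = 0 -> (forall x, U x -> {for x, continuous (p \o G)}) ->
   measurable_fun [set: d.-tuple (measurableTypeR R)]
     (fun t => p (if row_of_tuple t \in U then G (row_of_tuple t) else 0)).
  move=> p0 cp; have := measurable_continuous_on oU cp.
  move/(measurable_restrictT _ (measurable_preim_open oU)).
  congr (measurable_fun _ _); apply/funext => t; rewrite patchE.
  have -> : (t \in @row_of_tuple R d @^-1` U) = (row_of_tuple t \in U).
    by apply/idP/idP; rewrite !inE.
  by case: ifP => // _; rewrite p0.
split.
- by apply: (E (@complex.Re R)) => // x /cG[].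
- by apply: (E (@complex.Im R)) => // x /cG[].
Qed.

End RestrictedIntegrals.

(** * Taylor remainders under Gevrey bounds *)

Section TaylorJets.
Variables (R : realType) (d : nat) (U : set 'rV[R]_d) (x0 : 'rV[R]_d).
Hypotheses (oU : open U) (Ux0 : U x0).
Hypothesis starU : forall x (t : R), U x -> 0 <= t <= 1 -> U (x0 + t *: (x - x0)).
Implicit Types (v : 'rV[R]_d -> R[i]) (x y : 'rV[R]_d).

Lemma taylor_jets v N x (m : R) : smooth_on U v -> U x ->
  (forall x', U x' -> normc (dirD N v (x - x0) x') <= m) ->
  normc (v x - \sum_(n < N) jet n v (x - x0) x0) <= 2 * (m / N`!%:R).
Proof.
move=> Sv Ux hm; set y := x - x0.
have H := @taylor_cbound R (fun n t => dirD n v y (x0 + t *: y)) N m.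
have : normc (dirD 0 v y (x0 + 1 *: y) - \sum_(n < N) dirD n v y (x0 + 0 *: y) / n`!%:R)
    <= 2 * (m / N`!%:R).
  apply: H => [n t _ t01|t t01]; last exact/hm/starU.
  exact: (cderive_dirD oU n Sv (starU Ux t01)).
by rewrite /= scale1r scale0r addr0 /y addrCA subrr addr0.
Qed.

Lemma powR_subr1 (z s : R) : 0 < z -> z `^ s / z = z `^ (s - 1).
Proof.
move=> z0; have zn := lt0r_neq0 z0.
have h : z `^ s = z `^ (s - 1) * z.
  by rewrite -{3}(powRr1 (ltW z0)) -powRD ?subrK// zn implybT.
by rewrite h -mulrA mulfV ?mulr1.
Qed.

(** The factorial of Taylor's formula uses up one power of n!, leaving the exponent s - 1 that
    measures the failure of analyticity. *)
Lemma dirD_gevrey_fact v (s A b : R) n y x : 1 <= s -> smooth_on U v -> 0 < A -> 0 < b ->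
  gevrey_bound s U v A b -> U x ->
  normc (dirD n v y x) / n`!%:R <= A * (b * norm1 y) ^+ n * n`!%:R `^ (s - 1).
Proof.
move=> s1 Sv A0 b0 G Ux.
have fn : 0 < n`!%:R :> R by rewrite ltr0n fact_gt0.
have s0 : 0 <= s by rewrite (le_trans ler01).
have h := dirD_gevrey n y oU Sv Ux Ux s0 A0 b0 G.
rewrite ler_pdivrMr// (le_trans h)// -mulrA.
have -> : n`!%:R `^ s = n`!%:R `^ (s - 1) * n`!%:R.
  by rewrite -powR_subr1// -mulrA mulVf ?mulr1// lt0r_neq0.
by rewrite exprMn; apply: le_of_eq; ring.
Qed.

Lemma fact_le_exp (l N : nat) : (l <= N)%N -> (l`! <= N ^ l)%N.
Proof.
move=> lN; elim: l lN => [//|l ih] lN; rewrite factS expnS leq_mul// ih// ltnW//.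
Qed.

Lemma fact2_le_exp (l N : nat) : (l.+2 <= N)%N -> ((l.+2)`! <= 2 * N ^ l)%N.
Proof.
elim: l => [//|l ih] lN; rewrite factS expnS mulnCA leq_mul// ih// ltnW//.
Qed.

Lemma powR_exprn (x r : R) n : 0 <= x -> (x ^+ n) `^ r = (x `^ r) ^+ n.
Proof. by move=> xp; rewrite -powR_mulrn// powRAC powR_mulrn// powR_ge0. Qed.

End TaylorJets.

Section Pointwise.
Variables (R : realType) (d : nat) (s : R) (U : set 'rV[R]_d).
Variables (f u : 'rV[R]_d -> R[i]) (x0 : 'rV[R]_d) (Au Bu Af Bf lam : R).
Hypotheses (s1 : 1 < s) (oU : open U) (Ux0 : U x0).
Hypothesis starU : forall x (t : R), U x -> 0 <= t <= 1 -> U (x0 + t *: (x - x0)).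
Hypotheses (Su : smooth_on U u) (Sf : smooth_on U f).
Hypotheses (Au0 : 0 < Au) (Bu0 : 0 < Bu) (Af0 : 0 < Af) (Bf0 : 0 < Bf) (lam0 : 0 < lam).
Hypotheses (Gu : gevrey_bound s U u Au Bu) (Gf : gevrey_bound s U f Af Bf).
Hypotheses (f0 : f x0 = 0) (df0 : forall i, pderiv i f x0 = 0).
Local Notation B := (hessian f x0).
Local Notation g := (cubic_part f x0).
Hypothesis coB : forall y, lam * sqnorm y <= im (qform B y).
Hypothesis gU : forall x, U x -> normc (g x) <= im (qform B (x - x0)) / 4.
Implicit Types (x y : 'rV[R]_d).

(** Dominates the geometric constants of both u and f, so that one [theta] serves both. *)
Let b0 : R := Bu + Bf.
Let b00 : 0 < b0. Proof. exact: addr_gt0. Qed.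
Let sm1 : 0 <= s - 1. Proof. by rewrite subr_ge0 ltW. Qed.

(* [l!^(s-1) <= (tau k)^l] for [l <= 2 k], which turns the Gevrey bounds on jets
   into the geometric ones [theta k y ^+ l]. *)
Definition tau k : R := (2 * k.+1)%:R `^ (s - 1).
Definition theta k y : R := b0 * norm1 y * tau k.
Definition cubic_const : R := 2 `^ (s - 1) * Af * b0 ^+ 2 * d%:R.
(* Makes [a y / (M - 1)] at most a sixteenth of [im (qform B y)], so that the
   Gaussian absorbs the exponentials of the majorants; see [a_le]. *)
Definition majorant_ratio : R := 2 + 16 * cubic_const / lam.

Local Notation M := majorant_ratio.
(** A coefficient of the phase of index l carries l + 2 derivatives of f; the two extra factors of
    |y| are collected here, so [a] is quadratic in y and the Gaussian can absorb it. *)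
Let a y : R := 2 `^ (s - 1) * Af * (b0 * norm1 y) ^+ 2.

Let tau0 k : 0 <= tau k. Proof. exact: powR_ge0. Qed.
Let z0 y : 0 <= b0 * norm1 y. Proof. by rewrite mulr_ge0 ?norm1_ge0// ltW. Qed.
Let theta0 k y : 0 <= theta k y. Proof. by rewrite mulr_ge0. Qed.
Let a0 y : 0 <= a y.
Proof. exact: mulr_ge0 (mulr_ge0 (powR_ge0 _ _) (ltW Af0)) (exprn_ge0 _ (z0 y)). Qed.
Let cc0 : 0 <= cubic_const.
Proof. by rewrite !mulr_ge0// ?powR_ge0 ?exprn_ge0// ltW. Qed.
Let M2 : 2 <= M.
Proof. by rewrite lerDl divr_ge0 ?mulr_ge0// ltW. Qed.
Let M1 : 0 < M - 1.
Proof. by rewrite subr_gt0 (lt_le_trans _ M2)// ltr1n. Qed.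

Let a_le y : a y <= (M - 1) * (im (qform B y) / 16).
Proof.
have h1 : a y <= cubic_const * sqnorm y.
  rewrite /a /cubic_const exprMn mulrA -[leRHS]mulrA; apply: ler_wpM2l.
    by rewrite !mulr_ge0// ?powR_ge0 ?exprn_ge0// ltW.
  exact: norm1_le_sqnorm.
have S0 := sqnorm_ge0 y.
have h2 : cubic_const * sqnorm y <= (M - 1) * (lam * sqnorm y / 16).
  have -> : (M - 1) * (lam * sqnorm y / 16) = (lam / 16 + cubic_const) * sqnorm y.
    by rewrite /majorant_ratio; field; rewrite lt0r_neq0.
  by rewrite ler_wpM2r// lerDr divr_ge0// ltW.
rewrite (le_trans h1)// (le_trans h2)// ler_wpM2l ?(ltW M1)// ler_wpM2r ?invr_ge0//.
Qed.

Let base_le (b : R) y l : 0 <= b -> b <= b0 -> (b * norm1 y) ^+ l <= (b0 * norm1 y) ^+ l.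
Proof.
move=> bp bb; apply: lerXn2r; rewrite ?nnegrE.
- by rewrite mulr_ge0// norm1_ge0.
- exact: z0.
- by rewrite ler_wpM2r ?norm1_ge0.
Qed.

Let amp_le l k y x : (l <= k.*2)%N -> U x ->
  normc (dirD l u y x) / l`!%:R <= Au * theta k y ^+ l.
Proof.
move=> lk Ux.
apply: le_trans (dirD_gevrey_fact oU l y (ltW s1) Su Au0 Bu0 Gu Ux) _.
have -> : Au * theta k y ^+ l = Au * (b0 * norm1 y) ^+ l * tau k ^+ l.
  by rewrite /theta exprMn mulrA.
apply: ler_pM; rewrite ?powR_ge0//.
- by rewrite mulr_ge0 ?exprn_ge0 ?mulr_ge0 ?norm1_ge0// ltW.
- by rewrite ler_wpM2l ?(ltW Au0)// base_le ?(ltW Bu0)// lerDl ltW.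
- rewrite /tau -powR_exprn ?ler0n// -natrX; apply: ge0_ler_powR => //; rewrite ?nnegrE ?ler0n// ler_nat.
  by apply: fact_le_exp; lia.
Qed.

Let phase_le l k y x : (l <= k.*2)%N -> U x ->
  normc (dirD l.+2 f y x) / (l.+2)`!%:R <= a y * theta k y ^+ l.
Proof.
move=> lk Ux.
apply: le_trans (dirD_gevrey_fact oU l.+2 y (ltW s1) Sf Af0 Bf0 Gf Ux) _.
have -> : a y * theta k y ^+ l = (Af * (b0 * norm1 y) ^+ l.+2) * (2 `^ (s - 1) * tau k ^+ l).
  by rewrite /a /theta (exprMn _ _ (tau k)) -(addn2 l) exprD; ring.
apply: ler_pM; rewrite ?powR_ge0//.
- by rewrite mulr_ge0 ?exprn_ge0 ?mulr_ge0 ?norm1_ge0// ltW.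
- by rewrite ler_wpM2l ?(ltW Af0)// base_le ?(ltW Bf0)// lerDr ltW.
- rewrite /tau -powR_exprn ?ler0n// -natrX -powRM ?ler0n// -natrM.
  apply: ge0_ler_powR => //; rewrite ?nnegrE ?ler0n// ler_nat.
  by apply: fact2_le_exp; lia.
Qed.

Let normc_jet l v y x : normc (jet l v y x) = normc (dirD l v y x) / l`!%:R :> R.
Proof.
by rewrite normcM normcVnat.
Qed.

Local Notation K k y := (phase_poly f x0 k.*2 y).
Local Notation V k y := (amplitude_poly u x0 k.*2 y).

Let K00 k y : (K k y)`_0 = 0.
Proof. by rewrite coef_poly if_same. Qed.

Let Ka k y l : (l < k.*2)%N -> normc (K k y)`_l <= a y * theta k y ^+ l.
Proof.
move=> lk; rewrite coef_poly lk; case: ifP => _.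
  by rewrite normc0 mulr_ge0 ?exprn_ge0.
by rewrite normc_jet phase_le// ltnW.
Qed.

Let Vb k y l : (l < k.*2)%N -> normc (V k y)`_l <= Au * theta k y ^+ l.
Proof. by move=> lk; rewrite coef_poly lk normc_jet amp_le// ltnW. Qed.

Let amp_rem k x : U x ->
  normc (u x - (V k (x - x0)).[1]) <= 2 * (Au * theta k (x - x0) ^+ k.*2).
Proof.
move=> Ux; rewrite horner_poly.
under eq_bigr do rewrite expr1n mulr1.
have fn : 0 < (k.*2)`!%:R :> R by rewrite ltr0n fact_gt0.
rewrite -[X in 2 * X](mulfK (lt0r_neq0 fn)).
apply: (taylor_jets oU starU Su Ux) => x' Ux'.
by rewrite -ler_pdivrMr// amp_le.
Qed.

Let phase_rem k x : U x ->
  normc (g x - (K k (x - x0)).[1]) <= 3 * (a (x - x0) * theta k (x - x0) ^+ k.*2).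
Proof.
move=> Ux; set y := x - x0.
have fn : 0 < ((k.*2).+2)`!%:R :> R by rewrite ltr0n fact_gt0.
have T : normc (f x - \sum_(n < (k.*2).+2) jet n f y x0) <= 2 * (a y * theta k y ^+ k.*2).
  rewrite -[X in 2 * X](mulfK (lt0r_neq0 fn)).
  apply: (taylor_jets oU starU Sf Ux) => x' Ux'.
  by rewrite -ler_pdivrMr// phase_le.
have t0 : 0 <= a y * theta k y ^+ k.*2 by rewrite mulr_ge0 ?exprn_ge0.
have j2 : jet 2 f y x0 = 2^-1 * qform B y.
  by rewrite /jet (dirD2_hessian oU Ux0 Sf) mulrC.
have j0 : jet 0 f y x0 = 0 by rewrite /jet /= f0 mul0r.
have j1 : jet 1 f y x0 = 0.
  by rewrite /jet /= big1 ?mul0r// => i _; rewrite df0 mulr0.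
have gE : g x = f x - jet 2 f y x0 by rewrite cubic_partE -/y j2 mulN1r.
rewrite horner_poly; under eq_bigr do rewrite expr1n mulr1.
rewrite !big_ord_recl /= j0 j1 !add0r in T.
(* For k = 0 the Taylor sum stops before the quadratic term, which is then bounded by one more
   [a y]; this is why the constant is 3 instead of 2. *)
case: k T t0 fn => [|k] T t0 fn.
  rewrite big_ord0 subr0 gE; rewrite big_ord0 subr0 in T.
  have P2 := @phase_le 0 0 y x0 (leqnn _) Ux0.
  rewrite -normc_jet in P2; rewrite (le_trans (normcB _ _))// (le_trans (lerD T P2))//.
  by rewrite double0 expr0; apply: le_of_eq; ring.
rewrite doubleS !big_ord_recl /= add0r in T *.
by rewrite gE -addrA -opprD (le_trans T)// ler_wpM2r// ler_nat.
Qed.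

Section FixedPoint.
Variables (h : R) (k : nat).
Hypothesis h0 : 0 < h.

Let c : R[i] := 'i%C / h%:C%C.
Let A := (h%:C%C * 'i%C)^-1 *: B.
Let E y : R := im (qform B y) / h.

Let normc_c : normc c = h^-1.
Proof.
by rewrite normcM normc_i mul1r -fmorphV normc_real gtr0_norm// invr_gt0.
Qed.

Let re_c z : re (c * z) = - (im z / h). Proof. exact: Re_idiv. Qed.

Let Q0 y : 0 <= im (qform B y).
Proof. by rewrite (le_trans _ (coB y))// mulr_ge0 ?sqnorm_ge0// ltW. Qed.

Let E0 y : 0 <= E y. Proof. by rewrite divr_ge0// ltW. Qed.

Let weightE x : weight A x0 x = cexp (c * (2^-1 * qform B (x - x0))).
Proof. by rewrite /weight /A qformZ inv_realCi; congr cexp; rewrite /c; ring. Qed.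

Let cexp_split x : cexp (c * f x) = weight A x0 x * cexp (c * g x).
Proof. by rewrite weightE -cexpD; congr cexp; rewrite cubic_partE; ring. Qed.

Let im_half (z : R[i]) : im (2^-1 * z) = im z / 2.
Proof.
by rewrite -(rmorph_nat (real_complex R)) -fmorphV ImM /= mul0r addr0 mulrC.
Qed.

Let normc_w x : normc (weight A x0 x) = expR (- (E (x - x0) / 2)).
Proof. by rewrite weightE normc_cexp re_c im_half /E mulrAC. Qed.

Let ratio_le y : h^-1 * a y / (M - 1) <= E y / 16.
Proof.
rewrite ler_pdivrMr// (le_trans (ler_wpM2l _ (a_le y))) ?invr_ge0 ?(ltW h0)//.
by rewrite /E; apply: le_of_eq; ring.
Qed.

Let P y := formal_integrand f u x0 h k.*2 y.
Let Th y := M * theta k y.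

Let Th0 y : 0 <= Th y. Proof. by rewrite mulr_ge0// (le_trans _ M2). Qed.

Let PE y : P y = truncated_exp k.*2 (K k y) (V k y) c. Proof. by []. Qed.

Let szK y : (size (K k y) <= k.*2)%N. Proof. exact: size_poly. Qed.
Let szV y : (size (V k y) <= k.*2)%N. Proof. exact: size_poly. Qed.

Let u_le x : U x -> normc (u x) <= Au.
Proof.
move=> Ux; have := @amp_le 0 k 0 x (leq0n _) Ux.
by rewrite /= divr1 expr0 mulr1.
Qed.

(** The majorized exponential costs 1/16 of the exponent 1/2, leaving 7/16. *)
Lemma formal_integrand_le x :
  normc (P (x - x0) * weight A x0 x) <=
  2 * Au * Num.max 1 (Th (x - x0)) ^+ k.*2 * expR (- (7 / 16 * E (x - x0))).
Proof.
set y := x - x0; rewrite normcM normc_w PE.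
have := truncated_exp_le c (a0 y) (ltW Au0) (theta0 k y) M2 (szK y) (szV y) (K00 k y)
  (@Ka k y) (@Vb k y).
rewrite normc_c -/(Th y) => H.
have H2 : expR (h^-1 * a y / (M - 1)) <= expR (E y / 16) by rewrite ler_expR.
have T0 : 0 <= Num.max 1 (Th y) ^+ k.*2 * (2 * Au).
  by rewrite mulr_ge0 ?exprn_ge0 ?le_max ?ler01// mulr_ge0// ltW.
apply: le_trans (ler_wpM2r (expR_ge0 _) (le_trans H (ler_wpM2l T0 H2))) _.
rewrite -mulrA -expRD (_ : E y / 16 - E y / 2 = - (7 / 16 * E y)); last by field.
by apply: le_of_eq; ring.
Qed.

(** By the choice of U the cubic part costs at most 1/4 of the exponent 1/2. *)
Lemma integrand_le x : U x ->
  normc (cexp (c * f x) * u x) <= Au * expR (- (E (x - x0) / 4)).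
Proof.
move=> Ux; rewrite normcM mulrC ler_pM ?normc_ge0// ?u_le//.
rewrite cexp_split normcM normc_w normc_cexp re_c -expRD ler_expR.
have : - im (g x) <= normc (g x).
  by rewrite (le_trans _ (normr_Im _))// -normrN ler_norm.
move=> h1; have h2 := le_trans h1 (gU Ux).
have h3 : - (im (g x) / h) <= E (x - x0) / 4.
  rewrite -mulNr /E mulrAC ler_wpM2r ?invr_ge0 ?(ltW h0)//.
rewrite (le_trans (lerD (lexx _) h3))// le_of_eq//; by field.
Qed.

(** Three replacements, in turn: g by its truncated phase, u by its truncated amplitude, the
    exponential by [truncated_exp]. Each error is at most exp (5 E / 16) times the power of [Th],
    with constants 6 (M - 1), 2 and 6, and the weight leaves 1/2 - 5/16 = 3/16. *)
Lemma expansion_error_small x : U x -> Th (x - x0) <= 1 ->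
  normc (cexp (c * f x) * u x - P (x - x0) * weight A x0 x) <=
  (6 * (M - 1) + 8) * Au * Th (x - x0) ^+ k.*2 * expR (- (3 / 16 * E (x - x0))).
Proof.
move=> Ux; set y := x - x0 => T1.
have thT : theta k y <= Th y by rewrite ler_peMl// (le_trans _ M2)// ler1n.
have thTn : theta k y ^+ k.*2 <= Th y ^+ k.*2 by rewrite lerXn2r ?nnegrE.
have Tn0 : 0 <= Th y ^+ k.*2 by rewrite exprn_ge0.
have Ey := E0 y.
pose K1 := (K k y).[1]; pose V1 := (V k y).[1].
have K1le : normc (c * K1) <= E y / 16.
  rewrite normcM normc_c (le_trans _ (ratio_le y))// -mulrA ler_wpM2l ?invr_ge0 ?(ltW h0)//.
  rewrite (le_trans (horner1_phase_le (a0 y) (theta0 k y) M2 (szK y) (K00 k y) (@Ka k y) T1))//.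
  by rewrite ler_piMr// divr_ge0// ltW.
have re_le z (e : R) : normc z <= e -> re z <= e.
  by apply: le_trans; rewrite (le_trans (ler_norm _))// normr_Re.
have t1 : normc ((cexp (c * g x) - cexp (c * K1)) * u x) <=
    6 * (M - 1) * Au * Th y ^+ k.*2 * expR (5 / 16 * E y).
  have r1 : re (c * g x) <= E y / 4.
    apply: re_le; rewrite normcM normc_c /E mulrC mulrAC ler_wpM2r ?invr_ge0 ?(ltW h0)//.
    exact: gU.
  have r2 : re (c * K1) <= E y / 4.
    apply: re_le; rewrite (le_trans K1le)// ler_wpM2l// lef_pV2 ?posrE// ler_nat//.
  have d1 : normc (c * g x - c * K1) <= 3 * (M - 1) * (E y / 16) * Th y ^+ k.*2.
    rewrite -mulrBr normcM normc_c (le_trans (ler_wpM2l _ (phase_rem k Ux))) ?invr_ge0 ?(ltW h0)//.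
    have -> : 3 * (M - 1) * (E y / 16) * Th y ^+ k.*2 = 3 * ((M - 1) * (E y / 16) * Th y ^+ k.*2).
      by ring.
    rewrite -/y mulrCA ler_wpM2l// [leLHS]mulrA; apply: ler_pM => //.
    - by rewrite mulr_ge0// invr_ge0 ltW.
    - by rewrite exprn_ge0.
    - by have := ratio_le y; rewrite ler_pdivrMr// [(M - 1) * _]mulrC.
  rewrite normcM; apply: le_trans (ler_pM (normc_ge0 _) (normc_ge0 _) (cexp_lipschitz r1 r2) (u_le Ux)) _.
  (* The difference of the phases carries a factor 1/h through E; a sixteenth of the exponent
     absorbs it. *)
  have e16 : E y / 16 <= expR (E y / 16) by rewrite (le_trans _ (expR_ge1Dx _))// lerDr.
  have -> : 5 / 16 * E y = E y / 16 + E y / 4 by field.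
  rewrite expRD.
  have h1 : normc (c * g x - c * K1) <= 3 * (M - 1) * expR (E y / 16) * Th y ^+ k.*2.
    by rewrite (le_trans d1)// ler_wpM2r// ler_wpM2l// mulr_ge0// ltW.
  have h2 := ler_wpM2r (ltW Au0) (ler_wpM2l (ler0n R 2) (ler_wpM2r (expR_ge0 (E y / 4)) h1)).
  by rewrite (le_trans h2)//; apply: le_of_eq; ring.
have t2 : normc (cexp (c * K1) * (u x - V1)) <= 2 * Au * Th y ^+ k.*2 * expR (5 / 16 * E y).
  rewrite normcM normc_cexp mulrC; apply: ler_pM; rewrite ?normc_ge0 ?expR_ge0//.
    rewrite (le_trans (amp_rem k Ux))// -mulrA ler_wpM2l// ler_wpM2l// ltW//.
  rewrite ler_expR (le_trans (re_le _ _ K1le))//; lra.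
have t3 : normc (cexp (c * K1) * V1 - P y) <= 6 * Au * Th y ^+ k.*2 * expR (5 / 16 * E y).
  rewrite PE (le_trans (cexp_truncated_exp c (a0 y) (ltW Au0) (theta0 k y) M2 (szK y) (szV y) (K00 k y)
    (@Ka k y) (@Vb k y) T1))// ler_wpM2l//.
    by rewrite mulr_ge0// mulr_ge0// ltW.
  by rewrite ler_expR normc_c; have := ratio_le y; lra.
have -> : cexp (c * f x) * u x - P y * weight A x0 x = weight A x0 x *
    ((cexp (c * g x) - cexp (c * K1)) * u x + cexp (c * K1) * (u x - V1) + (cexp (c * K1) * V1 - P y)).
  by rewrite cexp_split; ring.
rewrite normcM normc_w -/y.
have t : normc ((cexp (c * g x) - cexp (c * K1)) * u x + cexp (c * K1) * (u x - V1) + (cexp (c * K1) * V1 - P y))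
    <= (6 * (M - 1) + 8) * Au * Th y ^+ k.*2 * expR (5 / 16 * E y).
  rewrite (le_trans (normcD _ _))// (le_trans (lerD (normcD _ _) (lexx _)))//.
  rewrite (le_trans (lerD (lerD t1 t2) t3))//; apply: le_of_eq; ring.
apply: le_trans (ler_wpM2l (expR_ge0 _) t) _.
rewrite mulrCA -expRD (_ : - (E y / 2) + 5 / 16 * E y = - (3 / 16 * E y)); last by field.
by [].
Qed.

(* Where [Th >= 1] the two terms are bounded separately; where [Th < 1] outside
   [U] the factor [Th ^+ k.*2] is of no use, hence the hypothesis. *)
Lemma expansion_error_pointwise x :
  (~ U x -> Th (x - x0) < 1 -> expR (- (3 / 16 * (lam * sqnorm (x - x0) / h))) <= h ^+ k) ->
  normc ((if x \in U then cexp (c * f x) * u x else 0) - P (x - x0) * weight A x0 x) <=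
  (6 * (M - 1) + 8) * Au * (Th (x - x0) ^+ k.*2 + h ^+ k) *
  expR (- (lam * sqnorm (x - x0) / h / 8)).
Proof.
set y := x - x0 => out.
have hk : 0 <= h ^+ k by rewrite exprn_ge0 ?ltW.
have Ey := E0 y; have Tn0 : 0 <= Th y ^+ k.*2 by rewrite exprn_ge0.
have SE : lam * sqnorm y / h <= E y by rewrite ler_wpM2r ?invr_ge0 ?(ltW h0)// coB.
have S0 : 0 <= lam * sqnorm y / h by rewrite divr_ge0 ?mulr_ge0 ?sqnorm_ge0// ltW.
have ex (p : R) : 8^-1 <= p -> expR (- (p * E y)) <= expR (- (lam * sqnorm y / h / 8)).
  move=> p8; rewrite ler_expR lerN2 (le_trans (_ : _ <= 8^-1 * E y))//.
    by rewrite mulrC ler_wpM2l ?invr_ge0.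
  by rewrite ler_wpM2r.
have X0 : 8 <= 6 * (M - 1) + 8 by rewrite lerDr mulr_ge0// ltW.
have comb (q b e : R) : 0 <= b -> 0 <= e -> q <= 6 * (M - 1) + 8 -> b <= Th y ^+ k.*2 + h ^+ k ->
    8^-1 <= e -> q * Au * b * expR (- (e * E y)) <=
   (6 * (M - 1) + 8) * Au * (Th y ^+ k.*2 + h ^+ k) * expR (- (lam * sqnorm y / h / 8)).
  move=> q0 e0 qX bT e8; apply: le_trans (_ : (6 * (M - 1) + 8) * Au * b * expR (- (e * E y)) <= _).
    by rewrite ler_wpM2r ?expR_ge0// ler_wpM2r// ler_wpM2r// ltW.
  apply: ler_pM; rewrite ?expR_ge0 ?ex//.
    by rewrite mulr_ge0// mulr_ge0 ?(ltW Au0)// (le_trans _ X0).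
  by rewrite ler_wpM2l// mulr_ge0 ?(ltW Au0)// (le_trans _ X0).
have F := formal_integrand_le x; rewrite -/y in F.
have [Ux|nUx] := boolP (x \in U); last first.
  rewrite sub0r normcN (le_trans F)//.
  have [T1|T1] := leP 1 (Th y).
    apply: comb => //; rewrite ?lerDl//; last by lra.
    by rewrite (le_trans _ X0)// ler_nat.
  have out' : expR (- (3 / 16 * (lam * sqnorm y / h))) <= h ^+ k.
    by apply: out => // /mem_set; exact/negP.
  rewrite expr1n mulr1.
  (* The share 3/16 is traded for h^k by the hypothesis on points outside U. *)
  have -> : 7 / 16 * E y = 3 / 16 * E y + 4^-1 * E y by field.
  rewrite opprD expRD mulrA.
  apply: le_trans (_ : 2 * Au * h ^+ k * expR (- (4^-1 * E y)) <= _).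
    rewrite ler_wpM2r ?expR_ge0// ler_wpM2l ?mulr_ge0 ?(ltW Au0)// (le_trans _ out')//.
    by rewrite ler_expR lerN2 ler_wpM2l//.
  apply: comb => //; rewrite ?lerDr//; last by lra.
  by rewrite (le_trans _ X0)// ler_nat.
have {}Ux : U x by rewrite inE in Ux.
have [T1|/ltW T1] := leP (Th y) 1.
  rewrite (le_trans (expansion_error_small Ux T1))//; apply: comb => //; rewrite ?lerDl//.
  by lra.
rewrite (le_trans (normcB _ _))// (le_trans (lerD (integrand_le Ux) F))// -/y.
(* Past the threshold this power is at least 1, so no cancellation between the two terms is
   needed. *)
have T1n : 1 <= Th y ^+ k.*2 by rewrite exprn_ege1.
apply: le_trans (_ : 3 * Au * Th y ^+ k.*2 * expR (- (4^-1 * E y)) <= _); last first.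
  apply: comb => //; rewrite ?lerDl//; last by lra.
  by rewrite (le_trans _ X0)// ler_nat.
have -> : 3 * Au * Th y ^+ k.*2 * expR (- (4^-1 * E y)) =
    Au * Th y ^+ k.*2 * expR (- (4^-1 * E y)) + 2 * Au * Th y ^+ k.*2 * expR (- (4^-1 * E y)).
  by ring.
apply: lerD.
  by rewrite [E y / 4]mulrC ler_wpM2r ?expR_ge0// ler_peMr// ltW.
rewrite (max_r T1) ler_wpM2l ?mulr_ge0 ?(ltW Au0)// ler_expR lerN2 ler_wpM2r//; lra.
Qed.

End FixedPoint.

Let M0 : 0 <= M. Proof. exact: le_trans M2. Qed.

Definition error_factor k : R := (M * (Bu + Bf) * tau k) ^+ k.*2 *
  (d%:R ^+ k * k`!%:R * (16 / lam) ^+ k).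

(** Half of the decay lam / (8 h) is spent pointwise on |y|^(2 k), producing k! (16 h / lam)^k; the
    other half stays for the integration. *)
Lemma theta_expR (h : R) k y : 0 < h ->
  (M * theta k y) ^+ k.*2 * expR (- (lam * sqnorm y / h / 8)) <=
  error_factor k * h ^+ k * expR (- (lam / (16 * h)) * sqnorm y).
Proof.
move=> h0; set S := sqnorm y; have S0 : 0 <= S by exact: sqnorm_ge0.
have c0 : 0 < lam / (16 * h) by rewrite divr_gt0 ?mulr_gt0.
have p0 : 0 <= M * (Bu + Bf) * tau k.
  exact: mulr_ge0 (mulr_ge0 M0 (addr_ge0 (ltW Bu0) (ltW Bf0))) (powR_ge0 _ _).
have -> : M * theta k y = M * (Bu + Bf) * tau k * norm1 y.
  by rewrite /theta /b0; ring.
have h1 : norm1 y ^+ k.*2 <= d%:R ^+ k * (k`!%:R / (lam / (16 * h)) ^+ k * expR (lam / (16 * h) * S)).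
  rewrite -muln2 mulnC exprM (le_trans (_ : _ <= (d%:R * S) ^+ k))//.
    by rewrite lerXn2r ?nnegrE ?exprn_ge0 ?norm1_ge0 ?mulr_ge0// norm1_le_sqnorm.
  by rewrite exprMn ler_wpM2l ?exprn_ge0// expr_le_expR.
rewrite /error_factor; move: (M * _ * _) p0 => p p0.
rewrite exprMn -[leLHS]mulrA.
have -> : p ^+ k.*2 * (d%:R ^+ k * k`!%:R * (16 / lam) ^+ k) * h ^+ k * expR (- (lam / (16 * h)) * S) =
  p ^+ k.*2 * (d%:R ^+ k * k`!%:R * (16 / lam * h) ^+ k * expR (- (lam / (16 * h)) * S)).
  by rewrite [(_ * h) ^+ k]exprMn; ring.
rewrite ler_wpM2l ?exprn_ge0//.
apply: le_trans (ler_wpM2r (expR_ge0 _) h1) _.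
have -> : - (lam / (16 * h)) * S = lam / (16 * h) * S - lam * S / h / 8.
  by field; rewrite lt0r_neq0.
rewrite expRD -exprVn (_ : (lam / (16 * h))^-1 = 16 / lam * h); last by field; rewrite !lt0r_neq0.
by apply: le_of_eq; ring.
Qed.

Lemma expansion_error (h : R) k : 0 < h ->
  (forall x, ~ U x -> M * theta k (x - x0) < 1 ->
     expR (- (3 / 16 * (lam * sqnorm (x - x0) / h))) <= h ^+ k) ->
  normc (oscillatory_integral h U f u - stationary_expansion h k f u x0) <=
  2 * ((6 * (M - 1) + 8) * Au * (error_factor k + 1) * h ^+ k *
    Num.sqrt (pi / (lam / (16 * h))) ^+ d).
Proof.
move=> h0 out; set A := (h%:C%C * 'i%C)^-1 *: B.
have c0 : 0 < lam / (16 * h) by rewrite divr_gt0 ?mulr_gt0.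
have lh : 0 < lam / h by rewrite divr_gt0.
have [cA sE] := sqrt_det_hessian x0 h0 (hessian_sym oU Ux0 Sf) lam0 coB.
pose G x := cexp ('i%C / h%:C%C * f x) * u x.
pose GU x := if x \in U then G x else 0.
pose Pw x := formal_integrand f u x0 h k.*2 (x - x0) * weight A x0 x.
have -> : stationary_expansion h k f u x0 = cint Pw.
  rewrite /stationary_expansion sE.
  by rewrite (cint_formal_integrand oU Ux0 Sf Su f0 df0 k h0 lh cA).
have -> : oscillatory_integral h U f u = cint GU by exact: cintegral_cint.
have domP : gauss_dom x0 Pw.
  exact: (gauss_dom_formal_integrand oU Ux0 Sf Su f0 df0 h k.*2 lh cA).
have domG : gauss_dom x0 GU.
  split.
    apply: (cmeasurable_restrict oU) => x Ux.
    have [cu1 cu2 _] := Su nil Ux; have [cf1 cf2 _] := Sf nil Ux.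
    apply: ccontinuous_atM; last by split.
    apply: ccontinuous_at_cexp; apply: ccontinuous_atM; last by split.
    exact: ccontinuous_cst.
  exists (lam / h / 4), Au; split; first by rewrite divr_gt0.
  move=> x; rewrite /GU; case: ifPn => [xU|_]; last first.
    by rewrite normc0 mulr_ge0 ?expR_ge0// ltW.
  have Ux : U x by rewrite inE in xU.
  rewrite (le_trans (integrand_le k h0 Ux))//.
  rewrite ler_wpM2l ?(ltW Au0)// ler_expR.
  have := coB (x - x0); rewrite -(ler_pM2r (_ : 0 < h^-1 / 4)) ?divr_gt0 ?invr_gt0//.
  by rewrite mulNr lerN2 => H; rewrite (le_trans _ (le_trans H _))//; apply: le_of_eq; ring.
have -> : cint GU - cint Pw = cint (fun x => GU x + -1 * Pw x).
  by rewrite (cintD domG (gauss_domZ (-1) domP)) (cintZ (-1) domP) mulN1r.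
apply: (cint_le (x0 := x0) c0).
  exact: (gauss_domD domG (gauss_domZ (-1) domP)).1.
move=> x; rewrite mulN1r.
have H := expansion_error_pointwise h0 (out x).
apply: le_trans H _ => /=.
set X := (6 * _ + 8) * Au.
have X0 : 0 <= X.
  rewrite mulr_ge0 ?(ltW Au0)// addr_ge0// mulr_ge0// subr_ge0 (le_trans _ M2)// ler1n//.
have T := theta_expR k (x - x0) h0.
have comb (t e1 e2 : R) : t * e1 <= error_factor k * h ^+ k * e2 -> e1 <= e2 ->
    X * (t + h ^+ k) * e1 <= X * (error_factor k + 1) * h ^+ k * e2.
  move=> te e12; rewrite -[leRHS]mulrA -[leRHS]mulrA -[leLHS]mulrA ler_wpM2l//.
  rewrite [leLHS]mulrDl [leRHS]mulrDl mul1r [X in _ <= X + _]mulrA; apply: lerD => //.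
  by rewrite ler_wpM2l ?exprn_ge0 ?(ltW h0).
apply: (comb _ _ _ T); rewrite ler_expR.
have S0 := sqnorm_ge0 (x - x0).
rewrite mulNr lerN2.
have -> : lam / (16 * h) * sqnorm (x - x0) = lam * sqnorm (x - x0) / h / 16.
  by field; rewrite lt0r_neq0.
by rewrite ler_wpM2l ?divr_ge0 ?mulr_ge0 ?(ltW h0) ?(ltW lam0)// lef_pV2 ?posrE// ler_nat.
Qed.

End Pointwise.

Lemma powR_ge1 (R : realType) (x r : R) : 1 <= x -> 0 <= r -> 1 <= x `^ r.
Proof.
move=> x1 r0; rewrite [leLHS](_ : 1 = 1 `^ r); last by rewrite powR1.
apply: ge0_ler_powR => //; rewrite ?nnegrE//.
exact: le_trans x1.
Qed.

Lemma majorant_ratio_ge2 (R : realType) (d : nat) (s Bu Af Bf lam : R) :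
  0 < Bu -> 0 < Af -> 0 < Bf -> 0 < lam -> 2 <= majorant_ratio d s Bu Af Bf lam.
Proof.
move=> Bu0 Af0 Bf0 lam0; rewrite lerDl divr_ge0 ?(ltW lam0)// mulr_ge0//.
by rewrite !mulr_ge0// ?powR_ge0 ?exprn_ge0 ?addr_ge0// ltW.
Qed.

Section ErrorConstant.
Variables (R : realType) (d : nat) (s : R).
Hypothesis s1 : 1 < s.

Definition error_base (Bu Af Bf lam : R) : R :=
  (majorant_ratio d s Bu Af Bf lam * (Bu + Bf)) ^+ 2 * 2 `^ (2 * (s - 1)) * d%:R * (16 / lam).

(** A product of factors at least 1, so that its power k + 1 absorbs those independent of k as well.
    It involves [lam] because the Gevrey constants, being upper bounds, do not control Im f''(x0)
    from below. *)
Definition expansion_const (Au Bu Af Bf lam : R) : R :=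
  (1 + 4 * ((6 * (majorant_ratio d s Bu Af Bf lam - 1) + 8) * Au * Num.sqrt (16 * pi / lam) ^+ d)) *
  (1 + error_base Bu Af Bf lam) * expR 1 `^ (2 * (s - 1)).

(** A form of Stirling's bound, (k + 1)^k <= k! e^(k + 1), raised to the power 2 (s - 1). *)
Lemma tau_le k : tau s k ^+ k.*2 <=
  (2 `^ (2 * (s - 1))) ^+ k * k`!%:R `^ (2 * (s - 1)) * (expR 1 `^ (2 * (s - 1))) ^+ k.+1.
Proof.
set t := 2 * (s - 1); have t0 : 0 <= t by rewrite mulr_ge0// subr_ge0 ltW.
have -> : tau s k ^+ k.*2 = ((2 * k.+1)%:R ^+ k) `^ t.
  rewrite powR_exprn// -muln2 mulnC exprM; congr (_ ^+ k).
  by rewrite /tau -powR_mulrn ?powR_ge0// -powRrM mulrC.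
have e0 : 0 <= expR 1 :> R by exact: expR_ge0.
rewrite -powR_exprn// -(powR_exprn _ k.+1 e0) -powRM ?exprn_ge0// -powRM ?mulr_ge0 ?exprn_ge0//.
apply: ge0_ler_powR => //; rewrite ?nnegrE ?mulr_ge0 ?exprn_ge0//.
rewrite natrM exprMn -mulrA ler_wpM2l ?exprn_ge0//.
have := expr_le_expR k (a := 1) ltr01 (ler0n R k.+1).
by rewrite expr1n divr1 [1 * _]mulrC expRM_natl.
Qed.

Lemma error_factor_le k (Bu Af Bf lam : R) : 0 < Bu -> 0 < Af -> 0 < Bf -> 0 < lam ->
  error_factor d s Bu Af Bf lam k <=
  error_base Bu Af Bf lam ^+ k * (expR 1 `^ (2 * (s - 1))) ^+ k.+1 * k`!%:R `^ (2 * s - 1).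
Proof.
move=> Bu0 Af0 Bf0 lam0; rewrite /error_factor /error_base.
set M := majorant_ratio _ _ _ _ _ _; set t := 2 * (s - 1).
have fk : 0 < k`!%:R :> R by rewrite ltr0n fact_gt0.
(* The power 2 (s - 1) of k! comes from the jets, the extra 1 from the Gaussian moments. *)
have -> : 2 * s - 1 = t + 1 :> R by rewrite /t; ring.
rewrite powRD ?(lt0r_neq0 fk) ?implybT// powRr1 ?(ltW fk)//.
have M0 : 0 <= M by exact: le_trans (majorant_ratio_ge2 d s Bu0 Af0 Bf0 lam0).
rewrite exprMn.
have D0 : 0 <= d%:R ^+ k * k`!%:R * (16 / lam) ^+ k :> R.
  by rewrite !mulr_ge0 ?exprn_ge0 ?divr_ge0 ?(ltW lam0).
have MB : 0 <= (M * (Bu + Bf)) ^+ k.*2.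
  exact: exprn_ge0 _ (mulr_ge0 M0 (addr_ge0 (ltW Bu0) (ltW Bf0))).
rewrite (le_trans (ler_wpM2r D0 (ler_wpM2l MB (tau_le k))))// -/t.
rewrite -muln2 mulnC exprM !exprMn; apply: le_of_eq; ring.
Qed.

Lemma expansion_const_le (Au Bu Af Bf lam h : R) k :
  0 < Au -> 0 < Bu -> 0 < Af -> 0 < Bf -> 0 < lam -> 0 < h ->
  2 * ((6 * (majorant_ratio d s Bu Af Bf lam - 1) + 8) * Au *
    (error_factor d s Bu Af Bf lam k + 1) * h ^+ k * Num.sqrt (pi / (lam / (16 * h))) ^+ d) <=
  expansion_const Au Bu Af Bf lam ^+ k.+1 * k`!%:R `^ (2 * s - 1) * h `^ (k%:R + d%:R / 2).
Proof.
move=> Au0 Bu0 Af0 Bf0 lam0 h0.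
have EF := error_factor_le k Bu0 Af0 Bf0 lam0.
rewrite /expansion_const; set M := majorant_ratio _ _ _ _ _ _ in EF *.
set Q := error_base _ _ _ _ in EF *; set E := expR 1 `^ _ in EF *.
set F := _ `^ (2 * s - 1) in EF *; set G := Num.sqrt (16 * pi / lam) ^+ d.
have -> : Num.sqrt (pi / (lam / (16 * h))) ^+ d = G * Num.sqrt h ^+ d.
  rewrite -exprMn -sqrtrM ?divr_ge0 ?mulr_ge0 ?pi_ge0 ?(ltW lam0)//; congr (Num.sqrt _ ^+ d).
  by field; rewrite !lt0r_neq0.
have -> : h `^ (k%:R + d%:R / 2) = h ^+ k * Num.sqrt h ^+ d.
  rewrite powRD ?(lt0r_neq0 h0) ?implybT// powR_mulrn ?(ltW h0)//; congr (_ * _).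
  by rewrite mulrC powRrM powR12_sqrt ?(ltW h0)// powR_mulrn ?sqrtr_ge0.
have M2 : 2 <= M by exact: majorant_ratio_ge2.
have M1 : 0 <= M - 1 by rewrite subr_ge0 (le_trans _ M2)// ler1n.
have G0 : 0 <= G by rewrite exprn_ge0 ?sqrtr_ge0.
set Y := (6 * (M - 1) + 8) * Au; have Y0 : 0 <= Y.
  by rewrite mulr_ge0 ?(ltW Au0)// addr_ge0// mulr_ge0.
have Q0 : 0 <= Q.
  rewrite /Q /error_base; apply: mulr_ge0; last by rewrite divr_ge0 ?(ltW lam0).
  by rewrite mulr_ge0// mulr_ge0 ?powR_ge0 ?sqr_ge0.
have t0 : 0 <= 2 * (s - 1) by rewrite mulr_ge0// subr_ge0 ltW.
have E1 : 1 <= E.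
  by apply: powR_ge1 => //; rewrite (le_trans _ (expR_ge1Dx 1))// lerDl.
have F1 : 1 <= F.
  by apply: powR_ge1; [rewrite ler1n fact_gt0|have := s1; lra].
have E0 : 0 <= E by rewrite (le_trans ler01).
have F0 : 0 <= F by rewrite (le_trans ler01).
have K1 : 0 <= 1 + 4 * (Y * G) by rewrite addr_ge0// mulr_ge0// mulr_ge0.
have step : error_factor d s Bu Af Bf lam k + 1 <= 2 * ((1 + Q) ^+ k * E ^+ k.+1 * F).
  have P1 : 1 <= (1 + Q) ^+ k * E ^+ k.+1 * F.
    have P2 : 1 <= (1 + Q) ^+ k by rewrite exprn_ege1// lerDl.
    have P3 : 1 <= E ^+ k.+1 by rewrite exprn_ege1.
    by rewrite mulr_ege1// mulr_ege1.
  rewrite mulr_natl mulr2n lerD// (le_trans EF)//.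
  rewrite ler_wpM2r// ler_wpM2r ?exprn_ge0// lerXn2r ?nnegrE ?addr_ge0// lerDr//.
have R0 : 0 <= h ^+ k * Num.sqrt h ^+ d by rewrite mulr_ge0 ?exprn_ge0 ?sqrtr_ge0 ?ltW.
apply: le_trans (_ : (4 * (Y * G)) * ((1 + Q) ^+ k * E ^+ k.+1 * F) * (h ^+ k * Num.sqrt h ^+ d) <= _).
  have := ler_wpM2r R0 (ler_wpM2l (mulr_ge0 (ler0n R 2) (mulr_ge0 Y0 G0)) step).
  congr (_ <= _); ring.
rewrite ler_wpM2r// mulrA ler_wpM2r// !exprMn.
rewrite mulrA ler_wpM2r ?exprn_ge0//; apply: ler_pM.
- by rewrite mulr_ge0// mulr_ge0.
- by rewrite exprn_ge0// addr_ge0.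
- rewrite exprS (le_trans (_ : _ <= 1 + 4 * (Y * G)))// ?lerDr// ler_peMr// exprn_ege1// lerDl mulr_ge0// mulr_ge0//.
- by rewrite exprS ler_peMl ?exprn_ge0 ?addr_ge0// lerDl.
Qed.

(* Only finitely many [k] satisfy [b * tau s k < 1]. *)
Lemma small_parameter (c b : R) : 0 < c -> 0 < b ->
  exists2 h0 : R, 0 < h0 & forall (h : R) k, 0 < h -> h < h0 -> b * tau s k < 1 ->
    expR (- (c / h)) <= h ^+ k.
Proof.
move=> c0 b0; have sp : 0 < s - 1 by rewrite subr_gt0.
(* The solution of b z^(s - 1) = 1; once 2 (k + 1) exceeds it, b tau >= 1. *)
pose z := b^-1 `^ (s - 1)^-1; have z0 : 0 <= z by exact: powR_ge0.
pose k0 := (Num.truncn z).+1.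
have zk : z < k0%:R by rewrite /k0 truncnS_gt.
have big k : (k0 <= k)%N -> 1 <= b * tau s k.
  move=> k0k; rewrite mulrC -ler_pdivrMr// mul1r.
  have -> : b^-1 = z `^ (s - 1).
    by rewrite /z -powRrM mulVf ?lt0r_neq0// powRr1 ?invr_ge0 ?ltW.
  apply: ge0_ler_powR; rewrite ?nnegrE ?(ltW sp)// (le_trans (ltW zk))// ler_nat; lia.
have fk : 0 < k0`!%:R :> R by rewrite ltr0n fact_gt0.
have ck : 0 < c ^+ k0 by rewrite exprn_gt0.
(* Since exp (c / h) >= (c / h)^k0 / k0!, such h satisfy h <= h^k0 exp (c / h), that is exp (- c /
   h) <= h^(k0 - 1), which is at most h^k for every k < k0. *)
exists (Num.min 1 (c ^+ k0 / k0`!%:R)); first by rewrite lt_min ltr01 divr_gt0.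
move=> h k h0; rewrite lt_min => /andP[h1 h2] bk.
have kk : (k < k0)%N by rewrite ltnNge; apply/negP => /big; rewrite leNgt bk.
have := expr_le_expR k0 c0 (ltW (_ : 0 < h^-1)); rewrite invr_gt0 => /(_ h0) H.
have e0 : 0 < expR (c / h) := expR_gt0 _.
rewrite expRN -[leLHS]mul1r ler_pdivrMr//.
have hk : 0 < h ^+ k0 by rewrite exprn_gt0.
have H2 : c ^+ k0 / k0`!%:R <= h ^+ k0 * expR (c / h).
  have := ler_wpM2l (mulr_ge0 (ltW hk) (divr_ge0 (ltW ck) (ltW fk))) H.
  rewrite exprVn; move: (h ^+ k0) (c ^+ k0) (k0`!%:R : R) (expR _) hk ck fk => p q r t p0 q0 r0.
  by congr (_ <= _); field; rewrite !lt0r_neq0.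
have H3 : h <= h ^+ k0 * expR (c / h) by rewrite (le_trans (ltW h2)).
have H4 : h ^+ k0 <= h * h ^+ k.
  by rewrite -exprS ler_wiXn2l// ltW.
rewrite -(ler_pM2l h0) mulr1 (le_trans H3)// mulrA ler_wpM2r// ltW.
Qed.

End ErrorConstant.

(** * Choice of the neighborhood *)

Section Neighborhood.
Variables (R : realType) (d : nat).
Implicit Types (x y : 'rV[R]_d) (B : 'M[R[i]]_d).

Lemma im_qformE B y : im (qform B y) = (y *m map_mx im B *m y^T) 0 0.
Proof.
rewrite /qform exchange_big Im_sum mxE /=; apply: eq_bigr => p _.
rewrite !mxE mulr_suml Im_sum; apply: eq_bigr => q _.
by rewrite !mxE mulrAC -rmorphM ImM /= mul0r addr0 mulrAC.
Qed.

Lemma im_posdef_coercive B : posdef (map_mx im B) ->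
  exists2 lam : R, 0 < lam & forall y, lam * sqnorm y <= im (qform B y).
Proof.
move=> pB.
have E (z : R[i]) : re (- 'i%C * z) = im z by rewrite ReM /= oppr0 mul0r sub0r mulN1r opprK.
have [|lam l0 cB] := @posdef_coercive R d (- 'i%C *: B).
  rewrite (_ : map_mx _ _ = map_mx im B)//.
  by apply/matrixP => p q; rewrite !mxE E.
by exists lam => // y; have := cB y; rewrite qformZ E.
Qed.

Lemma ball_star x0 (r : R) x (t : R) : ball x0 r x -> 0 <= t <= 1 ->
  ball x0 r (x0 + t *: (x - x0)).
Proof.
move=> /rV_ballP[r0 H] /andP[t0 t1]; apply/rV_ballP; split=> // i; rewrite !mxE.
rewrite opprD addNKr normrN normrM (ger0_norm t0) distrC.
by rewrite (le_lt_trans _ (H i))// ler_piMl.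
Qed.

Lemma norm1_ball x0 (r : R) x : ball x0 r x -> norm1 (x - x0) <= d%:R * r.
Proof.
move=> /rV_ballP[r0 H]; rewrite /norm1 (le_trans (_ : _ <= \sum_(i < d) r))//.
  by apply: ler_sum => i _; rewrite !mxE distrC ltW.
by rewrite sumr_const card_ord mulr_natl.
Qed.

Lemma closed_box_compact x0 (e : R) : compact [set x : 'rV[R]_d | forall i, `|x0 0 i - x 0 i| <= e].
Proof.
rewrite (_ : [set x | _] = [set x : 'rV[R]_d | forall i, `[x0 0 i - e, x0 0 i + e]%classic (x 0 i)]).
  by apply: (@rV_compact R d (fun i => `[x0 0 i - e, x0 0 i + e]%classic)) => i; exact: segment_compact.
apply/seteqP; split=> x /= H i; have := H i; rewrite /= in_itv /= ler_distlC//.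
Qed.

(** Third-order Taylor: |g| is at most a constant times |y|^3, hence at most r |y|^2 up to a
    constant, which a small radius r puts below lam |y|^2 / 4. *)
Lemma small_cubic_ball (s : R) (W : set 'rV[R]_d) (f : 'rV[R]_d -> R[i]) x0 : 1 < s -> open W ->
  gevrey s W f -> W x0 -> f x0 = 0 -> (forall i, pderiv i f x0 = 0) ->
  posdef (map_mx im (hessian f x0)) ->
  exists2 r : R, 0 < r & rel_compact_in (ball x0 r) W /\
    forall x, ball x0 r x -> normc (cubic_part f x0 x) <= im (qform (hessian f x0) (x - x0)) / 4.
Proof.
move=> s1 oW [Sf Gf] Wx0 f0 df0 pB.
have [lam l0 cB] := im_posdef_coercive pB.
have /nbhs_ballP[e /= e0 eW] : nbhs x0 W by exact: open_nbhs_nbhs.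
pose K := [set x : 'rV[R]_d | forall i, `|x0 0 i - x 0 i| <= e / 2].
have cK : compact K by exact: closed_box_compact.
have KW : K `<=` W.
  move=> x Kx; apply: eW; apply/rV_ballP; split=> // i.
  by rewrite (le_lt_trans (Kx i))// ltr_pdivrMr// ltr_pMr// ltr1n.
have [A [b [A0 b0 GK]]] := Gf K cK KW.
pose D : R := A * b ^+ 3 * (3`!)%:R `^ s.
have D0 : 0 <= D by rewrite !mulr_ge0 ?powR_ge0 ?exprn_ge0 ?ltW.
have q0 : 0 < d%:R ^+ 2 * D + 1 by rewrite ltr_wpDl// mulr_ge0 ?exprn_ge0.
(* The first bound keeps the closed ball in a compact box inside W, where the Gevrey bound is
   available; the second makes the cubic part small against the quadratic one. *)
pose r := Num.min (e / 2) (lam / (4 * (d%:R ^+ 2 * D + 1))).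
have r0 : 0 < r by rewrite lt_min !divr_gt0// mulr_gt0.
have UK x : ball x0 r x -> K x.
  move=> /rV_ballP[_ H] i; rewrite (le_trans (ltW (H i)))// ge_min lexx//.
have clK : closure (ball x0 r) `<=` K.
  have clo : closed K by apply: compact_closed => //; exact: norm_hausdorff.
  by rewrite [X in _ `<=` X](iffLR (closure_id K) clo); apply: closureS.
have UW x : ball x0 r x -> W x by move=> /UK/KW.
exists r => //; split.
  split; last exact: subset_trans KW.
  by apply: subclosed_compact clK => //; exact: closed_closure.
move=> x Ux; set y := x - x0; set S := sqnorm y.
have S0 : 0 <= S by exact: sqnorm_ge0.
have Uo : open (ball x0 r) by exact: ball_open.
have Sf' : smooth_on (ball x0 r) f by move=> l z Uz; exact/Sf/UW.
have Ux0 : ball x0 r x0 by exact: ballxx.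
have T : normc (f x - \sum_(n < 3) jet n f y x0) <= 2 * (norm1 y ^+ 3 * D / 3`!%:R).
  apply: (taylor_jets Uo (@ball_star x0 r) Sf' Ux) => x' Ux'.
  exact: (dirD_gevrey 3 _ oW Sf (UW _ Ux') (UK _ Ux') (ltW (lt_trans ltr01 s1)) A0 b0 GK).
have j2 : jet 2 f y x0 = 2^-1 * qform (hessian f x0) y.
  by rewrite /jet (dirD2_hessian oW Wx0 Sf) mulrC.
have gE : cubic_part f x0 x = f x - \sum_(n < 3) jet n f y x0.
  rewrite cubic_partE -/y !big_ord_recl big_ord0 addr0 mulN1r -j2.
  rewrite {2}/jet /= f0 mul0r add0r {2}/jet /=.
  by rewrite big1 ?mul0r ?add0r// => i _; rewrite df0 mulr0.
rewrite gE (le_trans T)//.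
have n3 : norm1 y ^+ 3 <= d%:R * r * (d%:R * S).
  by rewrite exprS; apply: ler_pM; rewrite ?norm1_ge0 ?exprn_ge0 ?norm1_ge0// ?norm1_ball// norm1_le_sqnorm.
have rq : r * (4 * (d%:R ^+ 2 * D + 1)) <= lam.
  by rewrite -ler_pdivlMr ?mulr_gt0// ge_min lexx orbT.
have h1 : 2 * (norm1 y ^+ 3 * D / 3`!%:R) <= lam * S / 4.
  apply: le_trans (_ : 2 * (d%:R * r * (d%:R * S) * D / 3`!%:R) <= _).
    by rewrite ler_wpM2l// ler_wpM2r ?invr_ge0// ler_wpM2r.
  rewrite ler_pdivlMr//; apply: le_trans (ler_wpM2r S0 rq).
  have -> : r * (4 * (d%:R ^+ 2 * D + 1)) * S = d%:R ^+ 2 * r * S * D * 4 + 4 * r * S by ring.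
  have X0 : 0 <= d%:R ^+ 2 * r * S * D by rewrite !mulr_ge0 ?exprn_ge0// ltW.
  have -> : 2 * (d%:R * r * (d%:R * S) * D / 3`!%:R) * 4 = d%:R ^+ 2 * r * S * D * (4 / 3).
    by rewrite (_ : 3`! = 6)%N//; field.
  rewrite -[leLHS]addr0 lerD ?mulr_ge0 ?(ltW r0)// ler_wpM2l//.
  by rewrite ler_pdivrMr// -natrM ler_nat.
rewrite (le_trans h1)// ler_wpM2r ?invr_ge0//; exact: cB.
Qed.

End Neighborhood.

Theorem theorem2p5 (R : realType) (d : nat) (s : R) (s_gt1 : 1 < s) :
  exists Cst : R -> R -> R -> R -> R -> R,
  forall (W : set 'rV[R]_d) (u f : 'rV[R]_d -> R[i]) (x0 : 'rV[R]_d),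
    open W -> gevrey s W u -> gevrey s W f -> W x0 ->
    f x0 = 0 ->
    (forall i : 'I_d, pderiv i f x0 = 0) ->
    posdef (map_mx (@complex.Im R) (hessian f x0)) ->
  exists U : set 'rV[R]_d,
    [/\ open U, U x0, rel_compact_in U W &
    forall Au Bu Af Bf lam : R,
      gevrey_b_with s U u Au Bu ->
      gevrey_b_with s U f Af Bf ->
      0 < lam ->
      (forall v : 'rV[R]_d, lam * (v *m v^T) 0 0 <=
         (v *m map_mx (@complex.Im R) (hessian f x0) *m v^T) 0 0) ->
    exists2 h0 : R, 0 < h0 &
    forall (h : R) (k : nat), 0 < h -> h < h0 ->
      `|oscillatory_integral h U f u - stationary_expansion h k f u x0| <=
        real_complex R (Cst Au Bu Af Bf lam ^+ k.+1 *
          (k`!)%:R `^ (2 * s - 1) * h `^ (k%:R + d%:R / 2))].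
Proof.
exists (expansion_const d s) => W u f x0 oW Gu Gf Wx0 f0 df0 pB.
have [r r0 [UW gU]] := small_cubic_ball s_gt1 oW Gf Wx0 f0 df0 pB.
have Uo : open (ball x0 r) by exact: ball_open.
have Ux0 : ball x0 r x0 by exact: ballxx.
exists (ball x0 r); split=> // Au Bu Af Bf lam [Su Au0 Bu0 GuU] [Sf Af0 Bf0 GfU] lam0 cB.
have coB y : lam * sqnorm y <= im (qform (hessian f x0) y) by rewrite im_qformE sqnormE; exact: cB.
have M2 := majorant_ratio_ge2 d s Bu0 Af0 Bf0 lam0.
set M := majorant_ratio _ _ _ _ _ _ in M2.
have M0 : 0 < M by exact: lt_le_trans M2.
(* Outside the ball |y|^2 >= r^2, so this constant over h bounds from below the exponent to be
   compared with h^k. *)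
have c0 : 0 < 3 / 16 * (lam * r ^+ 2) by rewrite !mulr_gt0 ?invr_gt0 ?exprn_gt0.
have b0 : 0 < M * (Bu + Bf) * r by rewrite !mulr_gt0// addr_gt0.
have [h0 h00 H] := small_parameter s_gt1 c0 b0.
exists h0 => // h k hp hlt.
rewrite -[`|_|]/((normc _)%:C%C) lecR.
apply: le_trans (expansion_const_le d s_gt1 k Au0 Bu0 Af0 Bf0 lam0 hp).
apply: (expansion_error s_gt1 Uo Ux0 (@ball_star R d x0 r) Su Sf Au0 Bu0 Af0 Bf0 lam0 GuU GfU f0 df0 coB gU hp).
move=> x nUx Th1; set y := x - x0 in Th1 *.
have [i ri] : exists i, r <= `|y 0 i|.
  apply: contrapT => nex; apply: nUx; apply/rV_ballP; split=> // i.
  rewrite ltNge; apply/negP => h1; apply: nex; exists i.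
  by rewrite /y !mxE distrC.
have ny : r <= norm1 y by rewrite (le_trans ri)// le_norm1.
have Sy : r ^+ 2 <= sqnorm y.
  rewrite (le_trans _ (coord_le_sqnorm y i))// -[y 0 i ^+ 2]real_normK ?num_real//.
  by rewrite lerXn2r ?nnegrE// ltW.
(* Outside the ball also [norm1 y >= r], which turns the condition on the point into one on k alone;
   the threshold h0 can then be chosen before h and k. *)
have Th2 : M * (Bu + Bf) * r * tau s k < 1.
  rewrite (le_lt_trans _ Th1)// /theta -!mulrA ler_wpM2l ?(ltW M0)// ler_wpM2l ?addr_ge0 ?(ltW Bu0) ?(ltW Bf0)//.
  by rewrite ler_wpM2r// powR_ge0.
apply: le_trans (H h k hp hlt Th2); rewrite ler_expR lerN2 -[leLHS]mulrA ler_wpM2l//.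
by rewrite ler_wpM2r ?invr_ge0 ?(ltW hp)// ler_wpM2l// ltW.
Qed.
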